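(* Let $0<\alpha_0<1$ and suppose $f\in W^{1,1}(0,T)$. Then the variable-exponent Abel integral equation $$(k*u)(t)=f(t),\quad t\in[0,T],$$ admits a unique solution $u\in L^1(0,T)$, and $$\|u\|_{L^1(0,T)}\le Q\|f\|_{W^{1,1}(0,T)}.$$ If further $f\in W^{1,\frac1{\alpha_0-\sigma}}(0,T)$ for $0<\sigma\ll\alpha_0$, then $$|u(t)|\le Q|f(0)|\,t^{\alpha_0-1}+Q\|f'\|_{L^{\frac1{\alpha_0-\sigma}}(0,T)},\quad t\in(0,T].$$ Here $Q>0$ denotes constants independent of $f$, $u$ and $t$.
   Context: $T>0$. The variable exponent $\alpha:[0,T]\to\mathbb R$ satisfies $0<\alpha(t)<1$ on $[0,T]$ and is three times differentiable with $|\alpha'(t)|+|\alpha''(t)|+|\alpha'''(t)|\le L$ on $[0,T]$ for some $L>0$; $\alpha_0:=\alpha(0)$. The kernel is $k(t):=\frac{t^{-\alpha(t)}}{\Gamma(1-\alpha(t))}$ and $(k*u)(t)=\int_0^tk(t-s)u(s)\,ds$. The notation $0<\sigma\ll\alpha_0$ means that $\sigma$ is a positive number that is sufficiently small compared with $\alpha_0$. Functions in $L^1(0,T)$ are identified up to null sets. *)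

(* Defs.v *)
From HB Require Import structures.
From mathcomp Require Import all_boot all_order all_algebra.
From mathcomp Require Import all_classical all_reals all_analysis.

Set Implicit Arguments.
Unset Strict Implicit.
Unset Printing Implicit Defensive.

Import Order.TTheory GRing.Theory Num.Theory.
Import numFieldNormedType.Exports.

Local Open Scope classical_set_scope.
Local Open Scope ring_scope.

Section Defs.
Context {R : realType}.
Local Notation mu := (@lebesgue_measure R).
Implicit Types (T p t x : R) (f g u phi alpha : R -> R) (D : set R).

(* Functions on (0, T) are total functions R -> R whose values outside
   ]0, T[ are ignored: Lebesgue norms are taken after extension by 0. *)

Definition in_Lp T p f : Prop := (f \_ `]0, T[) \in Lfun mu p%:E.

Definition Lp_norm T p f : \bar R := 'N[mu]_p%:E[EFin \o (f \_ `]0, T[)].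

Definition eq_ae T f g : Prop := {ae mu, forall t, t \in `]0, T[ -> f t = g t}.

Definition test_function T phi : Prop :=
  (forall n x, derivable (phi^`(n))%classic x 1) /\
  (exists a b : R, [/\ 0 < a, b < T & forall x, phi x != 0 -> a <= x <= b]).

Definition is_weak_derivative T f g : Prop :=
  [/\ locally_integrable `]0, T[ f, locally_integrable `]0, T[ g &
      forall phi, test_function T phi ->
        \int[mu]_(x in `]0, T[) (f x * (phi^`())%classic x) =
        - \int[mu]_(x in `]0, T[) (g x * phi x)].

Definition in_W1p T p f : Prop :=
  in_Lp T p f /\ exists2 g, is_weak_derivative T f g & in_Lp T p g.

(* A chosen representative of the weak derivative, which is unique up to null
   sets; 0 if there is none. *)
Definition weak_derivative T f : R -> R :=
  xget (cst 0) [set g | is_weak_derivative T f g].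

Definition W1p_norm T p f : \bar R :=
  (Lp_norm T p f + Lp_norm T p (weak_derivative T f))%E.

(* f(0) for f in W^{1,p}(0, T): the value at 0 of the representative of f that
   is continuous on [0, T] (default 0 if there is none). *)
Definition value_at0 T f : R :=
  xget 0 [set c | exists g, [/\ {within `[0, T], continuous g},
                                eq_ae T f g & g 0 = c]].

(* g is the derivative of f on D, relative to D: one-sided at an endpoint of
   an interval. *)
Definition is_derivative_on D f g : Prop :=
  forall t, D t ->
    (x - t)^-1 * (f x - f t) @[x --> within D t^'] --> g t.

Definition Gamma x : R := \int[mu]_(s in `]0, +oo[) (s `^ (x - 1) * expR (- s)).

Definition kernel alpha t : R := t `^ (- alpha t) / Gamma (1 - alpha t).

Definition convolution (k u : R -> R) t : R :=
  \int[mu]_(s in `[0, t]) (k (t - s) * u s).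

(* (k * u)(t) = f(t) as an equality of elements of L^1(0, T); it cannot be
   required at t = 0, where the left-hand side is 0. *)
Definition Abel_solution T alpha f u : Prop :=
  in_Lp T 1 u /\ eq_ae T (convolution (kernel alpha) u) f.

End Defs.

(* Main.v *)
Require Import Defs.
From HB Require Import structures.
From mathcomp Require Import all_boot all_order all_algebra.
From mathcomp Require Import all_classical all_reals all_analysis.
From mathcomp Require Import measurable_realfun.
From mathcomp Require Import ring lra.

(** Let [a := alpha 0] and let [b(t) = t^(a-1)] be the power conjugate to the
    singularity of the kernel.  On [(0, T)] the kernel factors as
    [k(t) = t^(-a) h(t)] with [h = exp((a - alpha(t)) ln t) / Gamma(1 - alpha(t))].
    As [a - alpha(t)] is at most [L t] in absolute value, [h] is continuous with
    [h(0) > 0], and its derivative has only a logarithmic singularity at 0,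
    which is less than a constant times [t^(-1/2)] ([regular_factor'_le]).  The
    scaling [s = t z] in the convolution then gives
    [(b * k)(t) = int_0^1 (1-z)^(a-1) z^(-a) h(tz) dz], and hence, with [1] for
    the unit step,
    [b * k = gam (1 + 1 * G)], where [gam = h(0) Beta(a, 1-a) > 0] and
    [|G(t)| <= C t^(-1/2)] ([kernel_factorization]).

    A function [f] with an integrable weak derivative [g] is, up to null sets,
    [c + 1 * g] ([weak_derivative_primitive]).  Convolving [k * u = f] with [b]
    turns it into [gam 1 * (u + G * u) = 1 * (c b + b * g)].  Convolution with
    [1] is injective by Lebesgue's differentiation theorem, and convolution with
    [b] is injective because a further convolution with [t^(-a)] makes it a
    multiple of convolution with [1].  So the equation of the first kind is
    equivalent to the Volterra equation of the second kind
    [u + G * u = gam^-1 (c b + b * g)] ([abel_equiv]).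

    Multiplication by [exp(-l t)] commutes with convolution and makes the norm
    of [G] smaller than [1/2] for a large [l]; the contraction principle then
    solves the Volterra equation and bounds the solution by the right-hand side
    in [L^1] ([volterra_exists], [volterra_bound]).  As [b] is integrable and
    [|c|] is bounded by the norms of [f] and [g] ([initial_value_le]), this
    gives existence, uniqueness and the first estimate ([abel_L1],
    [abel_unique]).

    For the pointwise estimate, [c = f(0)], and [b * g] is bounded by the
    [L^p] norm of [g] by Hoelder's inequality, as [p = 1/(a - sigma)] exceeds
    [1/a] ([convol_powT_hoelder]).  So [|u|] is at most [A + C t^(-1/2) * |u|]
    with [A] a multiple of [|c| t^(a-1)] plus a constant.  Inserting this bound
    into itself replaces the singular kernel by [t^(-1/2) * t^(-1/2)], which is
    a constant, so that the term in [|u|] becomes a multiple of the [L^1] norm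
    of [u] ([bootstrap], [abel_pointwise]). *)

Set Implicit Arguments.
Unset Strict Implicit.
Unset Printing Implicit Defensive.

Import Order.TTheory GRing.Theory Num.Theory.
Import numFieldNormedType.Exports.

Local Open Scope classical_set_scope.
Local Open Scope ring_scope.

(** * Affine changes of variables in Lebesgue integrals *)

Section affine.
Context {R : realType}.
Local Notation mu := (@lebesgue_measure R).

Let aff (a b : R) : measurableTypeR R -> measurableTypeR R :=
  fun x => a * x + b.

Lemma measurable_affine (a b : R) : measurable_fun setT (aff a b).
Proof.
apply: measurable_funD => //; apply: measurable_funM => //.
Qed.

Let affine_pushforward (a b : R) : {measure set (measurableTypeR R) -> \bar R}.
Proof.
unshelve refine (pushforward mu (aff a b) : {measure set _ -> \bar R}).
exact: measurable_affine.
Defined.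

Let affine_measure (a b : R) : {measure set (measurableTypeR R) -> \bar R} :=
  mscale (NngNum (normr_ge0 a)) (affine_pushforward a b).

Let affine_measureE a b A :
  affine_measure a b A = (`|a|%:E * mu (aff a b @^-1` A))%E.
Proof. by []. Qed.

(** Lebesgue measure is determined by its values on half-open intervals,
    where the claim is elementary. *)
Lemma lebesgue_measure_affine (a b : R) (A : set R) : a != 0 -> measurable A ->
  mu A = (`|a|%:E * pushforward mu (aff a b) A)%E.
Proof.
move=> a0 mA.
have ma := @measurable_affine a b.
have /(_ A mA) -> // : forall A, measurable A -> mu A = affine_measure a b A.
  move=> {mA}A mA; apply: lebesgue_measure_unique mA => _ [[p q]] _ <-.
rewrite affine_measureE.
have [apos|aneg|a00] := ltgtP 0 a; last by rewrite -a00 eqxx in a0.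
- have -> : aff a b @^-1` `]p, q] = [set` `](p - b) / a, (q - b) / a]].
    apply/seteqP; split => x; rewrite /= !in_itv/= /aff ltr_pdivrMr// ler_pdivlMr//;
    by rewrite ltrBlDr lerBrDr (mulrC x).
  rewrite !lebesgue_measure_itv/= !lte_fin ltr_pM2r ?invr_gt0// ltrD2r.
  case: ifPn => _; last by rewrite mule0.
  rewrite -!EFinB -EFinM gtr0_norm//; congr EFin; field; exact: lt0r_neq0.
- have -> : aff a b @^-1` `]p, q] = [set` `[(q - b) / a, (p - b) / a[].
    apply/seteqP; split => x; rewrite /= !in_itv/= /aff ler_ndivrMr// ltr_ndivlMr//;
    by rewrite ltrBlDr lerBrDr (mulrC x) andbC.
  rewrite !lebesgue_measure_itv/= !lte_fin ltr_nM2r ?invr_lt0// ltrD2r.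
  case: ifPn => _; last by rewrite mule0.
  rewrite -!EFinB -EFinM ltr0_norm//; congr EFin; field; exact: ltr0_neq0.
Qed.

Lemma ge0_integral_affine (a b : R) (f : R -> \bar R) : a != 0 ->
  measurable_fun [set: R] f -> (forall x, 0 <= f x)%E ->
  (\int[mu]_x f x = `|a|%:E * \int[mu]_x f (a * x + b)%R)%E.
Proof.
move=> a0 mf f0.
have ma := @measurable_affine a b.
have := @ge0_integral_pushforward _ _ _ _ _ (aff a b) ma mu setT f measurableT mf
  (fun y _ => f0 y).
rewrite preimage_setT => E.
rewrite (@eq_measure_integral _ _ _ setT (affine_measure a b)); last first.
  by move=> A mA _; exact: lebesgue_measure_affine.
rewrite ge0_integral_mscale //=; congr (_ * _)%E; exact: E.
Qed.

Lemma integrable_affine (a b : R) (f : R -> R) : a != 0 ->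
  mu.-integrable setT (EFin \o f) ->
  mu.-integrable setT (EFin \o (fun x => f (a * x + b))).
Proof.
move=> a0 /integrableP[mf lf]; apply/integrableP; split.
  apply/measurable_EFinP; move/measurable_EFinP : mf => mf.
  exact: (measurableT_comp mf (measurable_affine a b)).
have mabs : measurable_fun [set: R] (fun x => `|(f x)%:E|%E).
  exact: (measurableT_comp (@abse_measurable R setT) mf).
move: lf; rewrite (@ge0_integral_affine a b)//=.
have na : (0 < `|a|)%R by rewrite normr_gt0.
case: (\int[mu]_x _)%E => [r|//|//]; first by rewrite !ltry.
by rewrite mulry gtr0_sg// mul1e.
Qed.

Lemma integral_affine (a b : R) (f : R -> R) : a != 0 ->
  mu.-integrable setT (EFin \o f) ->
  \int[mu]_x f x = `|a| * \int[mu]_x f (a * x + b).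
Proof.
move=> a0 intf; have intg := integrable_affine b a0 intf.
have mf := measurable_int mu intf.
rewrite /Rintegral integralE [in RHS]integralE.
rewrite (@ge0_integral_affine a b)//; last exact: measurable_funepos.
rewrite [X in (_ - X)%E](@ge0_integral_affine a b)//; last exact: measurable_funeneg.
have P1 := integrable_pos_fin_num measurableT intg.
have P2 := integrable_neg_fin_num measurableT intg.
move: P1 P2; set A := (\int[mu]_x _^\+ x)%E; set B := (\int[mu]_x _^\- x)%E.
move=> P1 P2; transitivity (fine (`|a|%:E * A - `|a|%:E * B)%E).
  by congr (fine (_ * _ - _ * _)%E); apply: eq_integral => x _;
    rewrite ?funeposE ?funenegE.
rewrite -muleBr ?fin_num_adde_defr//.
by rewrite fineM// fin_numB P1 P2.
Qed.

End affine.

(** * Convolution of integrable functions on the line *)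

Section L1.
Context {R : realType}.
Local Notation mu := (@lebesgue_measure R).
Implicit Types (f g h : R -> R) (t T : R).

Lemma ae_impl (P Q : R -> Prop) : (forall x, P x -> Q x) ->
  {ae mu, forall x, P x} -> {ae mu, forall x, Q x}.
Proof. by move=> PQ; exact: (@filterS _ _ (ae_filter_ringOfSetsType mu)  _ _ PQ). Qed.

Lemma ae_impl2 (P Q S : R -> Prop) : (forall x, P x -> Q x -> S x) ->
  {ae mu, forall x, P x} -> {ae mu, forall x, Q x} -> {ae mu, forall x, S x}.
Proof. by move=> PQ; exact: (@filterS2 _ _ (ae_filter_ringOfSetsType mu) _  _ _ PQ). Qed.

Lemma ae_impl3 (P Q S U : R -> Prop) :
  (forall x, P x -> Q x -> S x -> U x) ->
  {ae mu, forall x, P x} -> {ae mu, forall x, Q x} -> {ae mu, forall x, S x} ->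
  {ae mu, forall x, U x}.
Proof. by move=> PQ; exact: (@filterS3 _ _ (ae_filter_ringOfSetsType mu) _ _  _ _ PQ). Qed.

Definition L1 f : Prop := mu.-integrable setT (EFin \o f).

Lemma L1_measurable f : L1 f -> measurable_fun setT f.
Proof. by move=> /(measurable_int mu)/measurable_EFinP. Qed.

Lemma L1_le f g : measurable_fun setT f -> (forall x, `|f x| <= `|g x|) ->
  L1 g -> L1 f.
Proof.
move=> mf fg; apply: le_integrable => //; first exact/measurable_EFinP.
by move=> x _; rewrite /= lee_fin.
Qed.

Lemma L1D f g : L1 f -> L1 g -> L1 (fun x => f x + g x).
Proof. by move=> lf lg; exact: (integrableD measurableT lf lg). Qed.

Lemma L1B f g : L1 f -> L1 g -> L1 (fun x => f x - g x).
Proof. by move=> lf lg; exact: (integrableB measurableT lf lg). Qed.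

Lemma L1Z c f : L1 f -> L1 (fun x => c * f x).
Proof. by move=> lf; exact: (integrableZl measurableT c lf). Qed.

Lemma L1_abs f : L1 f -> L1 (fun x => `|f x|).
Proof. exact: integrable_norm. Qed.

Lemma ae_reflect (P : R -> Prop) t : {ae mu, forall x, P x} ->
  {ae mu, forall x, P (t - x)}.
Proof.
move=> [N [mN N0 PN]].
have neg1 : (-1 : R) != 0 by rewrite oppr_eq0 oner_eq0.
(* The reflection of a null set is a null set. *)
exists ((fun x => t - x) @^-1` N); split.
- rewrite -[X in measurable X]setTI.
  by apply: (measurable_funB (measurable_cst t) (@measurable_id _ _ setT)).
- have := lebesgue_measure_affine t neg1 mN; rewrite N0 normrN1 mul1e /pushforward.
  move=> ->; congr (mu _); apply/seteqP; split => x /=;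
  by rewrite mulN1r addrC.
- by move=> x /= h; exact: PN.
Qed.

Lemma ae_eq_Rintegral f g : measurable_fun setT f -> measurable_fun setT g ->
  {ae mu, forall x, f x = g x} -> \int[mu]_x f x = \int[mu]_x g x.
Proof.
move=> mf mg fg; congr fine; apply: ae_eq_integral => //; first 2 last.
- by apply: ae_impl fg => x /= -> _.
- exact/measurable_EFinP.
- exact/measurable_EFinP.
Qed.

(** Where the integrand is not integrable the value is meaningless; for
    integrable [f] and [g] this happens on a null set of [t], so the identities
    between convolutions are stated almost everywhere. *)
Definition convol f g t : R := \int[mu]_s (f (t - s) * g s).

Lemma measurable_convol_integrand f g :
  measurable_fun setT f -> measurable_fun setT g ->
  measurable_fun setT (fun z : R * R => f (z.1 - z.2) * g z.2).
Proof.
move=> mf mg; apply: measurable_funM.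
  apply: (measurableT_comp mf); apply: measurable_funB => //.
exact: (measurableT_comp mg).
Qed.

Lemma integral_abs_reflect f (y : R) : measurable_fun setT f ->
  (\int[mu]_x `|f (x - y)|%:E = \int[mu]_x `|f x|%:E)%E.
Proof.
move=> mf; rewrite [RHS](@ge0_integral_affine _ 1 (- y))//.
- by rewrite normr1 mul1e; apply: eq_integral => x _; rewrite mul1r.
- by apply/measurable_EFinP; exact: measurableT_comp.
Qed.

(** Integrate in [t] first and use the invariance under translations.
    The finiteness of the right-hand side is what makes convolution meaningful
    on integrable functions, and it yields the norm inequality. *)
Lemma convol_tonelli f g : measurable_fun setT f -> measurable_fun setT g ->
  (\int[mu]_t \int[mu]_s `|f (t - s) * g s|%:E =
   (\int[mu]_x `|f x|%:E) * (\int[mu]_x `|g x|%:E))%E.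
Proof.
move=> mf mg.
have mfg := measurable_convol_integrand mf mg.
rewrite (fubini_tonelli (fun z : measurableTypeR R * measurableTypeR R =>
   `|f (z.1 - z.2) * g z.2|%:E)) //=; last first.
  by apply/measurable_EFinP; exact: measurableT_comp.
rewrite -ge0_integralZl//; first last.
- exact: integral_ge0.
- by apply/measurable_EFinP; exact: measurableT_comp.
apply: eq_integral => y _.
rewrite -(integral_abs_reflect y mf) -ge0_integralZr//.
- by apply: eq_integral => x _; rewrite normrM EFinM.
- apply/measurable_EFinP; apply: measurableT_comp => //.
  apply: measurableT_comp => //; exact: measurable_funB.
Qed.

Lemma L1_abs_lty f : L1 f -> (\int[mu]_x `|f x|%:E < +oo)%E.
Proof. by move=> /integrableP[]. Qed.

Lemma convol_integrable2 f g : L1 f -> L1 g ->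
  (mu \x mu)%E.-integrable setT
     (EFin \o (fun z : R * R => f (z.1 - z.2) * g z.2)).
Proof.
move=> lf lg; have [mf mg] := (L1_measurable lf, L1_measurable lg).
apply/integrable12ltyP.
  by apply/measurable_EFinP; exact: measurable_convol_integrand.
rewrite /= convol_tonelli// lte_mul_pinfty// ?L1_abs_lty//.
  exact: integral_ge0.
by rewrite ge0_fin_numE ?L1_abs_lty//; exact: integral_ge0.
Qed.

Lemma convol_ae_integrable f g : L1 f -> L1 g ->
  {ae mu, forall t, L1 (fun s => f (t - s) * g s)}.
Proof. by move=> lf lg; exact: (ae_integrable1 (convol_integrable2 lf lg)). Qed.

Section iterated.
Context (K : R * R -> R).
Context (iK : (mu \x mu)%E.-integrable setT (EFin \o K)).

Lemma measurable_section1 : measurable_fun setT (fun x => \int[mu]_y K (x, y)).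
Proof. exact: (measurableT_comp (@fine_measurable R setT measurableT) (measurable_fubini_F iK)). Qed.

Lemma measurable_section2 : measurable_fun setT (fun y => \int[mu]_x K (x, y)).
Proof. exact: (measurableT_comp (@fine_measurable R setT measurableT) (measurable_fubini_G iK)). Qed.

Lemma ae_section1 : {ae mu, forall x,
  (\int[mu]_y K (x, y))%:E = (\int[mu]_y (K (x, y))%:E)%E}.
Proof.
apply: ae_impl (ae_integrable1 iK) => x ix; rewrite /Rintegral fineK//.
exact: integrable_fin_num.
Qed.

Lemma ae_section2 : {ae mu, forall y,
  (\int[mu]_x K (x, y))%:E = (\int[mu]_x (K (x, y))%:E)%E}.
Proof.
apply: ae_impl (ae_integrable2 iK) => x ix; rewrite /Rintegral fineK//.
exact: integrable_fin_num.
Qed.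

Lemma L1_section1 : L1 (fun x => \int[mu]_y K (x, y)).
Proof.
apply: le_integrable (integrable_fubini_F iK) => //.
  by apply/measurable_EFinP; exact: measurable_section1.
have le_fine (e : \bar R) : (`|(fine e)%:E| <= `|e|)%E.
  by case: e => [r|/=|/=]; rewrite ?lee_fin ?normr0 ?leey.
by move=> x _; exact: le_fine.
Qed.

(** Fubini's theorem for the real-valued integral: the sections that are not
    integrable, where that integral is 0 by convention, form a null set. *)
Lemma Rfubini :
  \int[mu]_x \int[mu]_y K (x, y) = \int[mu]_y \int[mu]_x K (x, y).
Proof.
rewrite [LHS]/Rintegral [RHS]/Rintegral; congr fine.
transitivity (\int[mu]_x \int[mu]_y (K (x, y))%:E)%E.
  apply: ae_eq_integral => //.
  - by apply/measurable_EFinP; exact: measurable_section1.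
  - exact: (measurable_fubini_F iK).
  - by apply: ae_impl ae_section1 => x /= -> _.
rewrite (Fubini iK); symmetry; apply: ae_eq_integral => //.
- by apply/measurable_EFinP; exact: measurable_section2.
- exact: (measurable_fubini_G iK).
- by apply: ae_impl ae_section2 => x /= -> _.
Qed.

End iterated.

Lemma L1_convol f g : L1 f -> L1 g -> L1 (convol f g).
Proof. by move=> lf lg; exact: (L1_section1 (convol_integrable2 lf lg)). Qed.

Lemma convolC f g t : L1 (fun s => f (t - s) * g s) -> convol f g t = convol g f t.
Proof.
move=> li; rewrite /convol (integral_affine t (@ltr0_neq0 R (-1) ltac:(lra)) li).
rewrite normrN1 mul1r; apply: eq_Rintegral => s _.
by rewrite mulrC; congr (g _ * f _); ring.
Qed.

Lemma ae_convolC f g : L1 f -> L1 g -> {ae mu, forall t, convol f g t = convol g f t}.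
Proof.
by move=> lf lg; apply: ae_impl (convol_ae_integrable lf lg) => t; exact: convolC.
Qed.

Lemma ae_convolDr f g h : L1 f -> L1 g -> L1 h ->
  {ae mu, forall t, convol f (fun s => g s + h s) t = convol f g t + convol f h t}.
Proof.
move=> lf lg lh.
apply: ae_impl2 (convol_ae_integrable lf lg) (convol_ae_integrable lf lh) => t ig ih.
by rewrite /convol -RintegralD//; apply: eq_Rintegral => s _; rewrite mulrDr.
Qed.

Lemma ae_convolBr f g h : L1 f -> L1 g -> L1 h ->
  {ae mu, forall t, convol f (fun s => g s - h s) t = convol f g t - convol f h t}.
Proof.
move=> lf lg lh.
apply: ae_impl2 (convol_ae_integrable lf lg) (convol_ae_integrable lf lh) => t ig ih.
by rewrite /convol -RintegralB//; apply: eq_Rintegral => s _; rewrite mulrBr.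
Qed.

Lemma ae_convolZr c f g : L1 f -> L1 g ->
  {ae mu, forall t, convol f (fun s => c * g s) t = c * convol f g t}.
Proof.
move=> lf lg; apply: ae_impl (convol_ae_integrable lf lg) => t ig.
by rewrite /convol -RintegralZl//; apply: eq_Rintegral => s _; rewrite mulrCA.
Qed.

Lemma ae_norm_convol f g : L1 f -> L1 g ->
  {ae mu, forall t, `|convol f g t| <= convol (fun s => `|f s|) (fun s => `|g s|) t}.
Proof.
move=> lf lg; apply: ae_impl (convol_ae_integrable lf lg) => t ig.
apply: le_trans (le_normr_Rintegral measurableT ig) _.
by rewrite /convol; under eq_Rintegral do rewrite normrM.
Qed.

Definition norm1 f : R := \int[mu]_x `|f x|.

Lemma norm1E f : L1 f -> (norm1 f)%:E = (\int[mu]_x `|f x|%:E)%E.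
Proof.
move=> lf; rewrite /norm1 /Rintegral fineK//.
by rewrite ge0_fin_numE ?L1_abs_lty//; exact: integral_ge0.
Qed.

Lemma norm1_ge0 f : 0 <= norm1 f.
Proof. exact: Rintegral_ge0. Qed.

Lemma le_norm1_convol f g : L1 f -> L1 g -> norm1 (convol f g) <= norm1 f * norm1 g.
Proof.
move=> lf lg; rewrite -lee_fin EFinM !norm1E//; last exact: L1_convol.
have [mf mg] := (L1_measurable lf, L1_measurable lg).
have mcv := L1_measurable (L1_convol lf lg).
rewrite -convol_tonelli//; apply: ae_ge0_le_integral => //.
- by apply/measurable_EFinP; exact: measurableT_comp.
- by move=> *; exact: integral_ge0.
- apply: (measurable_fun_fubini_tonelli_F (fun z : measurableTypeR R * measurableTypeR R =>
   `|f (z.1 - z.2) * g z.2|%:E)%E) => //=.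
  apply/measurable_EFinP; apply: measurableT_comp => //.
  exact: measurable_convol_integrand.
apply: ae_impl (convol_ae_integrable lf lg) => t ig _.
rewrite EFin_normr_Rintegral//; exact: (le_abse_integral _ _ (measurable_int mu ig)).
Qed.

(** The iterated integral of the absolute values is
    [|f| * (|g| * |h|)], which is finite at almost every [t]. *)
Lemma convol_integrable3 f g h : L1 f -> L1 g -> L1 h ->
  {ae mu, forall t, (mu \x mu)%E.-integrable setT
     (EFin \o (fun z : R * R => f (t - z.1) * (g (z.1 - z.2) * h z.2)))}.
Proof.
move=> lf lg lh.
have mf := L1_measurable lf; have mg := L1_measurable lg.
have mh := L1_measurable lh.
have lgh := convol_integrable2 (L1_abs lg) (L1_abs lh).
apply: ae_impl (convol_ae_integrable (L1_abs lf) (L1_convol (L1_abs lg) (L1_abs lh))).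
move=> t it.
apply/integrable12ltyP.
  apply/measurable_EFinP; apply: measurable_funM.
    apply: (measurableT_comp mf); exact: measurable_funB.
  exact: measurable_convol_integrand.
apply: le_lt_trans (L1_abs_lty it); apply: ae_ge0_le_integral => //.
- by move=> *; exact: integral_ge0.
- apply: (measurable_fun_fubini_tonelli_F (fun z : measurableTypeR R * measurableTypeR R =>
   `|f (t - z.1) * (g (z.1 - z.2) * h z.2)|%:E)%E) => //=.
  apply/measurable_EFinP; apply: measurableT_comp => //.
  apply: measurable_funM.
    apply: (measurableT_comp mf); exact: measurable_funB.
  exact: measurable_convol_integrand.
- by apply/measurable_EFinP; apply: measurableT_comp => //; exact: L1_measurable it.
apply: ae_impl (ae_section1 lgh) => s /= Hs _.
rewrite normrM normr_id EFinM.
rewrite (@ger0_norm _ (convol _ _ _)); last first.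
  by apply: Rintegral_ge0 => x _; rewrite mulr_ge0.
rewrite [X in (_ <= _ * X)%E]Hs -ge0_integralZl//; last first.
- apply/measurable_EFinP; apply: measurable_funM; apply: measurableT_comp => //.
  by apply: (measurableT_comp mg); exact: measurable_funB.
rewrite le_eqVlt; apply/orP; left; apply/eqP; apply: eq_integral => y _.
by rewrite -EFinM !normrM.
Qed.

(** Exchange the two integrations at the points where the triple product is
    integrable, and translate the inner variable. *)
Lemma ae_convolA f g h : L1 f -> L1 g -> L1 h ->
  {ae mu, forall t, convol (convol f g) h t = convol f (convol g h) t}.
Proof.
move=> lf lg lh.
have lfg := convol_ae_integrable lf lg.
have mf := L1_measurable lf; have mg := L1_measurable lg.
have mh := L1_measurable lh.
apply: ae_impl (convol_integrable3 lf lg lh) => t it.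
transitivity (\int[mu]_q \int[mu]_s (f (t - q) * (g (q - s) * h s))); last first.
  apply: ae_eq_Rintegral.
  - exact: (measurable_section1 it).
  - apply: measurable_funM; last exact: L1_measurable (L1_convol lg lh).
    by apply: (measurableT_comp mf); exact: measurable_funB.
  apply: ae_impl (convol_ae_integrable lg lh) => q iq.
  by rewrite RintegralZl.
rewrite (Rfubini it); apply: ae_eq_Rintegral.
- apply: measurable_funM => //; apply: (measurableT_comp (L1_measurable (L1_convol lf lg))).
  exact: measurable_funB.
- exact: (measurable_section2 it).
have /(ae_reflect t) lfgt := lfg.
apply: ae_impl lfgt => s is_.
rewrite /convol (integral_affine (- s) (oner_neq0 R) is_) normr1 mul1r.
rewrite -RintegralZr//; last exact: (integrable_affine (- s) (oner_neq0 R) is_).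
apply: eq_Rintegral => q _ /=; rewrite mulrA; congr (f _ * g _ * _); ring.
Qed.

End L1.

(** * Causal functions and equality almost everywhere on an interval *)

Section truncation.
Context {R : realType}.
Local Notation mu := (@lebesgue_measure R).
Implicit Types (f g h u : R -> R) (t T : R).

Definition causal f : Prop := forall x, x <= 0 -> f x = 0.

Lemma truncE T f t : (f \_ `]0, T[) t = if 0 < t < T then f t else 0.
Proof.
rewrite patchE; have [/set_mem|] := boolP (t \in _).
  by rewrite /= in_itv/= => ->.
by move=> /negP h; case: ifPn => // ht; exfalso; apply: h; rewrite inE/= in_itv.
Qed.

Lemma causal_trunc T f : causal (f \_ `]0, T[).
Proof. by move=> x x0; rewrite truncE ltNge x0. Qed.

Lemma eqT_ae T f g : {ae mu, forall t, f t = g t} -> eq_ae T f g.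
Proof. exact: ae_impl. Qed.

Lemma eqT_sym T f g : eq_ae T f g -> eq_ae T g f.
Proof. by apply: ae_impl => t fg /fg. Qed.

Lemma eqT_trans T g f h : eq_ae T f g -> eq_ae T g h -> eq_ae T f h.
Proof. by apply: ae_impl2 => t fg gh tT; rewrite fg// gh. Qed.

Lemma eqT_fun T f g : (forall t, 0 < t < T -> f t = g t) -> eq_ae T f g.
Proof. by move=> fg; apply: aeW => t; rewrite in_itv/=; exact: fg. Qed.

Lemma eqT_trunc T f : eq_ae T (f \_ `]0, T[) f.
Proof. by apply: eqT_fun => t tT; rewrite truncE tT. Qed.

Lemma causal_convol f g : causal f -> causal g -> causal (convol f g).
Proof.
move=> cf cg t t0; rewrite /convol (@eq_Rintegral _ _ _ _ _ (cst 0)).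
  by rewrite Rintegral_cst// mul0r.
move=> s _; rewrite /=; have [s0|s0] := leP s 0; first by rewrite cg// mulr0.
by rewrite cf ?mul0r//; lra.
Qed.

Lemma measurable_convol_section f g t : measurable_fun setT f ->
  measurable_fun setT g -> measurable_fun [set: R] (fun s => f (t - s) * g s).
Proof.
move=> mf mg; apply: measurable_funM => //.
by apply: (measurableT_comp mf); exact: measurable_funB.
Qed.

(** For causal factors [convol f g t] depends only on the values of the
    factors between 0 and [t]; this is why the equation makes sense on [(0, T)]
    alone. *)
Lemma convol_eqT T f f' g g' t : measurable_fun setT f -> measurable_fun setT f' ->
  measurable_fun setT g -> measurable_fun setT g' ->
  causal f -> causal f' -> causal g -> causal g' ->
  eq_ae T f f' -> eq_ae T g g' -> t < T -> convol f g t = convol f' g' t.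
Proof.
move=> mf mf' mg mg' cf cf' cg cg' /(ae_reflect t) ff' gg' tT.
apply: ae_eq_Rintegral.
- exact: measurable_convol_section.
- exact: measurable_convol_section.
apply: ae_impl2 ff' gg' => s fs gs.
have [s0|s0] := leP s 0; first by rewrite cg// cg'// !mulr0.
have [st|st] := leP t s; first by rewrite cf ?cf' ?mul0r//; lra.
by rewrite fs ?gs// in_itv/=; lra.
Qed.

Lemma eqT_convol T f f' g g' : L1 f -> L1 f' -> L1 g -> L1 g' ->
  causal f -> causal f' -> causal g -> causal g' ->
  eq_ae T f f' -> eq_ae T g g' -> eq_ae T (convol f g) (convol f' g').
Proof.
move=> lf lf' lg lg' cf cf' cg cg' ff' gg'; apply: eqT_fun => t /andP[_ tT].
by apply: (convol_eqT _ _ _ _ cf cf' cg cg' ff' gg') => //; exact: L1_measurable.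
Qed.

(** An open interval is not a null set; this is how points with good
    properties are picked below. *)
Lemma ae_ex_itv (P : R -> Prop) (a b : R) : a < b -> {ae mu, forall x, P x} ->
  exists2 x, a < x < b & P x.
Proof.
move=> ab [N [mN N0 PN]]; apply: contrapT => nex.
have sub : `]a, b[%classic `<=` N.
  move=> x; rewrite /= in_itv/= => xab; apply: PN => /= Px.
  by apply: nex; exists x.
have : (mu `]a, b[%classic <= mu N)%E by apply: le_measure; rewrite ?inE.
rewrite lebesgue_measure_itv/= lte_fin ab N0 -EFinB lee_fin.
lra.
Qed.

Lemma L1_restrict (D : set R) f : measurable D ->
  mu.-integrable D (EFin \o f) <-> L1 (f \_ D).
Proof.
move=> mD; rewrite /L1 -restrict_EFin.
exact: (@integrable_mkcond _ _ R mu D (EFin \o f) mD).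
Qed.

Lemma L1_cst_itv (a b c : R) : L1 ((cst c : R -> R) \_ `]a, b[).
Proof.
apply/(L1_restrict (cst c) (measurable_itv `]a, b[)).
apply/integrableP; split; first exact/measurable_EFinP/measurable_cst.
rewrite (eq_integral (cst `|c|%:E))// integral_cst//=.
by rewrite lebesgue_measure_itv/=; case: ifP => // _; rewrite -?EFinB -?EFinM ?ltry ?mule0.
Qed.

(** Convolution with it is integration from 0; the truncation at [T] keeps it
    integrable. *)
Definition one T : R -> R := (cst 1 : R -> R) \_ `]0, T[.

Lemma L1_one T : L1 (one T).
Proof. exact: L1_cst_itv. Qed.

Lemma convol_oneE T u t : L1 u -> causal u -> t < T ->
  convol (one T) u t = \int[mu]_(s in `]-oo, t]) u s.
Proof.
move=> lu cu tT; rewrite [RHS]Rintegral_mkcond; apply: ae_eq_Rintegral.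
- by apply: measurable_convol_section; [exact: L1_measurable (L1_one T)|exact: L1_measurable].
- apply: (measurable_restrictT u (measurable_itv `]-oo, t])).1.
  by apply: measurable_funTS; exact: L1_measurable.
exists [set t]; split => //; first exact: lebesgue_measure_set1.
move=> s /= h; apply: contrapT => st; apply: h.
rewrite patchE /one truncE.
have [s0|s0] := leP s 0; first by rewrite cu// mulr0; case: ifP.
have [ts|ts] := ltP t s.
  rewrite ifF; last by apply/negbTE; rewrite negb_and; lra.
  by rewrite mul0r ifF//; apply: memNset; rewrite /= in_itv/=; lra.
have {}ts : s < t by rewrite lt_neqAle ts andbT; apply/eqP.
by rewrite ifT; [rewrite mul1r ifT//; apply: mem_set; rewrite /= in_itv/=; lra|lra].
Qed.

(** The primitive of an integrable function determines it: by Lebesgue's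
    theorem the function is almost everywhere the derivative of its primitive,
    and a difference quotient that vanishes on a dense set has limit 0. *)
Lemma convol_one_inj T u : L1 u -> causal u ->
  eq_ae T (convol (one T) u) (cst 0) -> eq_ae T u (cst 0).
Proof.
move=> lu cu H0.
have iu y : mu.-integrable `]-oo, y] (EFin \o u) by exact: integrableS lu.
have locu : locally_integrable [set: R] u.
  by apply: open_integrable_locally => //; exact: openT.
have := FTC1Ny iu locu.
apply: ae_impl => x /=; set F := (fun x => \int[mu]_(_ in _) _) => -[dF F'x] xT.
have {}H0 : {ae mu, forall t, t \in `]0, T[ -> F t = 0}.
  apply: ae_impl H0 => t h tT; rewrite -[RHS](h tT) convol_oneE//.
  by move: tT; rewrite in_itv/= => /andP[].
have dense (e : R) : 0 < e -> exists2 y, x < y < x + e & F y = 0.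
  move=> e0; move: xT; rewrite in_itv/= => /andP[x0 xT].
  have : x < Num.min T (x + e) by rewrite lt_min xT/=; lra.
  move=> /ae_ex_itv/(_ H0)[y /andP[xy]]; rewrite lt_min => /andP[yT ye] Fy.
  by exists y; [rewrite xy|apply: Fy; rewrite in_itv/=; lra].
have Fx : F x = 0.
  have cF : {for x, continuous F}.
    by apply: differentiable_continuous; exact/derivable1_diffP.
  apply/eqP/contraT => Fx0.
  have nF : 0 < `|F x| by rewrite normr_gt0.
  have /cvgrPdist_lt/(_ _ nF)[e /= e0 he] := cF.
  have [y /andP[xy ye] Fy] := dense e e0.
  have : `|F x - F y| < `|F x|.
    by apply: he; rewrite /= ltr0_norm; lra.
  by rewrite Fy subr0 ltxx.
apply/eqP/contraT => ux0.
have nu : 0 < `|u x| by rewrite normr_gt0.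
have /cvgrPdist_lt/(_ _ nu)[e /= e0 he] :
    h^-1 *: (F (h *: 1 + x) - F x) @[h --> 0^'] --> u x.
  by rewrite -F'x derive1E; exact: dF.
have [y /andP[xy ye] Fy] := dense e e0.
have := he (y - x); rewrite /= sub0r normrN gtr0_norm ?subr_gt0//.
have yx0 : 0 < y - x by rewrite subr_gt0.
have yxe : y - x < e by lra.
move=> /(_ yxe (lt0r_neq0 yx0)).
have -> : (y - x) *: (1 : R) + x = y by rewrite /GRing.scale/=; ring.
by rewrite Fy Fx subr0 scaler0 subr0 ltxx.
Qed.

End truncation.

(** * Convolution of powers *)

Section powers.
Context {R : realType}.
Local Notation mu := (@lebesgue_measure R).
Implicit Types (f g h u : R -> R) (t T x y z : R).

Definition powT T x : R -> R := (fun t => t `^ (x - 1)) \_ `]0, T[.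

Lemma powTE T x t : 0 < t < T -> powT T x t = t `^ (x - 1).
Proof. by move=> tT; rewrite /powT truncE tT. Qed.

Lemma powT_ge0 T x t : 0 <= powT T x t.
Proof. by rewrite /powT truncE; case: ifP => // _; exact: powR_ge0. Qed.

Lemma causal_powT T x : causal (powT T x).
Proof. exact: causal_trunc. Qed.

Lemma measurable_powT T x : measurable_fun setT (powT T x).
Proof.
apply: (measurable_restrictT (fun t : R => t `^ (x - 1)) (measurable_itv `]0, T[)).1.
exact: measurable_funTS (measurable_powR _).
Qed.

Lemma powR_continuous_at (p t : R) : 0 < t -> {for t, continuous (fun s => s `^ p)}.
Proof.
move=> t0; apply: differentiable_continuous; apply/derivable1_diffP.
by apply: derivable_powR; rewrite in_itv/= t0.
Qed.

Lemma integral_powR_itv (x e T : R) : 0 < x -> 0 < e < T ->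
  (\int[mu]_(t in `[e, T]) (t `^ (x - 1))%:E = (T `^ x / x - e `^ x / x)%:E)%E.
Proof.
move=> x0 /andP[e0 eT].
have pos t : t \in `[e, T] -> 0 < t.
  by rewrite in_itv/= => /andP[+ _]; exact: lt_le_trans.
rewrite (@continuous_FTC2 _ (fun t => t `^ (x - 1)) (fun t => x^-1 * t `^ x))//.
- by rewrite -EFinB; congr EFin; rewrite !(mulrC x^-1).
- by apply: continuous_in_subspaceT => t /set_mem/pos; exact: powR_continuous_at.
- have cF t : 0 < t -> {for t, continuous (fun t : R => x^-1 * t `^ x)}.
    move=> t0; apply: continuousM; first exact: cst_continuous.
    exact: powR_continuous_at.
  split.
  + move=> t; rewrite in_itv/= => /andP[et _].
    apply: derivableM; first exact: derivable_cst.
    by apply: derivable_powR; rewrite in_itv/= (lt_trans e0 et).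
  + by apply: cvg_at_right_filter; exact: cF.
  + by apply: cvg_at_left_filter; apply: cF; exact: lt_trans eT.
- move=> t; rewrite in_itv/= => /andP[et _]; have t0 := lt_trans e0 et.
  have dp : derivable (fun t : R => t `^ x) t 1.
    by apply: derivable_powR; rewrite in_itv/= t0.
  rewrite derive1E deriveM ?derive_cst//.
  rewrite scaler0 addr0 -derive1E powR_derive1 ?in_itv/= ?t0//.
  by rewrite /GRing.scale/= mulrA mulVf ?mul1r// lt0r_neq0.
Qed.

(** Monotone convergence over the intervals [[T / n, T]], on which the
    primitive is explicit and bounded by [T `^ x / x]. *)
Lemma L1_powT T x : 0 < T -> 0 < x -> L1 (powT T x).
Proof.
move=> T0 x0; apply/(L1_restrict (fun t : R => t `^ (x - 1)) (measurable_itv `]0, T[)).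
have mp (D : set R) : measurable_fun D (fun t : R => t `^ (x - 1)).
  exact: measurable_funTS (measurable_powR _).
apply: (@integrableS _ _ _ mu `]0, T]) => //.
  by move=> t /=; rewrite !in_itv/= => /andP[-> /ltW].
apply/integrableP; split; first by apply/measurable_EFinP; exact: mp.
pose F n : set R := `[T / n.+2%:R, T]%classic.
have -> : `]0, T]%classic = \bigcup_n F n.
  apply/seteqP; split => t /=; rewrite in_itv/=.
    move=> /andP[t0 tT]; exists (Num.trunc (T / t)) => //.
    rewrite /F/= in_itv/= tT andbT ler_pdivrMr// mulrC -ler_pdivrMr//.
    have := truncnS_gt (T / t); move/ltW/le_trans; apply.
    by rewrite ler_nat.
  move=> [n _]; rewrite /F/= in_itv/= => /andP[+ ->]; rewrite andbT.
  by apply: lt_le_trans; rewrite divr_gt0.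
under eq_integral do rewrite /= ger0_norm ?powR_ge0//.
have ndF : {homo F : n m / (n <= m)%N >-> (n <= m)%O}.
  move=> n m nm; apply/subsetPset => t; rewrite /F/= !in_itv/= => /andP[+ ->].
  rewrite andbT; apply: le_trans; rewrite ler_pM2l// lef_pV2 ?posrE//.
  by rewrite ler_nat !ltnS.
have cvF : (\int[mu]_(t in F n) (t `^ (x - 1))%:E)%E @[n --> \oo] -->
    (\int[mu]_(t in \bigcup_n F n) (t `^ (x - 1))%:E)%E.
  apply: ge0_nondecreasing_set_cvg_integral => //.
  - by move=> n; exact: measurable_itv.
  - by move=> n; apply/measurable_EFinP; exact: mp.
  - by move=> n t _; rewrite lee_fin powR_ge0.
rewrite -(cvg_lim _ cvF)//.
apply: (@le_lt_trans _ _ (T `^ x / x)%:E); last exact: ltry.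
apply: lime_le; first by apply/cvg_ex; exists (\int[mu]_(t in \bigcup_n F n) (t `^ (x - 1))%:E)%E.
apply: nearW => n; rewrite /F integral_powR_itv//.
  by rewrite lee_fin gerBl divr_ge0 ?powR_ge0// ltW.
rewrite divr_gt0//= ltr_pdivrMr// ltr_pMr// ltr1n//.
Qed.

Definition beta_weight x y : R -> R :=
  (fun z => (1 - z) `^ (x - 1) * z `^ (y - 1)) \_ `]0, 1[.

Lemma beta_weight_ge0 x y z : 0 <= beta_weight x y z.
Proof. by rewrite /beta_weight truncE; case: ifP => // _; rewrite mulr_ge0 ?powR_ge0. Qed.

Lemma powT_scale T x y t z : 0 < t < T ->
  powT T x (t - t * z) * powT T y (t * z) = t `^ (x + y - 2) * beta_weight x y z.
Proof.
move=> /andP[t0 tT]; rewrite /powT /beta_weight !truncE.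
have [z0|z0] := leP z 0.
  have -> : (0 < t * z) = false by rewrite pmulr_rgt0// ltNge z0.
  by rewrite mulr0 mulr0.
have tz0 : 0 < t * z by exact: mulr_gt0.
have [z1|z1] := ltP z 1; last first.
  have -> : (0 < t - t * z) = false by rewrite subr_gt0 gtr_pMr// ltNge z1.
  by rewrite mul0r mulr0.
have tzt : t * z < t by rewrite gtr_pMr.
rewrite /= !ifT; [|lra|lra].
have -> : t - t * z = t * (1 - z) by ring.
rewrite !powRM ?ltW//; last by rewrite subr_gt0.
have -> : x + y - 2 = (x - 1) + (y - 1) by ring.
rewrite (@powRD _ t (x - 1) (y - 1)); last by rewrite (lt0r_neq0 t0) implybT.
ring.
Qed.

(** The scaling [s = t * z] turns the convolution of two powers into a Beta
    integral.  Its finiteness comes for free: the convolution of integrable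
    functions is finite at almost every point. *)
Lemma L1_beta_weight x y : 0 < x -> 0 < y -> L1 (beta_weight x y).
Proof.
move=> x0 y0.
have lx := @L1_powT 1 x ltr01 x0; have ly := @L1_powT 1 y ltr01 y0.
have [t t01 it] := ae_ex_itv ltr01 (convol_ae_integrable lx ly).
have /andP[t0 _] := t01; have tn0 := lt0r_neq0 t0.
have := integrable_affine 0 tn0 it => /(L1Z (t `^ (x + y - 2))^-1).
rewrite /L1; congr (integrable _ _ _); apply/funext => z /=; congr EFin.
rewrite addr0 powT_scale// mulKf// powR_eq0 negb_and; apply/orP; left.
exact: lt0r_neq0.
Qed.

Definition Beta x y : R := \int[mu]_z beta_weight x y z.

Lemma L1_powT_section T x y t : 0 < x -> 0 < y -> 0 < t < T ->
  L1 (fun s => powT T x (t - s) * powT T y s).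
Proof.
move=> x0 y0 tT; have /andP[t0 _] := tT; have ti0 : t^-1 != 0 by rewrite invr_eq0 lt0r_neq0.
have := integrable_affine 0 ti0 (L1_beta_weight x0 y0) => /(L1Z (t `^ (x + y - 2))).
rewrite /L1; congr (integrable _ _ _); apply/funext => z /=; congr EFin.
by rewrite addr0 -(powT_scale _ _ _ tT) mulrA mulfV ?mul1r// lt0r_neq0.
Qed.

Lemma convol_powT T x y t : 0 < x -> 0 < y -> 0 < t < T ->
  convol (powT T x) (powT T y) t = Beta x y * t `^ (x + y - 1).
Proof.
move=> x0 y0 tT; have /andP[t0 _] := tT; have tn0 := lt0r_neq0 t0.
rewrite /convol (integral_affine 0 tn0 (L1_powT_section x0 y0 tT)).
under eq_Rintegral do rewrite addr0 powT_scale//.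
rewrite RintegralZl//; last exact: L1_beta_weight.
rewrite gtr0_norm// mulrA [RHS]mulrC; congr (_ * _).
have -> : x + y - 1 = 1 + (x + y - 2) by ring.
by rewrite (@powRD _ t 1) ?tn0 ?implybT// powRr1 ?ltW.
Qed.

(** This gives the positivity of the Beta integrals that are divided by
    below: the exponents are nonpositive and the bases less than 1, so the
    integrand is at least 1. *)
Lemma Beta_ge1 x y : 0 < x <= 1 -> 0 < y <= 1 -> 1 <= Beta x y.
Proof.
move=> /andP[x0 x1] /andP[y0 y1].
have -> : 1 = \int[mu]_z one 1 z :> R.
  have m1 : fine (mu `]0, 1[%classic) = 1.
    by rewrite lebesgue_measure_itv/= lte_fin ltr01 oppr0 adde0.
  by rewrite /one -Rintegral_mkcond Rintegral_cst// [X in _ * X]m1 mulr1.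
apply: le_Rintegral => //; [exact: L1_one|exact: L1_beta_weight|].
move=> z _; rewrite /one /beta_weight !truncE; case: ifPn => // /andP[z0 z1].
have p w r : 0 < w < 1 -> r <= 1 -> 1 <= w `^ (r - 1).
  move=> /andP[w0 w1] r1; rewrite -[leLHS](powRr0 w); have hw : 0 < w <= 1 by rewrite w0 ltW.
  by apply: (ger_powR hw); rewrite subr_le0.
rewrite -[leLHS]mulr1; apply: ler_pM => //; apply: p => //; lra.
Qed.

End powers.

(** * Completeness of the integrable functions *)

Section L1_norm.
Context {R : realType}.
Local Notation mu := (@lebesgue_measure R).
Implicit Types (f g h u : R -> R) (t T x y z : R).

Lemma norm1_le_ae f g : L1 f -> L1 g ->
  {ae mu, forall x, `|f x| <= `|g x|} -> norm1 f <= norm1 g.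
Proof.
move=> lf lg fg; rewrite -lee_fin !norm1E//; apply: ae_ge0_le_integral => //.
- by apply/measurable_EFinP; apply: measurableT_comp => //; exact: L1_measurable.
- by apply/measurable_EFinP; apply: measurableT_comp => //; exact: L1_measurable.
- by apply: ae_impl fg => x fg _; rewrite lee_fin.
Qed.

Lemma norm1D f g : L1 f -> L1 g -> norm1 (fun x => f x + g x) <= norm1 f + norm1 g.
Proof.
move=> lf lg; rewrite /norm1 -RintegralD//; [|exact: L1_abs|exact: L1_abs].
apply: le_Rintegral => //.
- exact: L1_abs (L1D lf lg).
- exact: L1D (L1_abs lf) (L1_abs lg).
- by move=> x _; exact: ler_normD.
Qed.

Lemma norm1Z c f : L1 f -> norm1 (fun x => c * f x) = `|c| * norm1 f.
Proof.
move=> lf; rewrite /norm1 -RintegralZl//; last exact: L1_abs.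
by apply: eq_Rintegral => x _; rewrite normrM.
Qed.

Lemma norm1_eq0 f : L1 f -> norm1 f = 0 -> {ae mu, forall x, f x = 0}.
Proof.
move=> lf nf; have := @ae_eq_integral_abs _ _ _ mu setT measurableT (EFin \o f)
  ((measurable_EFinP _ _).2 (L1_measurable lf)).
rewrite /= -norm1E// nf => -[/(_ erefl) + _].
by apply: ae_impl => x /= /(_ I)[].
Qed.

Lemma sum_geometric_le (C a : R) n : 0 <= C -> 0 <= a < 1 ->
  \sum_(0 <= k < n) C * a ^+ k <= C / (1 - a).
Proof.
move=> C0 /andP[a0 a1]; have a1' : 0 < 1 - a by rewrite subr_gt0.
have -> : \sum_(0 <= k < n) C * a ^+ k = C * (1 - a ^+ n) / (1 - a).
  elim: n => [|n ih]; first by rewrite big_nil expr0 subrr mulr0 mul0r.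
  by rewrite big_nat_recr//= ih exprS; field; exact: lt0r_neq0.
rewrite ler_pM2r ?invr_gt0// ler_piMr// gerBl; exact: exprn_ge0.
Qed.

(** The Riesz-Fischer theorem, for sequences with geometrically decreasing
    increments: these are summable, hence absolutely summable almost
    everywhere, and their sum dominates the sequence. *)
Lemma riesz_fischer (w : nat -> R -> R) (C a : R) :
  (forall n, L1 (w n)) -> 0 <= C -> 0 <= a < 1 ->
  (forall n, norm1 (fun x => w n.+1 x - w n x) <= C * a ^+ n) ->
  exists2 u, L1 u & norm1 (fun x => u x - w n x) @[n --> \oo] --> 0.
Proof.
move=> lw C0 a01 dw.
pose d n x := w n.+1 x - w n x.
have ld n : L1 (d n) by exact: L1B.
have md n : measurable_fun [set: R] (fun x => `|d n x|%:E).
  by apply/measurable_EFinP; apply: measurableT_comp => //; exact: L1_measurable.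
pose S x := (\sum_(0 <= n <oo) `|d n x|%:E)%E.
have S0 x : (0 <= S x)%E by exact: nneseries_ge0.
have mS : measurable_fun [set: R] S.
  exact: (@ge0_emeasurable_sum _ _ R setT (fun n x => `|d n x|%:E) xpredT).
have iS : mu.-integrable setT S.
  apply/integrableP; split => //.
  under eq_integral do rewrite gee0_abs//.
  rewrite /S integral_nneseries//.
  apply: (@le_lt_trans _ _ (C / (1 - a))%:E); last exact: ltry.
  apply: lime_le; first by apply: is_cvg_nneseries => n _ _; exact: integral_ge0.
  apply: nearW => n; under eq_bigr do rewrite -norm1E//.
  rewrite sumEFin lee_fin; apply: le_trans (sum_geometric_le n C0 a01).
  by apply: ler_sum => k _; exact: dw.
pose A := [set x | S x < +oo]%E.
have mA : measurable A.
  by rewrite -[A]setTI; exact: (emeasurable_fun_infty_o measurableT mS).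
have partial x n : A x -> \sum_(0 <= k < n) `|d k x| <= fine (S x).
  move=> Ax; rewrite -lee_fin fineK ?ge0_fin_numE// -sumEFin.
  exact: (@nneseries_lim_ge _ (fun k => `|d k x|%:E) xpredT 0).
have wE x n : w n x = w 0%N x + series (d ^~ x) n.
  by rewrite [LHS](eq_sum_telescope (w ^~ x) n).
have wle x n : A x -> `|w n x| <= `|w 0%N x| + fine (S x).
  move=> Ax; rewrite wE; apply: (le_trans (ler_normD _ _)); rewrite lerD2l.
  by apply: le_trans (partial x n Ax); rewrite seriesEnat; exact: ler_norm_sum.
have cw x : A x -> cvgn (w ^~ x).
  move=> Ax; rewrite (_ : w ^~ x = (fun n => w 0%N x + series (d ^~ x) n)); last first.
    by apply/funext => n; exact: wE.
  apply: is_cvgD; first exact: is_cvg_cst.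
  apply: normed_cvg; apply: nondecreasing_is_cvgn.
    apply/nondecreasing_seqP => n.
    rewrite [leRHS](@big_nat_recr _ _ _ n 0%N (fun k => `|d k x|))//=.
    by rewrite lerDl.
  by exists (fine (S x)) => _ [n _ <-]; exact: partial.
pose u x := limn (fun n => (w n \_ A) x).
have cu x : (w n \_ A) x @[n --> \oo] --> u x.
  have [Ax|nAx] := pselect (A x).
    have : cvgn (fun n => (w n \_ A) x).
      by under eq_fun do rewrite patchE mem_set//; exact: cw.
    by [].
  have : cvgn (fun n => (w n \_ A) x).
    by under eq_fun do rewrite patchE memNset//; exact: is_cvg_cst.
  by [].
have mu_ : measurable_fun setT u.
  apply: (@measurable_fun_cvg _ _ R setT (fun n => w n \_ A)) => // n.
  by apply: (measurable_restrictT (w n) mA).1; apply: measurable_funTS; exact: L1_measurable.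
have aeA : {ae mu, forall x, A x}.
  by apply: ae_impl (integrable_ae measurableT iS) => x /(_ I); rewrite ge0_fin_numE.
have ig : mu.-integrable setT (fun x => `|w 0%N x|%:E + S x)%E.
  exact: (integrableD measurableT (L1_abs (lw 0%N)) iS).
have := @dominated_convergence _ _ R mu setT measurableT (fun n x => (w n x)%:E)
  (fun x => (u x)%:E) (fun x => `|w 0%N x|%:E + S x)%E.
case => //.
- by move=> n; apply/measurable_EFinP; exact: L1_measurable.
- exact/measurable_EFinP.
- apply: ae_impl aeA => x Ax _; apply: cvg_EFin; first exact: nearW.
  have := cu x; rewrite (_ : (fun n => (w n \_ A) x) = (fun n => w n x))//.
  by apply/funext => n /=; rewrite patchE mem_set.
- apply: ae_impl aeA => x Ax n _ /=.
  by rewrite -(@fineK _ (S x)) ?ge0_fin_numE// -EFinD lee_fin wle.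
move=> lu cvgu _; exists u => //.
have /fine_cvgP[_] // : (norm1 (fun x => u x - w n x))%:E @[n --> \oo] --> 0%:E.
have : (\int[mu]_x `|(w n x)%:E - (u x)%:E|)%E @[n --> \oo] --> 0%:E by exact: cvgu.
apply: cvg_trans; apply: near_eq_cvg; apply: nearW => n /=.
rewrite norm1E//; last exact: L1B.
by apply: eq_integral => x _; rewrite /= distrC.
Qed.

End L1_norm.

(** * Volterra equations of the second kind *)

Section volterra.
Context {R : realType}.
Local Notation mu := (@lebesgue_measure R).
Implicit Types (f g h u : R -> R) (t T x y z : R).

(** Picard iteration: the increments of [w n.+1 = F - G * w n] are
    multiplied by at most [norm1 G] in norm, so the iterates converge. *)
Lemma volterra_contraction (G F : R -> R) : L1 G -> L1 F -> causal G -> causal F ->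
  norm1 G < 1 ->
  exists u, [/\ L1 u, causal u & {ae mu, forall t, u t = F t - convol G u t}].
Proof.
move=> lG lF cG cF G1.
pose w := fix w n := if n is m.+1 then (fun t => F t - convol G (w m) t) else cst 0.
have wS n t : w n.+1 t = F t - convol G (w n) t by [].
have lw n : L1 (w n).
  elim: n => [|n ih]; first exact: integrable0.
  by apply: L1B => //; exact: L1_convol.
have cw n : causal (w n).
  elim: n => [//|n ih] t t0; rewrite /= cF// sub0r (causal_convol cG ih t0).
  by rewrite oppr0.
have dwE n : {ae mu, forall t, w n.+2 t - w n.+1 t =
    - convol G (fun s => w n.+1 s - w n s) t}.
  apply: ae_impl (ae_convolBr lG (lw n.+1) (lw n)) => t ->.
  by rewrite (wS n.+1) (wS n); ring.
have [||u lu cu] := @riesz_fischer _ w (norm1 F) (norm1 G) lw (norm1_ge0 F).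
- by rewrite norm1_ge0.
- elim=> [|n ih].
    rewrite expr0 mulr1; apply: norm1_le_ae => //; first exact: L1B.
    apply: aeW => t; rewrite (wS 0%N) /=.
    have -> : convol G (cst 0) t = 0.
      rewrite /convol; under eq_Rintegral do rewrite mulr0.
      by rewrite Rintegral_cst// mul0r.
    by rewrite !subr0.
  apply: (@le_trans _ _ (norm1 (convol G (fun s => w n.+1 s - w n s)))).
    apply: norm1_le_ae; [exact: L1B|by apply: L1_convol => //; exact: L1B|].
    by apply: ae_impl (dwE n) => t ->; rewrite normrN.
  apply: le_trans (le_norm1_convol lG (L1B (lw _) (lw _))) _.
  by rewrite exprS mulrCA ler_wpM2l// norm1_ge0.
(* The limit in norm is determined up to null sets; cutting it off makes it
   causal and keeps the convergence, since the iterates are causal. *)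
pose v : R -> R := u \_ `]0, +oo[.
have vE t : v t = if 0 < t then u t else 0.
  rewrite /v patchE; case: ifPn => [/set_mem|/negP nt].
    by rewrite /= in_itv/= andbT => ->.
  case: ifPn => // t0; exfalso; apply: nt; apply: mem_set.
  by rewrite /= in_itv/= t0.
have lv : L1 v.
  apply: (L1_restrict u (measurable_itv `]0, +oo[)).1.
  by apply: integrableS lu.
have cvw : norm1 (fun t => v t - w n t) @[n --> \oo] --> 0.
  apply: (squeeze_cvgr _ (@cvg_cst _ 0 _ _ _) cu).
  apply: nearW => n; rewrite norm1_ge0/=; apply: norm1_le_ae; [exact: L1B|exact: L1B|].
  apply: aeW => t; rewrite vE; case: ifPn => // t0.
  by rewrite cw ?subr0 ?normr0// leNgt.
exists v; split => //.
  by move=> t t0; rewrite vE ltNge t0.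
have ld : L1 (fun t => v t - (F t - convol G v t)).
  by apply: L1B => //; apply: L1B => //; exact: L1_convol.
have : norm1 (fun t => v t - (F t - convol G v t)) = 0; last first.
  by move=> /(norm1_eq0 ld); apply: ae_impl => t /eqP; rewrite subr_eq0 => /eqP.
apply/eqP; rewrite eq_le norm1_ge0 andbT.
have cvg0 : norm1 (fun t => v t - w n.+1 t) + norm1 G * norm1 (fun t => v t - w n t)
    @[n --> \oo] --> 0.
  rewrite -[X in _ --> X](addr0 0) -[X in _ --> _ + X](mulr0 (norm1 G)).
  apply: cvgD; first by rewrite (cvg_shiftS (fun n => norm1 (fun t => v t - w n t))).
  by apply: cvgM => //; exact: cvg_cst.
apply: (ler_cvg_to (@cvg_cst _ (norm1 (fun t => v t - (F t - convol G v t))) _ _ _) cvg0).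
apply: nearW => n.
apply: le_trans (lerD (lexx _) (le_norm1_convol lG (L1B lv (lw n)))).
have l1 := L1B lv (lw n.+1); have l2 := L1_convol lG (L1B lv (lw n)).
apply: le_trans (norm1D l1 l2); apply: norm1_le_ae => //; first exact: L1D.
apply: ae_impl (ae_convolBr lG lv (lw n)) => t ->.
rewrite wS le_eqVlt; apply/orP; left; apply/eqP; congr `|_|; ring.
Qed.

(** As [expR (- (l * t))] is multiplicative, this weight commutes with
    convolution. *)
Definition damp (l : R) f : R -> R := fun t => expR (- (l * t)) * f t.

Lemma causal_damp l f : causal f -> causal (damp l f).
Proof. by move=> cf t t0; rewrite /damp cf// mulr0. Qed.

Lemma L1_damp l f : 0 <= l -> causal f -> L1 f -> L1 (damp l f).
Proof.
move=> l0 cf lf; apply: (L1_le _ _ lf).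
  apply: measurable_funM; last exact: (L1_measurable lf).
  under eq_fun do rewrite -mulNr.
  exact: (measurableT_comp (@measurable_expR R) (mulrl_measurable (- l))).
move=> x; have [x0|x0] := leP x 0; first by rewrite /damp cf// mulr0.
rewrite /damp normrM ler_piMl// ger0_norm ?expR_ge0//.
by rewrite -expR0 ler_expR oppr_le0 mulr_ge0// ltW.
Qed.

Lemma convol_damp l f g t : convol (damp l f) (damp l g) t =
  \int[mu]_s (expR (- (l * t)) * (f (t - s) * g s)).
Proof.
apply: eq_Rintegral => s _; rewrite /damp.
have -> : - (l * t) = - (l * (t - s)) + - (l * s) by ring.
by rewrite expRD; ring.
Qed.

(** Dominated convergence as [l] grows, by causality.  This removes any
    smallness condition from Volterra equations on a bounded interval. *)
Lemma damp_small (G : R -> R) : L1 G -> causal G ->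
  exists2 l, 0 <= l & norm1 (damp l G) < 1 / 2.
Proof.
move=> lG cG.
have lD n : L1 (damp n%:R G) by exact: L1_damp.
have := @dominated_convergence _ _ R mu setT measurableT
  (fun n x => (damp n%:R G x)%:E) (fun x => 0%:E) (fun x => `|G x|%:E)%E.
case => //.
- by move=> n; apply/measurable_EFinP; exact: L1_measurable.
- apply: aeW => x _; apply: cvg_EFin; first exact: nearW.
  have [x0|x0] := leP x 0.
    apply: cvg_near_cst; apply: nearW => n /=.
    by rewrite /damp cG// mulr0.
  have e1 : `|expR (- x)| < 1.
    by rewrite ger0_norm ?expR_ge0// -expR0 ltr_expR oppr_lt0.
  rewrite [X in X @ _ --> _](_ : _ = (fun n => expR (- x) ^+ n * G x)); last first.
    apply/funext => n /=; rewrite /damp; congr (_ * _).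
    by rewrite -expRM_natl mulrN.
  rewrite -(mul0r (G x)); apply: cvgM; last exact: cvg_cst.
  exact: cvg_expr.
- exact: L1_abs.
- apply: aeW => x n _; rewrite /= lee_fin.
  have [x0|x0] := leP x 0; first by rewrite /damp cG// mulr0 normr0.
  rewrite /damp normrM ler_piMl// ger0_norm ?expR_ge0//.
  by rewrite -expR0 ler_expR oppr_le0 mulr_ge0// ltW.
move=> _ + _ => /= cv0.
have /fine_cvgP[_ /=] : (norm1 (damp n%:R G))%:E @[n --> \oo] --> 0%:E.
  move: cv0; apply: cvg_trans; apply: near_eq_cvg; apply: nearW => n /=.
  by rewrite norm1E//; apply: eq_integral => x _; rewrite /= subr0.
move=> /cvgrPdist_lt/(_ (1/2) ltac:(lra))[N _ /(_ N (leqnn N))] /=.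
rewrite sub0r normrN ger0_norm ?norm1_ge0// => h.
by exists N%:R.
Qed.

(** Solve the equation for the damped data, for which the kernel is a
    contraction, and undo the damping. *)
Lemma volterra_exists (T : R) (G F : R -> R) : L1 G -> L1 F -> causal G -> causal F ->
  exists u, [/\ L1 u, causal u & eq_ae T u (fun t => F t - convol G u t)].
Proof.
move=> lG lF cG cF; have [l l0 Gl] := damp_small lG cG.
have [|v [lv cv' vE]] := volterra_contraction (L1_damp l0 cG lG)
  (L1_damp l0 cF lF) (causal_damp l cG) (causal_damp l cF); first lra.
(* Undoing the damping is possible only up to time [T], because
   [expR (l * t)] is unbounded. *)
pose u : R -> R := (fun t => expR (l * t) * v t) \_ `]0, T[.
have mexp : measurable_fun setT (fun t : R => expR (l * t)).
  exact: (measurableT_comp (@measurable_expR R) (mulrl_measurable l)).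
have lu : L1 u.
  apply: (@L1_le _ _ (fun t => expR (l * T) * v t)); last exact: L1Z.
    apply: (measurable_restrictT (fun t => expR (l * t) * v t) (measurable_itv `]0, T[)).1.
    by apply: measurable_funTS; apply: measurable_funM => //; exact: L1_measurable.
  move=> x; rewrite /u truncE; case: ifPn => [/andP[x0 xT]|_]; last by rewrite normr0.
  rewrite !normrM ler_wpM2r// !ger0_norm ?expR_ge0// ler_expR.
  by rewrite ler_wpM2l// ltW.
exists u; split => //; first exact: causal_trunc.
apply: ae_impl2 vE (convol_ae_integrable lG lu) => t vt it; rewrite in_itv/= => tT; have /andP[t0 tT'] := tT.
have aux (a b : R) : expR (l * t) * (expR (- (l * t)) * a) = a.
  by rewrite mulrA -expRD subrr expR0 mul1r.
rewrite /u truncE tT vt mulrBr {1}/damp aux//; congr (_ - _).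
have -> : convol (damp l G) v t = convol (damp l G) (damp l u) t.
  apply: eq_Rintegral => s _.
  have [s0|s0] := leP s 0; first by rewrite cv'// /damp /u (causal_trunc _ _ s0) !mulr0.
  have [st|st] := leP t s; first by rewrite /damp cG ?mulr0 ?mul0r//; lra.
  congr (_ * _); rewrite /damp /u truncE ifT; last lra.
  by rewrite mulrA -expRD addrC subrr expR0 mul1r.
by rewrite convol_damp RintegralZl// aux.
Qed.

(** For the damped functions the convolution term is at most half of the
    left-hand side and can be absorbed there; on [(0, T)] the weight lies
    between [expR (- (l * T))] and 1. *)
Lemma volterra_bound (T : R) (G : R -> R) : 0 < T -> L1 G -> causal G ->
  exists2 Q, 0 < Q & forall F u : R -> R, L1 F -> L1 u -> causal F ->
    (forall t, ~~ (0 < t < T) -> u t = 0) ->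
    eq_ae T u (fun t => F t - convol G u t) -> norm1 u <= Q * norm1 F.
Proof.
move=> T0 lG cG; have [l l0 Gl] := damp_small lG cG.
exists (2 * expR (l * T)) => [|F u lF lu cF u0 uE].
  by rewrite mulr_gt0// expR_gt0.
have cu : causal u by move=> x x0; apply: u0; rewrite ltNge x0.
have [[lDF lDu] lDG] := (L1_damp l0 cF lF, L1_damp l0 cu lu, L1_damp l0 cG lG).
have lDc := L1_convol lDG lDu.
have duE : {ae mu, forall t, `|damp l u t| <=
    `| `|damp l F t| + `|convol (damp l G) (damp l u) t| | }.
  apply: ae_impl2 uE (convol_ae_integrable lG lu) => t ut it.
  have [tT|ntT] := boolP (0 < t < T); last first.
    by rewrite /damp u0// mulr0 normr0.
  rewrite [leRHS]ger0_norm ?addr_ge0// {1}/damp ut ?in_itv//= mulrBr.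
  by rewrite (le_trans (ler_normB _ _))// convol_damp RintegralZl.
have b1 : norm1 (damp l u) <= norm1 (damp l F) + norm1 (damp l G) * norm1 (damp l u).
  apply: le_trans (lerD (lexx _) (le_norm1_convol lDG lDu)).
  apply: (le_trans (norm1_le_ae lDu (L1D (L1_abs lDF) (L1_abs lDc)) duE)).
  apply: (le_trans (norm1D (L1_abs lDF) (L1_abs lDc))).
  by rewrite /norm1; under eq_Rintegral do rewrite normr_id;
     under [X in _ + X <= _]eq_Rintegral do rewrite normr_id.
have b2 : norm1 (damp l F) <= norm1 F.
  apply: norm1_le_ae => //; apply: aeW => x.
  have [x0|x0] := leP x 0; first by rewrite /damp cF// mulr0 normr0.
  rewrite /damp normrM ler_piMl// ger0_norm ?expR_ge0//.
  by rewrite -expR0 ler_expR oppr_le0 mulr_ge0// ltW.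
have b3 : norm1 u <= expR (l * T) * norm1 (damp l u).
  have <- : norm1 (fun x => expR (l * T) * damp l u x) = expR (l * T) * norm1 (damp l u).
    by rewrite norm1Z// ger0_norm ?expR_ge0.
  apply: norm1_le_ae => //; first exact: L1Z.
  apply: aeW => x; have [/andP[x0 xT]|nx] := boolP (0 < x < T); last by rewrite u0// normr0.
  rewrite /damp mulrA -expRD normrM ler_peMl// ger0_norm ?expR_ge0//.
  by rewrite -expR0 ler_expR -mulrBr mulr_ge0// subr_ge0 ltW.
have b4 : norm1 (damp l G) * norm1 (damp l u) <= 1/2 * norm1 (damp l u).
  by rewrite ler_wpM2r ?norm1_ge0// ltW.
rewrite -mulrA mulrCA.
apply: (le_trans b3); rewrite ler_wpM2l ?expR_ge0//; lra.
Qed.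

End volterra.

(** * Smooth functions that vanish on a half-line *)

Section bump.
Context {R : realType}.
Local Notation mu := (@lebesgue_measure R).
Implicit Types (f g h u : R -> R) (t T x y z : R).

(** Differentiability [n] times, by recursion on a given derivative, so that
    the closure properties follow from those of [is_derive]. *)
Fixpoint diffn n f : Prop :=
  if n is m.+1 then exists2 f', (forall x, is_derive x 1 f (f' x)) & diffn m f'
  else True.

Lemma is_derive_derive1 f f' : (forall x, is_derive x 1 f (f' x)) ->
  f^`()%classic = f'.
Proof. by move=> ff'; apply/funext => x; rewrite derive1E; apply: derive_val. Qed.

Lemma diffn_derivable n f x : diffn n.+1 f -> derivable (f^`(n))%classic x 1.
Proof.
elim: n f => [|n ih] f [f' ff' df'].
  by rewrite derive1n0; exact: (@ex_derive _ _ _ _ _ _ _ (ff' x)).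
by rewrite derive1Sn (is_derive_derive1 ff'); exact: ih.
Qed.

Lemma diffn_weak n f : diffn n.+1 f -> diffn n f.
Proof.
elim: n f => [//|n ih] f [f' ff' df']; exists f' => //; exact: ih.
Qed.

Lemma diffnD n f g : diffn n f -> diffn n g -> diffn n (fun x => f x + g x).
Proof.
elim: n f g => [//|n ih] f g [f' ff' df'] [g' gg' dg'].
exists (fun x => f' x + g' x); last exact: ih.
by move=> x; have := ff' x; have := gg' x => ? ?; exact: is_deriveD.
Qed.

Lemma diffnZ n c f : diffn n f -> diffn n (fun x => c * f x).
Proof.
elim: n f => [//|n ih] f [f' ff' df'].
exists (fun x => c * f' x); last exact: ih.
by move=> x; have := ff' x => ?; exact: is_deriveZ.
Qed.

Lemma diffnM n f g : diffn n f -> diffn n g -> diffn n (fun x => f x * g x).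
Proof.
elim: n f g => [//|n ih] f g df0 dg0.
have [f' ff' df'] := df0; have [g' gg' dg'] := dg0.
exists (fun x => f x * g' x + g x * f' x).
  by move=> x; have := ff' x; have := gg' x => ? ?; exact: is_deriveM.
by apply: diffnD; apply: ih => //; exact: diffn_weak.
Qed.

Lemma is_derive_affine a b x : is_derive x 1 (fun x => a * x + b) a.
Proof. by apply: is_derive_eq; rewrite addr0 /GRing.scale/= mulr1. Qed.

Lemma diffn_affine n a b f : diffn n f -> diffn n (fun x => f (a * x + b)).
Proof.
elim: n f => [//|n ih] f [f' ff' df'].
exists (fun x => a * f' (a * x + b)); last by apply: diffnZ; exact: ih.
move=> x; have dab := is_derive_affine a b x.
have := ff' (a * x + b) => dfx.
by have := @is_derive1_comp _ f (fun x => a * x + b) x _ _ dfx dab; rewrite mulrC.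
Qed.

(** All the derivatives of [exp(-1/x)] are combinations of these functions, a
    family stable under differentiation. *)
Definition psi k x : R := if 0 < x then x^-1 ^+ k * expR (- x^-1) else 0.

Lemma psi_ge0 k x : 0 <= psi k x.
Proof.
rewrite /psi; case: ifPn => // x0.
by rewrite mulr_ge0 ?expR_ge0// exprn_ge0// invr_ge0 ltW.
Qed.

(** A power of [1/x] is dominated by the exponential series; this bound gives
    the derivative 0 at the origin. *)
Lemma psi_le k x : 0 < x -> psi k x <= k.+1`!%:R * x.
Proof.
move=> x0; rewrite /psi x0 expRN ler_pdivrMr ?expR_gt0//.
have y0 : 0 <= x^-1 by rewrite invr_ge0 ltW.
have f0 : (0 : R) < k.+1`!%:R by rewrite ltr0n fact_gt0.
have := expR_ge1Dxn k y0.
rewrite -(ler_pM2l f0) -(ler_pM2r x0) => h.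
rewrite mulrAC; apply: le_trans h.
rewrite mulrDr mulrDl mulr1 mulrCA divff ?lt0r_neq0// mulr1 exprSr.
by rewrite -mulrA mulVf ?lt0r_neq0// mulr1 lerDr mulr_ge0// ltW.
Qed.

Lemma is_derive_psi k x : is_derive x 1 (psi k) (psi k.+2 x - k%:R * psi k.+1 x).
Proof.
have [x0|x0|->] := ltgtP x 0.
- apply: (@near_eq_is_derive _ _ _ (cst 0)).
    near=> y; rewrite /psi ltNge ifN// negbK ltW//.
    by near: y; exact: lt_nbhsl.
  by apply: is_derive_eq; rewrite /psi ltNge (ltW x0)/= mulr0 subr0.
- apply: (@near_eq_is_derive _ _ _ (fun y => y^-1 ^+ k * expR (- y^-1))).
    near=> y; rewrite /psi ifT//.
    by near: y; exact: lt_nbhsr.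
  have xn0 : x != 0 by rewrite lt0r_neq0.
  have dV : is_derive x 1 (fun y : R => y^-1) (- x ^- 2).
    by apply: is_derive_eq; first exact: (@is_deriveV _ id); rewrite /GRing.scale/= mulr1.
  have dX : is_derive x 1 (fun y : R => y^-1 ^+ k) (k%:R * x^-1 ^+ k.-1 * (- x ^- 2)).
    have -> : (fun y : R => y^-1 ^+ k) = (fun y : R => y^-1) ^+ k.
      by apply/funext => y; rewrite exprfctE.
    exact: is_deriveX.
  have dN : is_derive x 1 (fun y : R => - y^-1) (x ^- 2).
    by apply: is_derive_eq; rewrite opprK.
  have dE : is_derive x 1 (fun y : R => expR (- y^-1)) (expR (- x^-1) * x ^- 2).
    exact: (@is_derive1_comp _ expR (fun y => - y^-1) x _ _ (is_derive_expR _) dN).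
  have := is_deriveM dX dE; congr (is_derive _ _ _ _).
  rewrite /psi x0 /GRing.scale/= -exprVn.
  case: k {dX} => [|k] /=; first by rewrite expr0; ring.
  by rewrite !exprS; ring.
- have E : psi k.+2 0 - k%:R * psi k.+1 0 = 0 by rewrite /psi ltxx mulr0 subr0.
  rewrite E.
  have dq : h^-1 *: (psi k (h *: 1 + 0) - psi k 0) @[h --> 0^'] --> (0 : R).
    apply/cvgrPdist_lt => e e0.
    have c0 : (0 : R) < k.+2`!%:R by rewrite ltr0n fact_gt0.
    near=> h; rewrite sub0r normrN addr0 /GRing.scale/= mulr1 {2}/psi ltxx subr0.
    rewrite {1}/psi; case: ifPn => h0; last by rewrite mulr0 normr0.
    rewrite mulrA -exprS -[X in `|X|](_ : psi k.+1 h = _); last by rewrite /psi h0.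
    rewrite ger0_norm ?psi_ge0//; apply: (le_lt_trans (psi_le _ h0)).
    rewrite -ltr_pdivlMl// mulrC -[ltLHS]gtr0_norm//.
    by near: h; apply: dnbhs0_lt; rewrite divr_gt0.
  by apply: DeriveDef; [apply/cvg_ex; exists 0; exact: dq|exact/cvg_lim].
Unshelve. all: by end_near. Qed.

Lemma diffn_psi n k : diffn n (psi k).
Proof.
elim: n k => [//|n ih] k.
exists (fun x => psi k.+2 x - k%:R * psi k.+1 x); first exact: is_derive_psi.
under eq_fun do rewrite -mulNr.
by apply: diffnD => //; exact: diffnZ.
Qed.

End bump.

(** * Mollifiers and smooth steps *)

Section mollifier.
Context {R : realType}.
Local Notation mu := (@lebesgue_measure R).
Implicit Types (f g h u w : R -> R) (t T x y z a b e : R).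

(** A smooth function, positive on [(0, 1)] and 0 elsewhere. *)
Definition rho x : R := psi 0 x * psi 0 (1 - x).

Lemma diffn_rho n : diffn n rho.
Proof.
apply: diffnM; first exact: diffn_psi.
have := diffn_affine (-1) 1 (@diffn_psi R n 0).
by congr (diffn _ _); apply/funext => x; congr psi; ring.
Qed.

Lemma rho_ge0 x : 0 <= rho x.
Proof. by rewrite mulr_ge0// psi_ge0. Qed.

Lemma psi0_le1 x : psi 0 x <= 1.
Proof.
rewrite /psi; case: ifPn => // x0; rewrite expr0 mul1r.
by rewrite -expR0 ler_expR oppr_le0 invr_ge0 ltW.
Qed.

Lemma rho_le1 x : rho x <= 1.
Proof. by rewrite -[leRHS]mulr1 ler_pM ?psi_ge0 ?psi0_le1. Qed.

Lemma rho_out x : ~~ (0 < x < 1) -> rho x = 0.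
Proof.
rewrite negb_and -!leNgt /rho /psi => /orP[x0|x1].
  by rewrite ltNge x0 mul0r.
by rewrite [0 < 1 - x]ltNge subr_le0 x1 mulr0.
Qed.

Lemma rho_continuous : continuous (rho : R -> R).
Proof.
move=> x; apply: differentiable_continuous; apply/derivable1_diffP.
by have [f' /(_ x) ? _] := diffn_rho 1; exact: ex_derive.
Qed.

Lemma measurable_rho : measurable_fun setT (rho : R -> R).
Proof. exact: continuous_measurable_fun rho_continuous. Qed.

Lemma L1_rho : L1 (rho : R -> R).
Proof.
apply: (L1_le measurable_rho _ (L1_one 1)) => x.
rewrite /one truncE; case: ifPn => [_|/rho_out ->]; last by rewrite normr0.
by rewrite !ger0_norm ?rho_ge0// rho_le1.
Qed.

(** The bump is not normalized: its mass is carried along as a factor and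
    cancels in the end. *)
Definition rho_mass : R := \int[mu]_x rho x.

Lemma rho_mass_gt0 : 0 < rho_mass.
Proof.
have m0 : 0 < expR (- 4) * expR (- 4) :> R by rewrite mulr_gt0 ?expR_gt0.
have q : (1/4 : R) < 3/4 by lra.
apply: (@lt_le_trans _ _ (expR (- 4) * expR (- 4) / 2)); first by rewrite divr_gt0.
have -> : expR (- 4) * expR (- 4) / 2 =
    \int[mu]_x ((cst (expR (- 4) * expR (- 4)) : R -> R) \_ `]1/4, 3/4[) x.
  have m1 : fine (mu `](1/4), (3/4)[%classic) = 1/2.
    by rewrite lebesgue_measure_itv/= lte_fin q/=; lra.
  rewrite -Rintegral_mkcond Rintegral_cst//; congr (_ * _).
  by rewrite [RHS]m1 mul1r.
apply: le_Rintegral => //; [exact: L1_cst_itv|exact: L1_rho|].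
move=> x _; rewrite patchE; case: ifPn => [/set_mem|_]; last exact: rho_ge0.
rewrite /= in_itv/= => /andP[x1 x2].
have p y : 1/4 < y -> expR (-4) <= psi 0 y.
  move=> y4; have y0 : 0 < y by lra.
  rewrite /psi y0 expr0 mul1r ler_expR lerN2.
  by rewrite -[leRHS]invrK lef_pV2 ?posrE ?invr_gt0//; lra.
by apply: ler_pM; rewrite ?expR_ge0//; apply: p; lra.
Qed.

Definition step x : R := \int[mu]_(s in `]-oo, x]) rho s.

Lemma L1_on (D : set R) f : measurable D -> L1 f -> mu.-integrable D (EFin \o f).
Proof. by move=> mD; apply: integrableS. Qed.

Lemma is_derive_step x : is_derive x 1 step (rho x).
Proof.
have x1 : x < x + 1 by rewrite ltrDl.
have cx : {for x, continuous rho} by exact: rho_continuous.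
have [] := @continuous_FTC1 R rho -oo%O x (x + 1) x1
  (L1_on (measurable_itv _) L1_rho) (ltNyr _) cx.
by move=> dP <-; rewrite derive1E; exact: derivableP.
Qed.

Lemma diffn_step n : diffn n step.
Proof.
case: n => [//|n]; exists rho; [exact: is_derive_step|exact: diffn_rho].
Qed.

Lemma step_ge0 x : 0 <= step x.
Proof. by apply: Rintegral_ge0 => s _; exact: rho_ge0. Qed.

Lemma step_le x : step x <= rho_mass.
Proof.
rewrite /step Rintegral_mkcond; apply: le_Rintegral => //.
- by apply/(L1_restrict rho (measurable_itv _)); apply: L1_on => //; exact: L1_rho.
- exact: L1_rho.
- by move=> s _; rewrite patchE; case: ifPn => // _; exact: rho_ge0.
Qed.

Lemma step0 x : x <= 0 -> step x = 0.
Proof.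
move=> x0; rewrite /step (@eq_Rintegral _ _ _ mu _ (cst 0)).
  by rewrite Rintegral_cst// mul0r.
move=> s /set_mem; rewrite /= in_itv/= => sx; apply: rho_out.
by rewrite negb_and -!leNgt (le_trans sx).
Qed.

Lemma step1 x : 1 <= x -> step x = rho_mass.
Proof.
move=> x1; rewrite /step Rintegral_mkcond; apply: eq_Rintegral => s _.
rewrite patchE; case: ifPn => // /negP sx; rewrite rho_out// negb_and -!leNgt.
apply/orP; right; rewrite leNgt; apply/negP => s1; apply: sx; apply: mem_set.
by rewrite /= in_itv/=; lra.
Qed.

Lemma measurable_step : measurable_fun setT step.
Proof.
apply: continuous_measurable_fun => x.
apply: differentiable_continuous; apply/derivable1_diffP.
by have := is_derive_step x => ?; exact: ex_derive.
Qed.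

Definition eps (n : nat) : R := n.+1%:R^-1.

Lemma eps_gt0 n : 0 < eps n. Proof. by rewrite invr_gt0. Qed.

Lemma cvg_eps : eps n @[n --> \oo] --> 0.
Proof. exact: cvg_harmonic. Qed.

Definition rho_at a e x : R := e^-1 * rho (e^-1 * x + - a / e).

Lemma rho_at_ge0 a e x : 0 < e -> 0 <= rho_at a e x.
Proof. by move=> e0; rewrite mulr_ge0 ?rho_ge0// invr_ge0 ltW. Qed.

Lemma rho_at_le a e x : 0 < e -> rho_at a e x <= e^-1.
Proof. by move=> e0; rewrite ler_piMr ?rho_le1// invr_ge0 ltW. Qed.

Lemma rho_at_out a e x : 0 < e -> ~~ (a < x < a + e) -> rho_at a e x = 0.
Proof.
move=> e0 h; rewrite /rho_at rho_out ?mulr0//; apply: contra h => /andP[].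
have -> : e^-1 * x + - a / e = (x - a) / e by rewrite mulrDl mulrC.
by rewrite pmulr_lgt0 ?invr_gt0// ltr_pdivrMr// mul1r => ? ?; lra.
Qed.

Lemma L1_rho_at a e : 0 < e -> L1 (rho_at a e).
Proof.
move=> e0; apply: L1Z; apply: integrable_affine L1_rho.
by rewrite invr_eq0 lt0r_neq0.
Qed.

Lemma integral_rho_at a e : 0 < e -> \int[mu]_x rho_at a e x = rho_mass.
Proof.
move=> e0; have en0 : e^-1 != 0 by rewrite invr_eq0 lt0r_neq0.
rewrite RintegralZl//; last exact: (integrable_affine _ en0 L1_rho).
rewrite /rho_mass [RHS](integral_affine (- a / e) en0 L1_rho).
by rewrite gtr0_norm// invr_gt0.
Qed.

Lemma L1_mul_bounded (M : R) f g : measurable_fun setT g ->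
  (forall x, `|g x| <= M) -> L1 f -> L1 (fun x => f x * g x).
Proof.
move=> mg gM lf; apply: (L1_le _ _ (L1Z M lf)).
  by apply: measurable_funM => //; exact: L1_measurable.
move=> x; rewrite !normrM mulrC ler_wpM2r//; apply: le_trans (gM x) _.
exact: ler_norm.
Qed.

(** The bump [rho_at a e] is at most [e^-1] and lives on an interval of
    length [e] next to [a], so the error is controlled by the mean oscillation
    of [w] around [a], which vanishes in the limit at a Lebesgue point. *)
Lemma mollifier_cvg w a : L1 w -> lebesgue_pt w a ->
  \int[mu]_x (w x * rho_at a (eps n) x) @[n --> \oo] --> rho_mass * w a.
Proof.
move=> lw leb.
have E2 : davg w a (2 * eps n) @[n --> \oo] --> 0%E.
  move=> A /leb[d /= d0 hd].
  have d2 : 0 < d / 2 by rewrite divr_gt0.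
  have /cvgrPdist_lt/(_ _ d2) := cvg_eps.
  apply: filterS => n; rewrite sub0r normrN (gtr0_norm (eps_gt0 n)) => en.
  have e20 : 0 < 2 * eps n by rewrite mulr_gt0// eps_gt0.
  by apply: hd => //=; rewrite sub0r normrN gtr0_norm//; lra.
have key n : (`|rho_mass * w a - \int[mu]_x (w x * rho_at a (eps n) x)|%:E <=
    4%:E * davg w a (2 * eps n))%E.
  have e0 := eps_gt0 n; have le := L1_rho_at a e0; have me := L1_measurable le.
  have lwe : L1 (fun x => w x * rho_at a (eps n) x).
    apply: (@L1_mul_bounded (eps n)^-1) => // x.
    by rewrite ger0_norm ?rho_at_le ?rho_at_ge0.
  rewrite -(integral_rho_at a e0) mulrC -RintegralZl//.
  rewrite -RintegralB//; last exact: L1Z.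
  have ld : L1 (fun x => w a * rho_at a (eps n) x - w x * rho_at a (eps n) x).
    by apply: L1B => //; exact: L1Z.
  rewrite EFin_normr_Rintegral//.
  apply: (le_trans (le_abse_integral _ _ (measurable_int mu ld))) => //.
  rewrite /davg /iavg lebesgue_measure_ball; last by rewrite mulr_ge0// ltW.
  (* The ball of radius [2 * eps n] has measure [4 * eps n], whence the factor
     4 between [davg] and the bound [(eps n)^-1] of the bump. *)
  have -> : (2 * eps n *+ 2)%:E^-1%E = (((eps n)^-1) / 4)%:E :> \bar R.
    rewrite inver ifF; last first.
      by apply/negbTE; rewrite mulrn_eq0/= mulf_neq0// lt0r_neq0.
    by congr EFin; rewrite -mulr_natl mulrA -natrM invfM mulrC.
  rewrite muleA -EFinM mulrC divfK// -ge0_integralZl//=; first last.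
  - by rewrite lee_fin invr_ge0 ltW.
  - apply/measurable_EFinP; apply: measurableT_comp => //.
    apply: measurable_funTS; apply: measurable_funB => //; exact: L1_measurable.
  - exact: measurable_ball.
  rewrite [X in (_ <= X)%E]integral_mkcond.
  apply: ge0_le_integral => //.
  - by apply/measurable_EFinP; apply: measurableT_comp => //; exact: L1_measurable ld.
  - apply/(measurable_restrictT _ _).1; first exact: measurable_ball.
    apply/measurable_EFinP; apply: measurable_funM => //; apply: measurableT_comp => //.
    apply: measurable_funTS; apply: measurable_funB => //; exact: L1_measurable.
  move=> x _; rewrite patchE; case: ifPn => [_|/negP nb].
    rewrite -EFinM lee_fin -mulrBl normrM mulrC distrC ler_wpM2r//.
    by rewrite ger0_norm ?rho_at_le ?rho_at_ge0.
  rewrite rho_at_out ?mulr0 ?subrr ?normr0//.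
  apply/negP => /andP[x1 x2]; apply: nb; apply: mem_set.
  by rewrite /ball/= ltr0_norm; lra.
apply/cvgrPdist_lt => e e0.
have e4 : (0 < (e / 4)%:E)%E by rewrite lte_fin divr_gt0.
have : \forall n \near \oo, (davg w a (2 * eps n) < (e / 4)%:E)%E.
  by apply: (E2 [set y | y < (e/4)%:E]%E); exact: (open_ereal_lt' e4).
apply: filterS => n hn; rewrite -lte_fin.
apply: (le_lt_trans (key n)).
by rewrite -lte_pdivlMl// -EFinM (mulrC 4^-1).
Qed.

End mollifier.

(** * A function is the primitive of its weak derivative *)

Section weak_derivative.
Context {R : realType}.
Local Notation mu := (@lebesgue_measure R).
Implicit Types (f g h u w : R -> R) (t T x y z a b e : R).

Lemma L1_dominated_cvg (F : nat -> R -> R) f g :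
  (forall n, measurable_fun setT (F n)) -> measurable_fun setT f ->
  (forall x, F n x @[n --> \oo] --> f x) -> L1 g ->
  (forall n x, `|F n x| <= g x) ->
  \int[mu]_x F n x @[n --> \oo] --> \int[mu]_x f x.
Proof.
move=> mF mf Ff lg Fg.
have := @dominated_convergence _ _ R mu setT measurableT
  (fun n x => (F n x)%:E) (fun x => (f x)%:E) (fun x => (g x)%:E)%E.
case => //.
- by move=> n; apply/measurable_EFinP; exact: mF.
- exact/measurable_EFinP.
- by apply: aeW => x _; apply: cvg_EFin; [exact: nearW|exact: Ff].
- by apply: aeW => x n _; rewrite lee_fin.
move=> lf _ cvF; apply: fine_cvg; rewrite fineK; last exact: integrable_fin_num.
exact: cvF.
Qed.

Definition step_at a e x : R := step (e^-1 * x + - a / e).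

Lemma step_atE a e x : step_at a e x = step ((x - a) / e).
Proof. by rewrite /step_at mulrDl mulrC. Qed.

Lemma measurable_step_at a e : measurable_fun setT (step_at a e).
Proof.
apply: (measurableT_comp measurable_step); apply: measurable_funD => //.
Qed.

Lemma step_at_cvg g a : L1 g ->
  \int[mu]_x (g x * step_at a (eps n) x) @[n --> \oo] -->
  rho_mass * \int[mu]_(x in `]a, +oo[) g x.
Proof.
move=> lg; have mg := L1_measurable lg.
rewrite -RintegralZl//; last exact: L1_on.
rewrite Rintegral_mkcond.
apply: (@L1_dominated_cvg _ _ (fun x => rho_mass * `|g x|)).
- by move=> n; apply: measurable_funM => //; exact: measurable_step_at.
- apply: (measurable_restrictT (fun x => rho_mass * g x) (measurable_itv `]a, +oo[)).1.
  by apply: measurable_funTS; exact: measurable_funM.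
- move=> x; apply: cvg_near_cst; rewrite patchE.
  case: ifPn => [/set_mem|/negP ax]; last first.
    apply: nearW => n; rewrite step_atE step0 ?mulr0// pmulr_lle0 ?invr_gt0 ?eps_gt0//.
    rewrite subr_le0 leNgt; apply/negP => h; apply: ax; apply: mem_set.
    by rewrite /= in_itv/= h.
  rewrite /= in_itv/= andbT -subr_gt0 => ax.
  have /cvgrPdist_lt/(_ _ ax) := @cvg_eps R; apply: filterS => n.
  rewrite sub0r normrN (gtr0_norm (eps_gt0 n)) => ex.
  rewrite step_atE step1; first by rewrite mulrC.
  by rewrite ler_pdivlMr ?eps_gt0// mul1r ltW.
- exact: L1Z (L1_abs lg).
- move=> n x; rewrite normrM mulrC ler_wpM2r// ger0_norm ?step_ge0//.
  exact: step_le.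
Qed.

Lemma is_derive_step_at a e x : is_derive x 1 (step_at a e) (rho_at a e x).
Proof.
have dab := is_derive_affine e^-1 (- a / e) x.
have := @is_derive1_comp _ step (fun x => e^-1 * x + - a / e) x _ _
  (is_derive_step _) dab.
by rewrite (mulrC (rho _)).
Qed.

(** The two steps cancel on the right of [b + e]: the difference is a
    smooth plateau between [a] and [b + e]. *)
Lemma test_function_bump T a b e : 0 < a -> a < b -> 0 < e -> b + e < T ->
  test_function T (fun x => step_at a e x - step_at b e x).
Proof.
move=> a0 ab e0 beT; split.
  move=> n x; apply: diffn_derivable.
  have -> : (fun x => step_at a e x - step_at b e x) =
            (fun x => step_at a e x + (-1) * step_at b e x).
    by apply/funext => y; rewrite mulN1r.
  by apply: diffnD; last apply: diffnZ; apply: diffn_affine; exact: diffn_step.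
exists a, (b + e); split => // x; apply: contraNT; rewrite negb_and -!ltNge.
move=> /orP[xa|bx]; rewrite !step_atE.
  by rewrite !step0 ?subrr// pmulr_lle0 ?invr_gt0//; lra.
by rewrite !step1 ?subrr// ler_pdivlMr//; lra.
Qed.

Lemma truncM T f g x : ((fun x => f x * g x) \_ `]0, T[) x = (f \_ `]0, T[) x * g x.
Proof. by rewrite !truncE; case: ifP => //; rewrite mul0r. Qed.

(** The derivative of the plateau from [a] to [b + e] is
    the difference of the bumps at [a] and at [b], which in the limit pick the
    values of [f]; the plateau itself tends to [rho_mass] times the indicator function of the
    interval. *)
Lemma weak_derivative_increment T f g a b : L1 (f \_ `]0, T[) -> L1 (g \_ `]0, T[) ->
  is_weak_derivative T f g -> 0 < a -> a < b -> b < T ->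
  lebesgue_pt (f \_ `]0, T[) a -> lebesgue_pt (f \_ `]0, T[) b ->
  (f \_ `]0, T[) a + \int[mu]_(x in `]a, +oo[) (g \_ `]0, T[) x =
  (f \_ `]0, T[) b + \int[mu]_(x in `]b, +oo[) (g \_ `]0, T[) x.
Proof.
move=> lf lg [_ _ wd] a0 ab bT fa fb.
set F := f \_ _ in lf fa fb *; set G := g \_ _ in lg *.
have lFr c n : L1 (fun x => F x * rho_at c (eps n) x).
  apply: (@L1_mul_bounded _ (eps n)^-1) => //.
    exact: L1_measurable (L1_rho_at _ (eps_gt0 n)).
  by move=> x; rewrite ger0_norm ?rho_at_le ?rho_at_ge0 ?eps_gt0.
have lGs c n : L1 (fun x => G x * step_at c (eps n) x).
  apply: (@L1_mul_bounded _ rho_mass) => //; first exact: measurable_step_at.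
  by move=> x; rewrite ger0_norm ?step_ge0 ?step_le.
have wdE n : b + eps n < T ->
    \int[mu]_x (F x * rho_at a (eps n) x) - \int[mu]_x (F x * rho_at b (eps n) x) =
    - (\int[mu]_x (G x * step_at a (eps n) x) - \int[mu]_x (G x * step_at b (eps n) x)).
  move=> bn; have := wd _ (test_function_bump a0 ab (eps_gt0 n) bn).
  have dphi x : is_derive x 1 (fun x => step_at a (eps n) x - step_at b (eps n) x)
      (rho_at a (eps n) x - rho_at b (eps n) x).
    by apply: is_deriveB; exact: is_derive_step_at.
  rewrite (is_derive_derive1 dphi) [X in X = _ -> _]Rintegral_mkcond.
  rewrite [X in _ = - X -> _]Rintegral_mkcond.
  under eq_Rintegral do rewrite truncM mulrBr.
  under [X in _ = - X -> _]eq_Rintegral do rewrite truncM mulrBr.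
  by rewrite RintegralB// ?RintegralB//; [exact: lGs|exact: lGs|exact: lFr|exact: lFr].
have c1 : \int[mu]_x (F x * rho_at a (eps n) x) -
    \int[mu]_x (F x * rho_at b (eps n) x) @[n --> \oo] -->
    rho_mass * F a - rho_mass * F b.
  by apply: cvgB; exact: mollifier_cvg.
have c2 : - (\int[mu]_x (G x * step_at a (eps n) x) -
      \int[mu]_x (G x * step_at b (eps n) x)) @[n --> \oo] -->
    - (rho_mass * (\int[mu]_(x in `]a, +oo[) G x) -
       rho_mass * \int[mu]_(x in `]b, +oo[) G x).
  by apply: cvgN; apply: cvgB; exact: step_at_cvg.
have c3 : \int[mu]_x (F x * rho_at a (eps n) x) -
    \int[mu]_x (F x * rho_at b (eps n) x) @[n --> \oo] -->
    - (rho_mass * (\int[mu]_(x in `]a, +oo[) G x) -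
       rho_mass * \int[mu]_(x in `]b, +oo[) G x).
  apply: cvg_trans c2; apply: near_eq_cvg.
  have bT' : 0 < T - b by rewrite subr_gt0.
  have /cvgrPdist_lt/(_ _ bT') := @cvg_eps R; apply: filterS => n.
  rewrite sub0r normrN (gtr0_norm (eps_gt0 n)) => en /=.
  by rewrite -wdE//; lra.
have e : rho_mass * (F a - F b) = rho_mass *
    - (\int[mu]_(x in `]a, +oo[) G x - \int[mu]_(x in `]b, +oo[) G x).
  by rewrite mulrN !mulrBr; exact: (cvg_unique _ c1 c3).
have := mulfI (lt0r_neq0 (@rho_mass_gt0 R)) e; lra.
Qed.

(** Almost every point is a Lebesgue point, and the increments
    of [f] between these are the integrals of [g]. *)
Lemma weak_derivative_primitive T f g : 0 < T -> L1 (f \_ `]0, T[) ->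
  L1 (g \_ `]0, T[) -> is_weak_derivative T f g ->
  exists c, eq_ae T f (fun t => c + convol (one T) (g \_ `]0, T[) t).
Proof.
move=> T0 lf lg wd.
have leb : {ae mu, forall x, lebesgue_pt (f \_ `]0, T[) x}.
  apply: lebesgue_differentiation; apply: open_integrable_locally => //.
  exact: openT.
have [a /andP[a0 aT] la] := ae_ex_itv T0 leb.
pose L x := \int[mu]_(y in `]x, +oo[) (g \_ `]0, T[) y.
(* The constant is [f(a)] minus the integral of [g] from 0 to [a]. *)
exists ((f \_ `]0, T[) a + L a - \int[mu]_y (g \_ `]0, T[) y).
apply: ae_impl leb => x lx; rewrite in_itv/= => xT; have /andP[x0 xT'] := xT.
have fxE : f x = (f \_ `]0, T[) x by rewrite truncE xT.
have inc : (f \_ `]0, T[) a + L a = f x + L x.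
  rewrite fxE; have [ax|xa|->//] := ltgtP a x.
    exact: weak_derivative_increment.
  by symmetry; exact: weak_derivative_increment.
rewrite inc convol_oneE//; last exact: causal_trunc.
suff -> : \int[mu]_y (g \_ `]0, T[) y =
    \int[mu]_(s in `]-oo, x]) (g \_ `]0, T[) s + L x by ring.
rewrite /L [X in _ = X + _]Rintegral_mkcond [X in _ = _ + X]Rintegral_mkcond.
rewrite -RintegralD//.
- apply: eq_Rintegral => y _; rewrite !patchE !mem_setE !in_itv/= andbT.
  by case: (leP y x); rewrite ?addr0 ?add0r.
- by apply/(L1_restrict _ (measurable_itv _)); exact: L1_on.
- by apply/(L1_restrict _ (measurable_itv _)); exact: L1_on.
Qed.

End weak_derivative.

(** * Differentiability of the Gamma function on the unit interval *)

Section gamma.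
Context {R : realType}.
Local Notation mu := (@lebesgue_measure R).
Implicit Types (f g h u w : R -> R) (t T x y z a b e s d : R).

Lemma ln_le_powR s d : 0 < s -> 0 < d -> ln s <= d^-1 * s `^ d.
Proof.
move=> s0 d0; rewrite -(ler_pM2l d0) mulrA divff ?lt0r_neq0// mul1r -ln_powR.
by apply: ltW; apply: ln_sublinear; exact: powR_gt0.
Qed.

Lemma opp_ln_le_powR s d : 0 < s -> 0 < d -> - ln s <= d^-1 * s `^ (- d).
Proof.
move=> s0 d0; rewrite -(ler_pM2l d0) mulrA divff ?lt0r_neq0// mul1r mulrN -mulNr.
by rewrite -ln_powR; apply: ltW; apply: ln_sublinear; exact: powR_gt0.
Qed.

(** A common integrable bound, for the exponents in [(u, 1)], of the integrand
    of Gamma and of its derivative in the exponent: halving the exponent [u] at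
    0 and the rate of decay at infinity leaves room for the logarithm. *)
Definition gamma_dom (u s : R) : R :=
  2 / u * (powT 1 (u / 2) s + 2 * exponential_pdf (1/2) s).

Lemma L1_gamma_dom (u : R) : 0 < u -> L1 (gamma_dom u).
Proof.
move=> u0; apply: L1Z; apply: L1D; first by apply: L1_powT; rewrite ?divr_gt0.
apply: L1Z; apply: integrable_exponential_pdf; lra.
Qed.

Lemma gamma_dom_ge0 (u s : R) : 0 < u -> 0 <= gamma_dom u s.
Proof.
move=> u0; have h : (0 : R) <= 1/2 by lra.
apply: mulr_ge0; first by rewrite divr_ge0// ltW.
by apply: addr_ge0; [exact: powT_ge0|rewrite mulr_ge0// exponential_pdf_ge0].
Qed.

Lemma gamma_dom_lt1 (u s : R) : 0 < s < 1 -> 0 < u ->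
  2 / u * s `^ (u / 2 - 1) <= gamma_dom u s.
Proof.
move=> s01 u0; rewrite /gamma_dom powTE// mulrDr lerDl.
have h : (0 : R) <= 1/2 by lra.
apply: mulr_ge0; first by rewrite divr_ge0// ltW.
by rewrite mulr_ge0// exponential_pdf_ge0.
Qed.

Lemma gamma_dom_ge1 (u s : R) : 1 <= s -> 0 < u ->
  2 / u * expR (- (s / 2)) <= gamma_dom u s.
Proof.
move=> s1 u0; rewrite /gamma_dom /exponential_pdf patchE ifT; last first.
  by apply: mem_set; rewrite /= in_itv/=; lra.
have -> : 2 * (1 / 2 * expR (- (1 / 2) * s)) = expR (- (s / 2)).
  by rewrite mulrA mulrCA divff// !mulr1 mul1r; congr expR; ring.
by rewrite mulrDr lerDr mulr_ge0 ?powT_ge0// divr_ge0// ltW.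
Qed.

Lemma powR_lt1_le s x y : 0 < s < 1 -> x <= y -> s `^ y <= s `^ x.
Proof.
move=> /andP[s0 s1] xy; have s01 : 0 < s <= 1 by rewrite s0 ltW.
exact: (ger_powR s01).
Qed.

Lemma gamma_integrand_le (u x s : R) : 0 < u < 1 -> u < x < 1 -> 0 < s ->
  s `^ (x - 1) * expR (- s) <= gamma_dom u s.
Proof.
move=> /andP[u0 u1] /andP[ux x1] s0.
have u2 : 1 <= 2 / u by rewrite ler_pdivlMr//; lra.
have [s1|s1] := ltP s 1.
  have s01 : 0 < s < 1 by rewrite s0.
  apply: le_trans (gamma_dom_lt1 s01 u0).
  rewrite mulrC; apply: ler_pM; rewrite ?expR_ge0 ?powR_ge0//.
    by apply: le_trans u2; rewrite -expR0 ler_expR; lra.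
  by apply: powR_lt1_le => //; lra.
apply: le_trans (gamma_dom_ge1 s1 u0).
apply: ler_pM; rewrite ?expR_ge0 ?powR_ge0//; last by rewrite ler_expR; lra.
apply: le_trans u2; rewrite -[leRHS](powRr0 s).
by apply: (ler_powR s1); lra.
Qed.

Lemma gamma_log_integrand_le (u x s : R) : 0 < u < 1 -> u < x < 1 -> 0 < s ->
  `|ln s * (s `^ (x - 1) * expR (- s))| <= gamma_dom u s.
Proof.
move=> /andP[u0 u1] /andP[ux x1] s0.
rewrite normrM [X in _ * X]ger0_norm ?mulr_ge0 ?powR_ge0 ?expR_ge0//.
have [s1|s1] := ltP s 1.
  have s01 : 0 < s < 1 by rewrite s0.
  apply: le_trans (gamma_dom_lt1 s01 u0).
  rewrite ler0_norm; last by apply: ln_le0; exact: ltW.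
  have -> : u / 2 - 1 = - (u / 2) + (u - 1) by field.
  rewrite (@powRD _ s (- (u / 2))); last by rewrite (lt0r_neq0 s0) implybT.
  rewrite [leRHS]mulrA; apply: ler_pM.
  - by rewrite oppr_ge0 ln_le0// ltW.
  - by rewrite mulr_ge0 ?powR_ge0 ?expR_ge0.
  - have u2' : 0 < u / 2 by rewrite divr_gt0.
    by have := opp_ln_le_powR s0 u2'; rewrite invf_div.
  - rewrite -[leRHS]mulr1; apply: ler_pM; rewrite ?powR_ge0 ?expR_ge0//.
      by apply: powR_lt1_le => //; lra.
    by rewrite -expR0 ler_expR; lra.
apply: le_trans (gamma_dom_ge1 s1 u0).
rewrite ger0_norm ?ln_ge0//.
have l1 : s `^ (x - 1) <= 1.
  by rewrite -[leRHS](powRr0 s); apply: (ler_powR s1); lra.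
have l2 : ln s <= 2 * expR (s / 2).
  apply: le_trans (ltW (ln_sublinear s0)) _.
  have := expR_ge1Dx (s / 2); lra.
have -> : 2 / u * expR (- (s / 2)) = 2 * expR (s / 2) * (u^-1 * expR (- s)).
  have -> : - (s / 2) = s / 2 + - s by field.
  by rewrite expRD; ring.
apply: ler_pM => //; rewrite ?ln_ge0 ?mulr_ge0 ?powR_ge0 ?expR_ge0//.
apply: ler_pM; rewrite ?powR_ge0 ?expR_ge0//.
by apply: le_trans l1 _; rewrite -invr1 lef_pV2 ?posrE//; exact: ltW.
Qed.

(** The Gamma integral differentiated under the integral sign. *)
Definition Dgamma x : R :=
  \int[mu]_(s in `]0, +oo[) (ln s * (s `^ (x - 1) * expR (- s))).

Let pos : set R := `]0, +oo[%classic.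

Let mpos : measurable pos. Proof. exact: measurable_itv. Qed.

Lemma measurable_gamma_integrand x :
  measurable_fun [set: R] (fun s : R => s `^ (x - 1) * expR (- s)).
Proof.
apply: measurable_funM; first exact: measurable_powR.
exact: (measurableT_comp (@measurable_expR R)).
Qed.

Lemma measurable_gamma_log_integrand x :
  measurable_fun [set: R] (fun s : R => ln s * (s `^ (x - 1) * expR (- s))).
Proof.
apply: measurable_funM; first exact: measurable_ln.
exact: measurable_gamma_integrand.
Qed.

Lemma gamma_dom_integrable (u : R) f : 0 < u ->
  measurable_fun [set: R] f -> (forall s, 0 < s -> `|f s| <= gamma_dom u s) ->
  mu.-integrable pos (EFin \o f).
Proof.
move=> u0 mf fd.
apply: (@le_integrable _ _ _ mu pos mpos _ (EFin \o gamma_dom u)).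
- by apply/measurable_EFinP; exact: measurable_funTS.
- move=> s; rewrite /pos/= in_itv/= andbT lee_fin => s0.
  by rewrite (le_trans (fd _ s0))// ler_norm.
- by apply: L1_on => //; exact: L1_gamma_dom.
Qed.

Lemma gamma_integrable x : 0 < x < 1 ->
  mu.-integrable pos (EFin \o (fun s => s `^ (x - 1) * expR (- s))).
Proof.
move=> x01; have x2 : 0 < x / 2 by lra.
apply: (gamma_dom_integrable x2); first exact: measurable_gamma_integrand.
move=> s s0; rewrite ger0_norm ?mulr_ge0 ?powR_ge0 ?expR_ge0//.
by apply: gamma_integrand_le => //; lra.
Qed.

Lemma gamma_log_integrable x : 0 < x < 1 ->
  mu.-integrable pos (EFin \o (fun s => ln s * (s `^ (x - 1) * expR (- s)))).
Proof.
move=> x01; have x2 : 0 < x / 2 by lra.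
apply: (gamma_dom_integrable x2); first exact: measurable_gamma_log_integrand.
by move=> s s0; apply: gamma_log_integrand_le => //; lra.
Qed.

Lemma is_derive_gamma_integrand s x : 0 < s ->
  is_derive x 1 (fun x => s `^ (x - 1) * expR (- s))
    (ln s * (s `^ (x - 1) * expR (- s))).
Proof.
move=> s0.
have -> : (fun x => s `^ (x - 1) * expR (- s)) =
    (fun x => expR (- s) * expR (ln s * x + - ln s)).
  apply/funext => y; rewrite /powR (negbTE (lt0r_neq0 s0)) mulrC; congr (_ * expR _); ring.
have d1 := is_derive_affine (ln s) (- ln s) x.
have d2 := @is_derive1_comp _ expR (fun x => ln s * x + - ln s) x _ _
  (is_derive_expR _) d1.
have := @is_deriveZ _ _ _ (expR \o (fun x => ln s * x + - ln s)) (expR (- s)) x 1 _ d2.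
congr (is_derive _ _ _ _).
rewrite /GRing.scale/= /powR (negbTE (lt0r_neq0 s0)).
have -> : (x - 1) * ln s = ln s * x + - ln s by ring.
by ring.
Qed.

Lemma is_derive_Gamma x : 0 < x < 1 -> is_derive x 1 (@Gamma R) (Dgamma x).
Proof.
move=> x01; have /andP[x0 x1] := x01.
have u01 : 0 < x / 2 < 1 by lra.
have inI y : `]x / 2, 1[%classic y -> x / 2 < y < 1 by rewrite /= in_itv.
have Ix : `]x / 2, 1[%classic x by rewrite /= in_itv/=; lra.
have intf y : `]x / 2, 1[%classic y -> mu.-integrable pos
    (EFin \o (fun s => s `^ (y - 1) * expR (- s))).
  by move=> /inI yI; apply: gamma_integrable; lra.
have posE s : pos s -> 0 < s by rewrite /pos/= in_itv/= andbT.
have derf y s : `]x / 2, 1[%classic y -> pos s ->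
    derivable (fun y => s `^ (y - 1) * expR (- s)) y 1.
  move=> _ /posE s0; have := @is_derive_gamma_integrand s y s0 => ?.
  exact: ex_derive.
have d1E y s : 0 < s -> partial1of2 (fun y s => s `^ (y - 1) * expR (- s)) y s =
    ln s * (s `^ (y - 1) * expR (- s)).
  by move=> s0; rewrite partial1of2E; have := @is_derive_gamma_integrand s y s0 => ?;
    exact: derive_val.
have dom y s : `]x / 2, 1[%classic y -> pos s ->
    `|partial1of2 (fun y s => s `^ (y - 1) * expR (- s)) y s| <= gamma_dom (x / 2) s.
  by move=> /inI yI /posE s0; rewrite d1E//; exact: gamma_log_integrand_le.
have u0 : 0 < x / 2 by lra.
have iG := L1_on mpos (L1_gamma_dom u0).
have G0 s := @gamma_dom_ge0 _ s u0.
apply: DeriveDef.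
  exact: (@derivable_under_integral _ _ _ mu
    (fun y s => s `^ (y - 1) * expR (- s)) pos mpos _ _ _ Ix intf derf _ G0 iG dom).
rewrite -derive1E.
have -> := @differentiation_under_integral _ _ _ mu
  (fun y s => s `^ (y - 1) * expR (- s)) pos mpos _ _ _ Ix intf derf _ G0 iG dom.
by apply: eq_Rintegral => s /set_mem/posE s0; exact: d1E.
Qed.

Lemma continuous_Dgamma x : 0 < x < 1 -> {for x, continuous Dgamma}.
Proof.
move=> x01; have u01 : 0 < x / 2 < 1 by lra.
have inI y : `]x / 2, 1[%classic y -> x / 2 < y < 1 by rewrite /= in_itv.
have posE s : pos s -> 0 < s by rewrite /pos/= in_itv/= andbT.
have u0 : 0 < x / 2 by lra.
have iG := L1_on mpos (L1_gamma_dom u0).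
apply: (@continuity_under_integral _ _ _ mu
  (fun y s => ln s * (s `^ (y - 1) * expR (- s))) pos mpos (x / 2) 1 _ _ _ iG).
- by move=> y /inI yI; apply: gamma_log_integrable; lra.
- apply: aeW => s /posE s0 y _; apply: differentiable_continuous; apply/derivable1_diffP.
  have h := @is_derive_gamma_integrand s y s0.
  by have := @is_deriveZ _ _ _ _ (ln s) y 1 _ h => hz; exact: (@ex_derive _ _ _ _ _ _ _ hz).
- move=> y /inI yI; apply: aeW => s /posE s0; exact: gamma_log_integrand_le.
- by apply: mem_set; rewrite /= in_itv/=; lra.
Qed.

Lemma Dgamma_bounded (u : R) : 0 < u < 1 ->
  exists2 M : R, 0 <= M & forall x, u < x < 1 -> `|Dgamma x| <= M.
Proof.
move=> u01; have /andP[u0 u1] := u01.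
have iG := L1_on mpos (L1_gamma_dom u0).
exists (\int[mu]_(s in pos) gamma_dom u s).
  by apply: Rintegral_ge0 => s _; exact: gamma_dom_ge0.
move=> x ux; have x01 : 0 < x < 1 by lra.
have ix := gamma_log_integrable x01.
have h1 : `|Dgamma x| <= \int[mu]_(s in pos) `|ln s * (s `^ (x - 1) * expR (- s))| :=
  @le_normr_Rintegral _ _ _ mu pos _ mpos ix.
apply: (le_trans h1).
apply: le_Rintegral => //; first exact: integrable_norm.
move=> s; rewrite /pos/= in_itv/= andbT => s0; exact: gamma_log_integrand_le.
Qed.

(** The integral over [(0, 1)] already gives the bound.  It is uniform in the
    argument, hence it bounds the reciprocal of Gamma in the kernel. *)
Lemma Gamma_ge x : 0 < x < 1 -> expR (- 1) <= Gamma x.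
Proof.
move=> x01; rewrite /Gamma Rintegral_mkcond.
have -> : expR (- 1) = \int[mu]_z (expR (- 1) * one 1 z) :> R.
  have m1 : fine (mu `]0, 1[%classic) = 1.
    by rewrite lebesgue_measure_itv/= lte_fin ltr01 oppr0 adde0.
  rewrite RintegralZl//; last exact: L1_one.
  by rewrite /one -Rintegral_mkcond Rintegral_cst// [X in _ * (_ * X)]m1 !mulr1.
apply: le_Rintegral => //; first exact: L1Z (L1_one 1).
  apply: (L1_restrict _ mpos).1; exact: gamma_integrable.
move=> s _; rewrite /one truncE patchE.
case: ifPn => [s01|_]; last first.
  by rewrite mulr0; case: ifP => // _; rewrite mulr_ge0 ?powR_ge0 ?expR_ge0.
rewrite ifT; last by apply: mem_set; rewrite /= in_itv/=; lra.
rewrite mulr1 -[leLHS]mul1r; apply: ler_pM; rewrite ?expR_ge0//.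
  by rewrite -[leLHS](powRr0 s); apply: powR_lt1_le => //; lra.
by rewrite ler_expR; lra.
Qed.

End gamma.

(** * Derivatives relative to a closed interval *)

Section relative_derivative.
Context {R : realType}.
Local Notation mu := (@lebesgue_measure R).
Implicit Types (f g h u w F : R -> R) (t T x y z a b e s d : R).

Lemma is_derivative_onP (D : set R) f g t e : is_derivative_on D f g -> D t -> 0 < e ->
  exists2 d, 0 < d & forall x, D x -> x != t -> `|x - t| < d ->
    `|g t - (x - t)^-1 * (f x - f t)| < e.
Proof.
move=> dfg Dt e0; have := dfg t Dt => /cvgrPdist_lt/(_ _ e0)[d /= d0 hd].
by exists d => // x Dx xt xd; apply: hd => //; rewrite /ball/= distrC.
Qed.

Lemma is_derivative_on_continuous (D : set R) f g : is_derivative_on D f g ->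
  {within D, continuous f}.
Proof.
move=> dfg; apply/subspace_continuousP => t Dt.
apply/cvgrPdist_lt => e e0.
have [d d0 hd] := is_derivative_onP dfg Dt ltr01.
have M0 : 0 < `|g t| + 1 by rewrite ltr_wpDl.
exists (Num.min d (e / (`|g t| + 1))); first by rewrite /= lt_min d0 divr_gt0.
move=> x; rewrite /ball/= distrC lt_min => /andP[xd xe] Dx.
have [->|xt] := eqVneq x t; first by rewrite subrr normr0.
have xt0 : x - t != 0 by rewrite subr_eq0.
have nxt : 0 < `|x - t| by rewrite normr_gt0.
have /ltW q1 := hd x Dx xt xd.
have qb : `|(x - t)^-1 * (f x - f t)| <= `|g t| + 1.
  set q := _ * _ in q1 *; have -> : q = g t - (g t - q) by ring.
  by apply: (le_trans (ler_normB _ _)); rewrite lerD2l.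
rewrite distrC; have -> : f x - f t = (x - t) * ((x - t)^-1 * (f x - f t)).
  by rewrite mulrA divff// mul1r.
rewrite normrM; apply: (@le_lt_trans _ _ (`|x - t| * (`|g t| + 1))).
  by rewrite ler_wpM2l.
by rewrite -ltr_pdivlMr.
Qed.

Lemma is_derivative_on_interior T f g t : is_derivative_on `[0, T] f g ->
  0 < t < T -> is_derive t 1 f (g t).
Proof.
move=> dfg /andP[t0 tT].
have Dt : `[0, T]%classic t by rewrite /= in_itv/=; lra.
have dq : h^-1 *: (f (h *: 1 + t) - f t) @[h --> 0^'] --> g t.
  apply/cvgrPdist_lt => e e0.
  have [d d0 hd] := is_derivative_onP dfg Dt e0.
  exists (Num.min d (Num.min t (T - t))).
    by rewrite /= !lt_min d0 t0 subr_gt0.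
  move=> h /=; rewrite sub0r normrN !lt_min => /and3P[hd' ht hT] h0.
  have hE : h *: (1 : R) + t - t = h by rewrite /GRing.scale/=; ring.
  have := hd (h *: 1 + t); rewrite hE /GRing.scale/= mulr1; apply => //.
  - rewrite in_itv/=; move: ht hT; rewrite !ltr_norml; lra.
  - by rewrite -subr_eq0 addrK.
by apply: DeriveDef; [apply/cvg_ex; exists (g t); exact: dq|exact/cvg_lim].
Qed.

Lemma is_derive_continuous f t df : is_derive t 1 f df -> {for t, continuous f}.
Proof.
move=> dft; apply: differentiable_continuous; apply/derivable1_diffP.
exact: (@ex_derive _ _ _ _ _ _ _ dft).
Qed.

(** The fundamental theorem of calculus on a half-open interval, for an
    integrable derivative that may be unbounded at the left end. *)
Lemma improper_FTC2 T F f (F0 : R) : (forall s, 0 < s < T -> is_derive s 1 F (f s)) ->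
  (forall s, 0 < s < T -> {for s, continuous f}) ->
  L1 (f \_ `]0, T[) -> F s @[s --> 0^'+] --> F0 ->
  forall s, 0 < s < T -> F s = F0 + \int[mu]_(r in `]-oo, s]) (f \_ `]0, T[) r.
Proof.
move=> dF cf lf F0E; pose Phi x := \int[mu]_(r in `]-oo, x]) (f \_ `]0, T[) r.
have dPhi x : 0 < x < T -> is_derive x 1 Phi (f x).
  move=> xT; have x1 : x < x + 1 by rewrite ltrDl.
  have cx : {for x, continuous (f \_ `]0, T[)}.
    rewrite /prop_for /continuous_at truncE xT; have := cf x xT; apply: cvg_trans.
    have xT' : x \in `]0, T[ by rewrite in_itv.
    apply: near_eq_cvg; apply: filterS (near_in_itvoo xT') => y.
    by rewrite in_itv/= truncE => ->.
  have [] := @continuous_FTC1 R _ -oo%O x (x + 1) x1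
    (L1_on (measurable_itv _) lf) (ltNyr _) cx.
  by move=> dP; rewrite truncE xT => <-; rewrite derive1E; exact: derivableP.
have cst_diff x y : 0 < x < T -> 0 < y < T -> x < y -> F x - Phi x = F y - Phi y.
  move=> xT yT xy.
  have dd z : 0 < z < T -> is_derive z 1 (fun z => F z - Phi z) (f z - f z).
    by move=> zT; have := dF z zT; have := dPhi z zT => ? ?; exact: is_deriveB.
  have [||c _] := @MVT R (fun z => F z - Phi z) (fun z => f z - f z) x y xy.
  - by move=> z; rewrite in_itv/= => zxy; apply: dd; lra.
  - apply: continuous_in_subspaceT => z /set_mem; rewrite /= in_itv/= => zxy.
    by apply: is_derive_continuous; apply: dd; lra.
  by rewrite subrr mul0r => /eqP; rewrite subr_eq0 => /eqP.
have Phi0 : Phi (eps n) @[n --> \oo] --> 0.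
  have -> : (0 : R) = \int[mu]_x (cst 0 : R -> R) x.
    by rewrite Rintegral_cst// mul0r.
  have -> : (fun n => Phi (eps n)) =
     (fun n => \int[mu]_x ((f \_ `]0, T[) \_ `]-oo, eps n]) x).
    by apply/funext => n; rewrite /Phi Rintegral_mkcond.
  apply: (L1_dominated_cvg _ _ _ (L1_abs lf)) => //.
  - move=> n; apply: (measurable_restrictT _ (measurable_itv `]-oo, eps n])).1.
    by apply: measurable_funTS; exact: L1_measurable.
  - move=> x; apply: cvg_near_cst.
    have [x0|x0] := leP x 0.
      apply: nearW => n; rewrite patchE; case: ifP => // _.
      by rewrite truncE ltNge x0.
    have /cvgrPdist_lt/(_ _ x0) := @cvg_eps R; apply: filterS => n.
    rewrite sub0r normrN (gtr0_norm (eps_gt0 n)) => ex.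
    rewrite patchE ifF//; apply: memNset; rewrite /= in_itv/=.
    by apply/negP; rewrite -ltNge.
  - by move=> n x; rewrite patchE; case: ifP => // _; rewrite normr0.
move=> s sT.
have Feps : F (eps n) @[n --> \oo] --> F0.
  move=> A /F0E[d /= d0 hd].
  have /cvgrPdist_lt/(_ _ d0) := @cvg_eps R.
  by apply: filterS => n en; apply: hd => //; exact: eps_gt0.
have c1 : F (eps n) - Phi (eps n) @[n --> \oo] --> F0 - 0 by exact: cvgB.
have c2 : F (eps n) - Phi (eps n) @[n --> \oo] --> F s - Phi s.
  apply: cvg_near_cst; have /andP[s0 s1] := sT.
  have /cvgrPdist_lt/(_ _ s0) := @cvg_eps R; apply: filterS => n.
  rewrite sub0r normrN (gtr0_norm (eps_gt0 n)) => es.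
  have e0 := eps_gt0 n.
  by apply: cst_diff => //; rewrite e0 (lt_trans es s1).
have : F0 - 0 = F s - Phi s by exact: (cvg_unique _ c1 c2).
by rewrite subr0 => ->; rewrite subrK.
Qed.

End relative_derivative.

(** * The inverse square root against logarithms *)

Section sqrt_weight.
Context {R : realType}.
Implicit Types (s T : R).

(** The exponent is that of [powT T (1/2)]. *)
Definition isqrt s : R := s `^ (1/2 - 1).

Lemma isqrt_gt0 s : 0 < s -> 0 < isqrt s.
Proof. exact: powR_gt0. Qed.

Lemma mul_isqrt s : 0 < s -> s * isqrt s = s `^ (1/2).
Proof. by move=> s0; rewrite /isqrt mulr_powRB1// ltW. Qed.

Lemma mul_isqrt2 s : 0 < s -> s * isqrt s * isqrt s = 1.
Proof.
move=> s0; rewrite mul_isqrt// /isqrt -powRD ?(lt0r_neq0 s0) ?implybT//.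
by rewrite (_ : 1/2 + (1/2 - 1) = 0) ?powRr0//; lra.
Qed.

Lemma mul_isqrt_le s T : 0 < s < T -> s * isqrt s <= 1 + T.
Proof.
move=> /andP[s0 sT]; have i0 := isqrt_gt0 s0; have i2 := mul_isqrt2 s0.
set m := s * isqrt s in i2 *.
have m0 : 0 < m by exact: mulr_gt0.
have mm : m * m = s.
  have e : m * (s * isqrt s) = s * (m * isqrt s) by ring.
  by rewrite i2 mulr1 in e.
nra.
Qed.

Lemma isqrt_ge s T : 0 < s < T -> 1 <= (1 + T) * isqrt s.
Proof.
move=> sT; have /andP[s0 _] := sT; rewrite -[leLHS](mul_isqrt2 s0).
by rewrite ler_wpM2r ?powR_ge0// mul_isqrt_le.
Qed.

(** The exponent [1/2] makes the bound integrable and its convolution with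
    itself bounded. *)
Lemma norm_ln_le s T : 0 < s < T -> `|ln s| <= 2 * (1 + T) * isqrt s.
Proof.
move=> sT; have /andP[s0 sT'] := sT.
(* [ln s] is at most [2 s^(1/2)] and [- ln s] is at most [2 s^(-1/2)]. *)
have h0 : (0 : R) < 1/2 by lra.
have i0 := isqrt_gt0 s0.
have := ln_le_powR s0 h0; have := opp_ln_le_powR s0 h0.
have -> : s `^ (- (1/2)) = isqrt s by rewrite /isqrt; congr (_ `^ _); lra.
rewrite -(mul_isqrt s0) (_ : (1/2)^-1 = 2); last by field.
move=> l1 l2; rewrite ler_norml; apply/andP; split; nra.
Qed.

End sqrt_weight.

(** * The regular factor of the kernel *)

Section kernel_factor.
Context {R : realType}.
Local Notation mu := (@lebesgue_measure R).
Context (T L : R) (alpha alpha' alpha'' : R -> R).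
Context (T0 : 0 < T) (L0 : 0 < L).
Context (alpha01 : forall t, t \in `[0, T] -> 0 < alpha t < 1).
Context (dalpha : is_derivative_on `[0, T] alpha alpha').
Context (dalpha' : is_derivative_on `[0, T] alpha' alpha'').
Context (alpha'_le : forall t, t \in `[0, T] -> `|alpha' t| <= L).

Let a0 := alpha 0.

Let oc s : 0 < s < T -> s \in `[0, T].
Proof. by move=> sT; rewrite in_itv/=; lra. Qed.

Lemma alpha_lipschitz s : 0 < s < T -> `|a0 - alpha s| <= L * s.
Proof.
move=> sT; have /andP[s0 sT'] := sT.
have [||c cs] := @MVT R alpha alpha' 0 s s0.
- move=> z; rewrite in_itv/= => zs; apply: (is_derivative_on_interior dalpha); lra.
- apply: continuous_subspaceW (is_derivative_on_continuous dalpha).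
  by move=> z /=; rewrite !in_itv/=; lra.
move: cs; rewrite in_itv/= subr0 => cs E.
rewrite distrC /a0 E normrM (gtr0_norm s0).
apply: ler_wpM2r; first exact: ltW.
by apply: alpha'_le; rewrite in_itv/=; lra.
Qed.

(** By compactness the argument of Gamma in the kernel stays away from 0, so
    that the bounds on the derivative of Gamma are uniform. *)
Lemma alpha_margin : exists2 u, 0 < u < 1 & forall t, t \in `[0, T] -> u < 1 - alpha t < 1.
Proof.
have [c cT cmax] := EVT_max (ltW T0) (is_derivative_on_continuous dalpha).
have c01 := alpha01 cT.
exists ((1 - alpha c) / 2); first lra.
by move=> t tT; have := cmax t tT; have := alpha01 tT; lra.
Qed.

Definition expo s : R := (a0 - alpha s) * ln s.
Definition expo' s : R := - alpha' s * ln s + (a0 - alpha s) * s^-1.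
Definition inv_gamma s : R := (Gamma (1 - alpha s))^-1.
Definition inv_gamma' s : R :=
  (Gamma (1 - alpha s)) ^- 2 * (Dgamma (1 - alpha s) * alpha' s).

(** The factor [h] in [k(t) = t^(-alpha(0)) h(t)].  At [s = 0] the exponent
    [expo] is 0, which is also its limit. *)
Definition regular_factor s : R := expR (expo s) * inv_gamma s.
Definition regular_factor' s : R :=
  expR (expo s) * inv_gamma' s + inv_gamma s * (expR (expo s) * expo' s).

Lemma kernel_factor s : 0 < s < T ->
  Defs.kernel alpha s = s `^ (- a0) * regular_factor s.
Proof.
move=> /andP[s0 _]; rewrite /Defs.kernel /regular_factor /inv_gamma mulrA; congr (_ * _).
rewrite /powR (negbTE (lt0r_neq0 s0)) -expRD; congr expR; rewrite /expo; ring.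
Qed.

Let gam01 s : s \in `[0, T] -> 0 < 1 - alpha s < 1.
Proof. by move=> /alpha01; lra. Qed.

Let gam_gt0 s : s \in `[0, T] -> 0 < Gamma (1 - alpha s).
Proof. by move=> /gam01/Gamma_ge; apply: lt_le_trans; exact: expR_gt0. Qed.

Lemma is_derive_alpha s : 0 < s < T -> is_derive s 1 alpha (alpha' s).
Proof. exact: is_derivative_on_interior. Qed.

Lemma is_derive_onem_alpha s : 0 < s < T ->
  is_derive s 1 (fun s => 1 - alpha s) (- alpha' s).
Proof.
move=> sT; have da := is_derive_alpha sT.
by have := is_deriveB (is_derive_cst (1 : R) s 1) da; rewrite sub0r.
Qed.

Lemma is_derive_expo s : 0 < s < T -> is_derive s 1 expo (expo' s).
Proof.
move=> sT; have /andP[s0 _] := sT; have da := is_derive_alpha sT.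
have d1 := is_deriveB (is_derive_cst a0 s 1) da.
have := is_deriveM d1 (is_derive1_ln s0); congr (is_derive _ _ _ _).
rewrite /expo' /GRing.scale/= sub0r -[(cst a0 - alpha) s]/(a0 - alpha s); ring.
Qed.

Lemma is_derive_inv_gamma s : 0 < s < T -> is_derive s 1 inv_gamma (inv_gamma' s).
Proof.
move=> sT; have g0 := gam_gt0 (oc sT).
have dG := @is_derive1_comp _ (@Gamma R) (fun s => 1 - alpha s) s _ _
  (is_derive_Gamma (gam01 (oc sT))) (is_derive_onem_alpha sT).
have := @is_deriveV _ (@Gamma R \o (fun s => 1 - alpha s)) s _ 1 (lt0r_neq0 g0) dG.
by congr (is_derive _ _ _ _); rewrite /inv_gamma' /GRing.scale/=; ring.
Qed.

Lemma is_derive_expR_expo s : 0 < s < T ->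
  is_derive s 1 (fun s => expR (expo s)) (expR (expo s) * expo' s).
Proof.
by move=> sT; have := @is_derive1_comp _ expR expo s _ _ (is_derive_expR _)
  (is_derive_expo sT).
Qed.

Lemma is_derive_regular_factor s : 0 < s < T ->
  is_derive s 1 regular_factor (regular_factor' s).
Proof.
by move=> sT; have := is_deriveM (is_derive_expR_expo sT) (is_derive_inv_gamma sT).
Qed.

Lemma continuous_regular_factor' s : 0 < s < T ->
  {for s, continuous regular_factor'}.
Proof.
move=> sT; have /andP[s0 _] := sT; have g0 := gam_gt0 (oc sT).
have cE := is_derive_continuous (is_derive_expR_expo sT).
have cI := is_derive_continuous (is_derive_inv_gamma sT).
have ca := is_derive_continuous (is_derive_alpha sT).
have ca' := is_derive_continuous (is_derivative_on_interior dalpha' sT).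
have c1a := is_derive_continuous (is_derive_onem_alpha sT).
have cln := is_derive_continuous (is_derive1_ln s0).
have cG : {for s, continuous (fun s => Gamma (1 - alpha s))}.
  apply: continuous_comp => //.
  exact: is_derive_continuous (is_derive_Gamma (gam01 (oc sT))).
have cD : {for s, continuous (fun s => Dgamma (1 - alpha s))}.
  apply: continuous_comp => //; exact: continuous_Dgamma (gam01 (oc sT)).
apply: continuousD.
  apply: continuousM => //; apply: continuousM; last exact: continuousM.
  apply: continuousV; first by rewrite expf_neq0// lt0r_neq0.
  exact: (continuousM cG cG).
apply: continuousM => //; apply: continuousM => //.
apply: continuousD.
  by apply: continuousM => //; exact: continuousN.
apply: continuousM; last by apply: continuousV; [exact: lt0r_neq0|exact: cvg_id].
by apply: continuousB => //; exact: cst_continuous.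
Qed.

Lemma expo_le s : 0 < s < T -> `|expo s| <= 2 * L * (1 + T) * (s * isqrt s).
Proof.
move=> sT; have /andP[s0 _] := sT; rewrite /expo normrM.
have -> : 2 * L * (1 + T) * (s * isqrt s) = (L * s) * (2 * (1 + T) * isqrt s) by ring.
by apply: ler_pM => //; [exact: alpha_lipschitz|exact: norm_ln_le].
Qed.

Definition expo_bound : R := expR (2 * L * (1 + T) * (1 + T)).

Lemma expR_expo_le s : 0 < s < T -> expR (expo s) <= expo_bound.
Proof.
move=> sT; rewrite ler_expR; apply: le_trans (ler_norm _) _.
apply: le_trans (expo_le sT) _; rewrite ler_wpM2l ?mul_isqrt_le//.
by rewrite !mulr_ge0 ?addr_ge0// ltW.
Qed.

Lemma inv_gamma_gt0 s : 0 < s < T -> 0 < inv_gamma s.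
Proof. by move=> /oc/gam_gt0; rewrite invr_gt0. Qed.

Lemma inv_gamma_le s : 0 < s < T -> inv_gamma s <= expR 1.
Proof.
move=> sT; rewrite /inv_gamma -[leRHS]invrK -expRN lef_pV2 ?posrE ?expR_gt0 ?gam_gt0 ?oc//.
exact: Gamma_ge (gam01 (oc sT)).
Qed.

Lemma regular_factor_bounded s : 0 < s < T ->
  `|regular_factor s| <= expo_bound * expR 1.
Proof.
move=> sT; rewrite normrM !ger0_norm ?expR_ge0 ?(ltW (inv_gamma_gt0 sT))//.
by apply: ler_pM; rewrite ?expR_ge0 ?(ltW (inv_gamma_gt0 sT)) ?expR_expo_le ?inv_gamma_le.
Qed.

(** The quotient [(alpha(0) - alpha(s)) / s] is bounded by [L] as well as
    [alpha'], so the derivative has no singularity beyond that of the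
    logarithm. *)
Lemma regular_factor'_le : exists2 C, 0 < C &
  forall s, 0 < s < T -> `|regular_factor' s| <= C * isqrt s.
Proof.
have [u u01 uE] := alpha_margin; have [M M0 DM] := Dgamma_bounded u01.
(* [C1] bounds the term with the derivative of [1 / Gamma] and [C2] that with
   the derivative of the exponent. *)
pose C1 := expo_bound * (expR 1 * expR 1 * (M * L)) * (1 + T).
pose C2 := expR 1 * (expo_bound * (3 * L * (1 + T))).
have e1 : 0 < expR 1 :> R by exact: expR_gt0.
have eb : 0 < expo_bound by exact: expR_gt0.
have T1 : 0 < 1 + T by exact: addr_gt0.
have C10 : 0 <= C1 by rewrite !mulr_ge0// ltW.
have C20 : 0 < C2 by rewrite !mulr_gt0.
exists (C1 + C2); first lra.
move=> s sT; have /andP[s0 _] := sT.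
have i0 := isqrt_gt0 s0; have i1 := isqrt_ge sT.
have ex := expR_expo_le sT; have ig := inv_gamma_le sT; have ig0 := inv_gamma_gt0 sT.
have ex0 := expR_ge0 (expo s).
have ap := alpha'_le (oc sT).
apply: le_trans (ler_normD _ _) _; rewrite mulrDl; apply: lerD.
  rewrite normrM (ger0_norm ex0).
  apply: (@le_trans _ _ (expo_bound * (expR 1 * expR 1 * (M * L)))); last first.
    by rewrite /C1 -[leRHS]mulrA ler_peMr// !mulr_ge0// ltW.
  apply: ler_pM => //; rewrite normrM; apply: ler_pM => //.
    have -> : `|Gamma (1 - alpha s) ^- 2| = inv_gamma s * inv_gamma s.
      rewrite -exprVn -/(inv_gamma s) expr2 ger0_norm// mulr_ge0// ltW//.
    by apply: ler_pM => //; exact: ltW.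
  by rewrite normrM; apply: ler_pM => //; apply: DM; exact: uE (oc sT).
rewrite /C2 -!mulrA normrM (gtr0_norm ig0); apply: ler_pM => //; first exact: ltW.
rewrite normrM (ger0_norm ex0); apply: ler_pM => //.
rewrite /expo'; apply: le_trans (ler_normD _ _) _.
have -> : 3 * (L * ((1 + T) * isqrt s)) =
    L * (2 * (1 + T) * isqrt s) + L * ((1 + T) * isqrt s) by ring.
apply: lerD.
  rewrite normrM normrN; apply: ler_pM => //; exact: norm_ln_le.
apply: (@le_trans _ _ L); last by rewrite ler_peMr// ltW.
rewrite normrM normfV (gtr0_norm s0) ler_pdivrMr//; exact: alpha_lipschitz.
Qed.

Lemma cvg_regular_factor : regular_factor s @[s --> 0^'+] --> regular_factor 0.
Proof.
have nearT : \forall s \near 0^'+, 0 < s < T.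
  near=> s; apply/andP; split; first by near: s; exact: nbhs_right_gt.
  by near: s; exact: nbhs_right_lt.
have ex0 : expo 0 = 0 by rewrite /expo subrr mul0r.
have cexpo : expo s @[s --> 0^'+] --> expo 0.
  rewrite ex0; apply/norm_cvg0P.
  have c0 : 2 * L * (1 + T) * s `^ (1/2) @[s --> 0^'+] --> 0.
    rewrite -[X in _ --> X](mulr0 (2 * L * (1 + T))); apply: cvgM; first exact: cvg_cst.
    by apply: powR_cvg0; lra.
  apply: (squeeze_cvgr _ (@cvg_cst _ 0 _ _ _) c0).
  apply: filterS nearT => s sT; rewrite normr_ge0/=.
  by have /andP[s0 _] := sT; rewrite -mul_isqrt// expo_le.
have calpha : alpha s @[s --> 0^'+] --> a0.
  apply/cvgrPdist_le => e e0; near=> s.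
  have sT : 0 < s < T by near: s.
  apply: le_trans (alpha_lipschitz sT) _; rewrite mulrC -ler_pdivlMr//.
  by near: s; apply: nbhs_right_le; rewrite divr_gt0.
have cGamma : {for 1 - alpha 0, continuous (@Gamma R)}.
  apply: is_derive_continuous; apply: is_derive_Gamma; apply: gam01.
  by rewrite in_itv/= lexx ltW.
apply: cvgM.
  by apply: continuous_cvg => //; exact: continuous_expR.
apply: cvgV.
  by rewrite lt0r_neq0// gam_gt0// in_itv/= lexx ltW.
apply: continuous_cvg => //.
by apply: cvgB => //; exact: cvg_cst.
Unshelve. all: by end_near. Qed.

Lemma regular_factor0_gt0 : 0 < regular_factor 0.
Proof. by rewrite mulr_gt0 ?expR_gt0// invr_gt0 gam_gt0// in_itv/= lexx ltW. Qed.

Lemma L1_regular_factor' : L1 (regular_factor' \_ `]0, T[).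
Proof.
have [C C0 HC] := regular_factor'_le.
have half : (0 : R) < 1/2 by lra.
apply: (L1_le _ _ (L1Z C (L1_powT T0 half))).
  apply: (measurable_restrictT _ (measurable_itv `]0, T[)).1.
  apply: open_continuous_measurable_fun => //.
  move=> s /set_mem; rewrite /= in_itv/= => sT; exact: continuous_regular_factor'.
move=> s; rewrite truncE; case: ifPn => sT; last by rewrite normr0.
rewrite powTE//; apply: le_trans (HC s sT) _; exact: ler_norm.
Qed.

Lemma regular_factorE s : 0 < s < T -> regular_factor s =
  regular_factor 0 + \int[mu]_(r in `]-oo, s]) (regular_factor' \_ `]0, T[) r.
Proof.
apply: improper_FTC2.
- exact: is_derive_regular_factor.
- exact: continuous_regular_factor'.
- exact: L1_regular_factor'.
- exact: cvg_regular_factor.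
Qed.

Lemma measurable_regular_factor : measurable_fun setT (regular_factor \_ `]0, T[).
Proof.
apply: (measurable_restrictT _ (measurable_itv `]0, T[)).1.
apply: open_continuous_measurable_fun => //.
move=> s /set_mem; rewrite /= in_itv/= => sT.
exact: is_derive_continuous (is_derive_regular_factor sT).
Qed.

End kernel_factor.

(** * Convolution of the kernel with the conjugate power *)

Section kernel_convolution.
Context {R : realType}.
Local Notation mu := (@lebesgue_measure R).
Implicit Types (f g u w : R -> R) (t x y z s : R).

Lemma L1_tensor f g : L1 f -> L1 g ->
  (mu \x mu)%E.-integrable setT (EFin \o (fun p : R * R => f p.1 * g p.2)).
Proof.
move=> lf lg; have [mf mg] := (L1_measurable lf, L1_measurable lg).
apply/integrable12ltyP.
  apply/measurable_EFinP; apply: measurable_funM.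
    exact: (measurableT_comp mf).
  exact: (measurableT_comp mg).
have E x : (\int[mu]_y `|(f x * g y)%:E| = (norm1 g)%:E * `|f x|%:E)%E.
  rewrite norm1E// muleC -ge0_integralZl//; last first.
    by apply/measurable_EFinP; exact: measurableT_comp.
  by apply: eq_integral => y _; rewrite /= normrM EFinM.
rewrite /=; under eq_integral do rewrite E.
rewrite ge0_integralZl//.
- by rewrite -norm1E// -EFinM ltry.
- by apply/measurable_EFinP; exact: measurableT_comp.
- by rewrite lee_fin norm1_ge0.
Qed.

Context (T a C M h0 : R) (h h' : R -> R).
Context (T0 : 0 < T) (a01 : 0 < a < 1) (C0 : 0 <= C).
Context (mh : measurable_fun setT (h \_ `]0, T[)).
Context (hM : forall s, 0 < s < T -> `|h s| <= M).
Context (lh' : L1 (h' \_ `]0, T[)).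
Context (h'C : forall s, 0 < s < T -> `|h' s| <= C * isqrt s).
Context (hE : forall s, 0 < s < T ->
  h s = h0 + \int[mu]_(r in `]-oo, s]) (h' \_ `]0, T[) r).

Let w := beta_weight a (1 - a).
Let H' := h' \_ `]0, T[.
Let B := Beta a (1 - a).

Let lw : L1 w.
Proof. by have := a01; case/andP=> ? ?; apply: L1_beta_weight; lra. Qed.

Let K (p : R * R) : R := one T p.1 * (w p.2 * (p.2 * H' (p.2 * p.1))).

Let mK : measurable_fun setT K.
Proof.
apply: measurable_funM.
  exact: (measurableT_comp (L1_measurable (L1_one T))).
apply: measurable_funM; first exact: (measurableT_comp (L1_measurable lw)).
apply: measurable_funM => //.
apply: (measurableT_comp (L1_measurable lh')); exact: measurable_funM.
Qed.

Let psq := powT T (1/2).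

Let lpsq : L1 psq.
Proof. by apply: L1_powT => //; lra. Qed.

Let K_le p : `|K p| <= C * psq p.1 * w p.2.
Proof.
case: p => y z; rewrite /K /= /one /psq /powT /w /beta_weight !truncE.
have [yT|] := boolP (0 < y < T); last by rewrite mul0r normr0 mulr0 mul0r.
rewrite [cst 1 y * _]mul1r; have /andP[y0 yT'] := yT.
case: ifPn => [zT|_]; last by rewrite mul0r normr0 mulr0.
have /andP[z0 z1] := zT.
rewrite normrM mulrC [X in _ * X]ger0_norm ?mulr_ge0 ?powR_ge0//.
apply: ler_wpM2r; first by rewrite mulr_ge0 ?powR_ge0.
rewrite /H' truncE; case: ifPn => zy; last by rewrite mulr0 normr0 mulr_ge0 ?powR_ge0.
have zy0 : 0 < z * y by exact: mulr_gt0.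
rewrite normrM (gtr0_norm z0).
apply: (@le_trans _ _ (z * (C * isqrt (z * y)))).
  by rewrite ler_wpM2l ?h'C// ltW.
have -> : z * (C * isqrt (z * y)) = C * (z * isqrt z * isqrt y).
  by rewrite {1}/isqrt powRM ?ltW// -/(isqrt z) -/(isqrt y); ring.
rewrite ler_wpM2l// ler_piMl ?powR_ge0// mul_isqrt//.
rewrite -[leRHS](powRr0 z); apply: powR_lt1_le => //; lra.
Qed.

Let iK : (mu \x mu)%E.-integrable setT (EFin \o K).
Proof.
apply: (@le_integrable _ _ _ (mu \x mu)%E setT _ _
  (EFin \o (fun p : R * R => (C * psq p.1) * w p.2))) => //.
- exact/measurable_EFinP.
- by move=> p _; rewrite lee_fin (le_trans (K_le p))// ler_norm.
- by apply: (@L1_tensor (fun x => C * psq x)) => //; exact: L1Z.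
Qed.

(** The derivative of [t |-> \int w(z) h(t z) dz], that is
    [\int w(z) z h'(t z) dz] with the Beta weight [w]. *)
Definition conv_derivative y : R := \int[mu]_z K (y, z).

Lemma L1_conv_derivative : L1 conv_derivative.
Proof. exact: (L1_section1 iK). Qed.

Lemma causal_conv_derivative : causal conv_derivative.
Proof.
move=> y y0; rewrite /conv_derivative (@eq_Rintegral _ _ _ mu _ (cst 0)).
  by rewrite Rintegral_cst// mul0r.
by move=> z _; rewrite /K/= /one truncE ltNge y0 mul0r.
Qed.

Let L1_K y : L1 (fun z => K (y, z)).
Proof.
apply: (L1_le _ _ (L1Z (C * psq y) lw)).
  exact: (measurableT_comp mK).
by move=> z; rewrite (le_trans (K_le (y, z)))//= ler_norm.
Qed.

Lemma conv_derivative_le y : `|conv_derivative y| <= C * B * psq y.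
Proof.
apply: (le_trans (le_normr_Rintegral measurableT (L1_K y))).
rewrite mulrAC /B /Beta -RintegralZl//; apply: le_Rintegral => //.
- exact: L1_abs (L1_K y).
- exact: L1Z.
Qed.

Let inner t z : 0 < t < T -> \int[mu]_y (one T (t - y) * K (y, z)) =
  w z * \int[mu]_(r in `]-oo, t * z]) H' r.
Proof.
move=> tT; have /andP[t0 tT'] := tT.
have [z01|nz] := boolP (0 < z < 1); last first.
  rewrite (_ : w z = 0) ?mul0r; last by rewrite /w /beta_weight truncE (negbTE nz).
  rewrite (@eq_Rintegral _ _ _ mu _ (cst 0)); first by rewrite Rintegral_cst// mul0r.
  by move=> y _; rewrite /K/= /w /beta_weight truncE (negbTE nz) mul0r !mulr0.
have /andP[z0 z1] := z01; have zn0 := lt0r_neq0 z0.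
pose F := H' \_ `]-oo, t * z].
have lF : L1 F by apply/(L1_restrict H' (measurable_itv `]-oo, t * z])); exact: L1_on.
rewrite [X in _ = _ * X]Rintegral_mkcond (integral_affine 0 zn0 lF) gtr0_norm//.
have lFz := integrable_affine 0 zn0 lF.
rewrite mulrA -RintegralZl//.
apply: ae_eq_Rintegral.
- apply: measurable_funM; last exact: (measurableT_comp mK).
  apply: (measurableT_comp (L1_measurable (L1_one T))); exact: measurable_funB.
- exact: L1_measurable (L1Z (w z * z) lFz).
exists [set t]; split => //; first exact: lebesgue_measure_set1.
move=> y /= hy; apply: contrapT => yt; apply: hy.
have FE : F (z * y) = if y <= t then H' (z * y) else 0.
  rewrite /F patchE; have [yt'|yt'] := leP y t.
    by rewrite ifT//; apply: mem_set; rewrite /= in_itv/= mulrC ler_pM2r.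
  rewrite ifF//; apply: memNset; rewrite /= in_itv/= mulrC ler_pM2r//.
  by apply/negP; rewrite -ltNge.
rewrite addr0 FE /K/= /one !truncE.
have [y0|y0] := leP y 0.
  have -> : H' (z * y) = 0 by rewrite /H' truncE pmulr_rgt0// ltNge y0.
  by case: ifP => _; case: ifP => _; rewrite !mulr0.
have [ty|ty] := leP y t; last first.
  have -> : (0 < t - y) = false by rewrite subr_gt0 ltNge (ltW ty).
  by rewrite mul0r mulr0.
have {}ty : y < t by rewrite lt_neqAle ty andbT; apply/eqP.
rewrite ifT; last lra.
rewrite ifT; last lra.
by rewrite ![cst 1 _]/(1 : R) !mul1r mulrA.
Qed.

Let trunc_factorE t z : 0 < t < T ->
  w z * (h \_ `]0, T[) (t * z) =
  h0 * w z + w z * \int[mu]_(r in `]-oo, t * z]) H' r.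
Proof.
move=> tT; have /andP[t0 tT'] := tT.
have [z01|nz] := boolP (0 < z < 1); last first.
  by rewrite (_ : w z = 0) ?mul0r ?mulr0 ?addr0// /w /beta_weight truncE (negbTE nz).
have tz : 0 < t * z < T.
  have /andP[z0 z1] := z01; rewrite mulr_gt0//= (lt_trans _ tT')//.
  by rewrite gtr_pMr.
by rewrite truncE tz hE// mulrDr (mulrC h0).
Qed.

(** The scaling [s = t z] makes the left-hand side the mean of [h(t z)] in the
    weight [z |-> (1-z)^(a-1) z^(-a)].  Write [h] as the primitive of [h'] and
    exchange the integrals. *)
Lemma convol_powT_factor t : 0 < t < T ->
  convol (powT T a) ((fun s => s `^ (- a) * h s) \_ `]0, T[) t =
  h0 * B + convol (one T) conv_derivative t.
Proof.
move=> tT; have /andP[t0 tT'] := tT; have tn0 := lt0r_neq0 t0.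
have M0 : 0 <= M by apply: le_trans (hM tT).
have hb s : `|(h \_ `]0, T[) s| <= M.
  by rewrite truncE; case: ifPn => [|_]; [exact: hM|rewrite normr0].
have kE s : ((fun s => s `^ (- a) * h s) \_ `]0, T[) s =
    powT T (1 - a) s * (h \_ `]0, T[) s.
  rewrite /powT !truncE; case: ifP => _; last by rewrite mulr0.
  by congr (_ `^ _ * _); ring.
have /andP[a0 a1'] := a01.
have a1 : 0 < 1 - a by rewrite subr_gt0.
have lprod : L1 (fun s => (powT T a (t - s) * powT T (1 - a) s) * (h \_ `]0, T[) s).
  by apply: L1_mul_bounded hb _ => //; exact: L1_powT_section.
have -> : convol (powT T a) ((fun s => s `^ (- a) * h s) \_ `]0, T[) t =
    \int[mu]_z (w z * (h \_ `]0, T[) (t * z)).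
  rewrite /convol; under eq_Rintegral do rewrite kE mulrA.
  rewrite (integral_affine 0 tn0 lprod) (gtr0_norm t0) -RintegralZl//; last first.
    exact: (integrable_affine 0 tn0 lprod).
  apply: eq_Rintegral => z _; rewrite addr0 powT_scale// -/w.
  rewrite (_ : a + (1 - a) - 2 = -1); last by ring.
  by rewrite powR_inv1 ?ltW// !mulrA divff// mul1r.
have lwh : L1 (fun z => w z * (h \_ `]0, T[) (t * z)).
  apply: (@L1_mul_bounded _ M w (fun z => (h \_ `]0, T[) (t * z))).
  - exact: (measurableT_comp mh (mulrl_measurable t)).
  - by move=> z; exact: hb.
  - exact: lw.
have -> : \int[mu]_z (w z * (h \_ `]0, T[) (t * z)) =
   h0 * B + \int[mu]_z (w z * \int[mu]_(r in `]-oo, t * z]) H' r).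
  have -> : \int[mu]_z (w z * \int[mu]_(r in `]-oo, t * z]) H' r) =
      \int[mu]_z (w z * (h \_ `]0, T[) (t * z) - h0 * w z).
    by apply: eq_Rintegral => z _; rewrite trunc_factorE//; ring.
  rewrite RintegralB//; last exact: L1Z.
  by rewrite RintegralZl//; rewrite /B /Beta; ring.
congr (_ + _).
have mt : measurable_fun setT (fun p : R * R => one T (t - p.1)).
  apply: (measurableT_comp (L1_measurable (L1_one T))); exact: measurable_funB.
have iKt : (mu \x mu)%E.-integrable setT
    (EFin \o (fun p : R * R => one T (t - p.1) * K p)).
  apply: (@le_integrable _ _ _ (mu \x mu)%E setT _ _ (EFin \o K)) => //.
  - by apply/measurable_EFinP; exact: measurable_funM.
  - move=> p _; rewrite lee_fin normrM ler_piMl// /one truncE.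
    by case: ifP; rewrite ?normr1 ?normr0.
transitivity (\int[mu]_z \int[mu]_y (one T (t - y) * K (y, z))).
  by apply: eq_Rintegral => z _; rewrite inner.
rewrite -(Rfubini iKt); apply: eq_Rintegral => y _.
by rewrite /= /conv_derivative RintegralZl//; exact: (L1_K y).
Qed.

End kernel_convolution.

(** * The algebra of causal integrable functions *)

Section causal_calculus.
Context {R : realType}.
Local Notation mu := (@lebesgue_measure R).
Implicit Types (f g h u v w : R -> R) (t x y z s T c : R).

(** The convolution algebra of integrable functions on the half-line. *)
Definition LC f : Prop := L1 f /\ causal f.

Lemma LC_D f g : LC f -> LC g -> LC (fun x => f x + g x).
Proof.
move=> [lf cf] [lg cg]; split; first exact: L1D.
by move=> x x0; rewrite cf// cg// addr0.
Qed.

Lemma LC_B f g : LC f -> LC g -> LC (fun x => f x - g x).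
Proof.
move=> [lf cf] [lg cg]; split; first exact: L1B.
by move=> x x0; rewrite cf// cg// subr0.
Qed.

Lemma LC_Z c f : LC f -> LC (fun x => c * f x).
Proof.
move=> [lf cf]; split; first exact: L1Z.
by move=> x x0; rewrite cf// mulr0.
Qed.

Lemma LC_abs f : LC f -> LC (fun x => `|f x|).
Proof.
move=> [lf cf]; split; first exact: L1_abs.
by move=> x x0; rewrite cf// normr0.
Qed.

Lemma LC_convol f g : LC f -> LC g -> LC (convol f g).
Proof. by move=> [lf cf] [lg cg]; split; [exact: L1_convol|exact: causal_convol]. Qed.

Lemma LC_one T : LC (one T).
Proof. by split; [exact: L1_one|exact: causal_trunc]. Qed.

Lemma LC_powT T x : 0 < T -> 0 < x -> LC (powT T x).
Proof. by move=> T0 x0; split; [exact: L1_powT|exact: causal_powT]. Qed.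

Lemma LC_trunc T f : L1 f -> LC (f \_ `]0, T[).
Proof.
move=> lf; split; last exact: causal_trunc.
by apply/(L1_restrict f (measurable_itv `]0, T[)); exact: L1_on.
Qed.

Lemma LC_0 : LC (cst 0).
Proof. by split => //; exact: integrable0. Qed.

Lemma eqT_refl T f : eq_ae T f f.
Proof. exact: eqT_fun. Qed.

Lemma eqT_convoll T f f' g : LC f -> LC f' -> LC g -> eq_ae T f f' ->
  eq_ae T (convol f g) (convol f' g).
Proof.
by move=> [lf cf] [lf' cf'] [lg cg] ff'; apply: eqT_convol => //; exact: eqT_refl.
Qed.

Lemma eqT_convolr T f g g' : LC f -> LC g -> LC g' -> eq_ae T g g' ->
  eq_ae T (convol f g) (convol f g').
Proof.
by move=> [lf cf] [lg cg] [lg' cg'] gg'; apply: eqT_convol => //; exact: eqT_refl.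
Qed.

Lemma eqT_convolA T f g h : LC f -> LC g -> LC h ->
  eq_ae T (convol (convol f g) h) (convol f (convol g h)).
Proof. by move=> [lf _] [lg _] [lh _]; apply: eqT_ae; exact: ae_convolA. Qed.

Lemma eqT_convolC T f g : LC f -> LC g -> eq_ae T (convol f g) (convol g f).
Proof. by move=> [lf _] [lg _]; apply: eqT_ae; exact: ae_convolC. Qed.

Lemma eqT_convolDr T f g h : LC f -> LC g -> LC h ->
  eq_ae T (convol f (fun s => g s + h s)) (fun t => convol f g t + convol f h t).
Proof. by move=> [lf _] [lg _] [lh _]; apply: eqT_ae; exact: ae_convolDr. Qed.

Lemma eqT_convolBr T f g h : LC f -> LC g -> LC h ->
  eq_ae T (convol f (fun s => g s - h s)) (fun t => convol f g t - convol f h t).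
Proof. by move=> [lf _] [lg _] [lh _]; apply: eqT_ae; exact: ae_convolBr. Qed.

Lemma eqT_convolZr T c f g : LC f -> LC g ->
  eq_ae T (convol f (fun s => c * g s)) (fun t => c * convol f g t).
Proof. by move=> [lf _] [lg _]; apply: eqT_ae; exact: ae_convolZr. Qed.

Lemma eqT_D T f f' g g' : eq_ae T f f' -> eq_ae T g g' ->
  eq_ae T (fun t => f t + g t) (fun t => f' t + g' t).
Proof. by apply: ae_impl2 => t ff' gg' tT; rewrite ff'// gg'. Qed.

Lemma eqT_Z T c f f' : eq_ae T f f' -> eq_ae T (fun t => c * f t) (fun t => c * f' t).
Proof. by apply: ae_impl => t ff' tT; rewrite ff'. Qed.

Lemma eqT_subr0 T f g : eq_ae T (fun t => f t - g t) (cst 0) <-> eq_ae T f g.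
Proof.
split; apply: ae_impl => t h tT; last by rewrite h// subrr.
by have /eqP := h tT; rewrite subr_eq0 => /eqP.
Qed.

(** Convolution with a nonnegative function is monotone; comparing the
    difference [h - g] with its absolute value reduces an inequality almost
    everywhere on [(0, T)] to an inequality everywhere. *)
Lemma convol_mono T f g h : LC f -> (forall x, 0 <= f x) -> LC g -> LC h ->
  {ae mu, forall t, t \in `]0, T[ -> g t <= h t} ->
  {ae mu, forall t, t \in `]0, T[ -> convol f g t <= convol f h t}.
Proof.
move=> LCf f0 LCg LCh gh; pose d t := h t - g t.
have LCd : LC d by exact: LC_B.
have dd : eq_ae T d (fun t => `|d t|).
  by apply: ae_impl gh => t gh tT; rewrite ger0_norm// subr_ge0 gh.
have := eqT_convolr LCf LCd (LC_abs LCd) dd.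
apply: ae_impl2 (eqT_convolBr T LCf LCh LCg) => t hB hd tT.
rewrite -subr_ge0 -[leRHS](hB tT) (hd tT).
by apply: Rintegral_ge0 => s _; rewrite mulr_ge0.
Qed.

End causal_calculus.

(** * Reduction of the Abel equation to a Volterra equation *)

Section abel.
Context {R : realType}.
Local Notation mu := (@lebesgue_measure R).
Implicit Types (f g h u v w : R -> R) (t x y z s : R).
Context (T a gam : R) (K G : R -> R).
Context (T0 : 0 < T) (a0 : 0 < a < 1) (gam0 : 0 < gam).
Context (LCK : LC K) (LCG : LC G).

Let b := powT T a.

Let LCb : LC b.
Proof. by apply: LC_powT => //; case/andP: a0. Qed.

Context (bK : eq_ae T (convol b K) (fun t => gam * (one T t + convol (one T) G t))).

(** Associativity lets the factorization of [b * K] act on [u]. *)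
Lemma convol_powT_kernel u : LC u ->
  eq_ae T (convol b (convol K u)) (fun t => gam * convol (one T) (fun s => u s + convol G u s) t).
Proof.
move=> LCu; have L1T := LC_one T.
have LC1G := LC_convol L1T LCG; have LCGu := LC_convol LCG LCu.
apply: eqT_trans (eqT_sym (eqT_convolA T LCb LCK LCu)) _.
have Ls := LC_D L1T LC1G; have Lgs := LC_Z gam Ls.
apply: eqT_trans (eqT_convoll (LC_convol LCb LCK) Lgs LCu bK) _.
apply: eqT_trans (eqT_convolC T Lgs LCu) _.
apply: eqT_trans (eqT_convolZr T gam LCu Ls) _.
apply: eqT_Z.
apply: eqT_trans (eqT_convolDr T LCu L1T LC1G) _.
apply: eqT_trans (eqT_sym (eqT_convolDr T L1T LCu LCGu)).
apply: eqT_D; first exact: eqT_convolC.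
apply: eqT_trans (eqT_convolC T LCu LC1G) _.
exact: eqT_convolA.
Qed.

(** The right-hand side of the equation of the second kind, for
    [f = c + 1 * g]. *)
Definition abel_rhs (c : R) g : R -> R := fun t => gam^-1 * (c * b t + convol b g t).

Lemma LC_abel_rhs c g : LC g -> LC (abel_rhs c g).
Proof. by move=> LCg; apply: LC_Z; apply: LC_D; [exact: LC_Z|exact: LC_convol]. Qed.

Lemma convol_powT_primitive c g : LC g ->
  eq_ae T (convol b (fun t => c * one T t + convol (one T) g t))
          (fun t => gam * convol (one T) (abel_rhs c g) t).
Proof.
move=> LCg; have L1T := LC_one T.
have L1g := LC_convol L1T LCg; have Lbg := LC_convol LCb LCg.
have Lcb := LC_Z c LCb.
apply: eqT_trans (eqT_convolDr T LCb (LC_Z c L1T) L1g) _.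
apply: (@eqT_trans _ _ (convol (one T) (fun t => c * b t + convol b g t))).
  apply: eqT_trans (eqT_sym (eqT_convolDr T L1T Lcb Lbg)).
  apply: eqT_D.
    apply: eqT_trans (eqT_convolZr T c LCb L1T) _.
    apply: eqT_trans (eqT_sym (eqT_convolZr T c L1T LCb)).
    by apply: eqT_Z; exact: eqT_convolC.
  apply: eqT_trans (eqT_sym (eqT_convolA T LCb L1T LCg)) _.
  apply: eqT_trans (eqT_convolA T L1T LCb LCg).
  by apply: eqT_convoll => //; [exact: LC_convol|exact: LC_convol|exact: eqT_convolC].
apply: eqT_sym; apply: ae_impl (eqT_convolZr T gam^-1 L1T (LC_D Lcb Lbg)) => t h tT.
by rewrite [in LHS]/abel_rhs h// mulrA mulfV ?mul1r// lt0r_neq0.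
Qed.

(** A further convolution with the conjugate power [t^(-a)] gives a multiple
    of the primitive, because [t^(-a) * t^(a-1)] is the constant
    [Beta (1 - a) a]. *)
Lemma convol_powT_inj d : LC d -> eq_ae T (convol b d) (cst 0) -> eq_ae T d (cst 0).
Proof.
move=> LCd bd0; have /andP[ap a1] := a0.
have a1' : 0 < 1 - a by rewrite subr_gt0.
have LCa : LC (powT T (1 - a)) by exact: LC_powT.
have L1T := LC_one T.
have B0 : Beta (1 - a) a != 0.
  have : 1 <= Beta (1 - a) a by apply: Beta_ge1; lra.
  by move=> h; rewrite lt0r_neq0// (lt_le_trans ltr01).
apply: convol_one_inj; [exact: LCd.1|exact: LCd.2|].
have ab : eq_ae T (convol (powT T (1 - a)) b) (fun t => Beta (1 - a) a * one T t).
  apply: eqT_fun => t tT; rewrite convol_powT// /one truncE tT.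
  by rewrite (_ : 1 - a + a - 1 = 0) ?powRr0//; ring.
have e1 := eqT_convoll (LC_convol LCa LCb) (LC_Z _ L1T) LCd ab.
have e2 := eqT_convolA T LCa LCb LCd.
have e3 := eqT_convolr LCa (LC_convol LCb LCd) (LC_0) bd0.
have e4 := eqT_convolC T (LC_Z (Beta (1 - a) a) L1T) LCd.
have e5 := eqT_convolZr T (Beta (1 - a) a) LCd L1T.
have e6 := eqT_convolC T LCd L1T.
have := eqT_trans (eqT_sym e1) (eqT_trans e2 e3).
have := eqT_trans e4 (eqT_trans e5 (eqT_Z (Beta (1 - a) a) e6)).
apply: ae_impl2 => t h1 h2 tT.
have : Beta (1 - a) a * convol (one T) d t = 0.
  rewrite -h1// h2//= /convol; under eq_Rintegral do rewrite mulr0.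
  by rewrite Rintegral_cst// mul0r.
by move=> /eqP; rewrite mulf_eq0 (negbTE B0) => /eqP.
Qed.

(** Convolving the equation of the first kind with [t^(a-1)] and
    differentiating gives an equivalent equation of the second kind: both
    operations are injective. *)
Lemma abel_equiv c g u : LC g -> LC u ->
  eq_ae T (convol K u) (fun t => c * one T t + convol (one T) g t) <->
  eq_ae T u (fun t => abel_rhs c g t - convol G u t).
Proof.
move=> LCg LCu; have L1T := LC_one T.
set F := fun t => c * one T t + convol (one T) g t.
have LCF : LC F by apply: LC_D; [exact: LC_Z|exact: LC_convol].
have LCr := LC_abel_rhs c LCg; have LCGu := LC_convol LCG LCu.
have LCKu := LC_convol LCK LCu; have LCs := LC_D LCu LCGu.
have gn0 := lt0r_neq0 gam0.
split => [E|E].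
  have e := eqT_convolr LCb LCKu LCF E.
  have : eq_ae T (fun t => (u t + convol G u t) - abel_rhs c g t) (cst 0).
    have Ld := LC_B LCs LCr.
    apply: convol_one_inj; [exact: Ld.1|exact: Ld.2|].
    apply: eqT_trans (eqT_convolBr T L1T LCs LCr) _.
    apply: ae_impl3 (convol_powT_kernel LCu) (convol_powT_primitive c LCg) e => t h1 h2 h3 tT.
    apply: (mulfI gn0); rewrite mulrBr mulr0.
    by rewrite -[X in X - _]h1// -h2// h3// subrr.
  by apply: ae_impl => t /[apply] /eqP; rewrite subr_eq0 => /eqP <-; rewrite addrK.
have Ld := LC_B LCKu LCF.
apply/eqT_subr0; apply: convol_powT_inj => //.
apply: eqT_trans (eqT_convolBr T LCb LCKu LCF) _.
have e : eq_ae T (fun s => u s + convol G u s) (abel_rhs c g).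
  by apply: ae_impl E => t /[apply] ->; rewrite subrK.
have := eqT_convolr L1T LCs LCr e.
apply: ae_impl3 (convol_powT_kernel LCu) (convol_powT_primitive c LCg) => t h1 h2 h3 tT.
by rewrite h1// h2// h3// subrr.
Qed.

End abel.

(** * Existence, uniqueness and bounds for the Abel equation *)

Section abel_estimates.
Context {R : realType}.
Local Notation mu := (@lebesgue_measure R).
Implicit Types (f g h u v w : R -> R) (t x y z s c N : R).

Lemma norm_convol_one_le T w t : LC w -> t < T -> `|convol (one T) w t| <= norm1 w.
Proof.
move=> [lw cw] tT; rewrite convol_oneE//.
have iw := L1_on (measurable_itv `]-oo, t]) lw.
apply: (le_trans (@le_normr_Rintegral _ _ _ mu _ _ (measurable_itv `]-oo, t]) iw)).
rewrite Rintegral_mkcond; apply: le_Rintegral => //.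
- apply/(L1_restrict (fun x => `|w x|) (measurable_itv `]-oo, t])).
  by apply: L1_on => //; exact: L1_abs.
- exact: L1_abs.
- by move=> x _; rewrite patchE; case: ifP => // _; exact: normr_ge0.
Qed.

Context (T a gam : R) (K G : R -> R).
Context (T0 : 0 < T) (a01 : 0 < a < 1) (gam0 : 0 < gam).
Context (LCK : LC K) (LCG : LC G).
Context (bK : eq_ae T (convol (powT T a) K) (fun t => gam * (one T t + convol (one T) G t))).

Let b := powT T a.

Let LCb : LC b.
Proof. by apply: LC_powT => //; case/andP: a01. Qed.

Let gi0 : 0 < gam^-1. Proof. by rewrite invr_gt0. Qed.

(** Solutions are normalized to vanish outside [(0, T)], so that their norm
    over the line is that over the interval. *)
Definition supported u : Prop := forall t, ~~ (0 < t < T) -> u t = 0.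

Lemma supported_trunc u : supported (u \_ `]0, T[).
Proof. by move=> t /negbTE nt; rewrite truncE nt. Qed.

Lemma norm1_abel_rhs c g : LC g ->
  norm1 (abel_rhs T a gam c g) <= gam^-1 * norm1 b * (`|c| + norm1 g).
Proof.
move=> LCg; rewrite /abel_rhs norm1Z; last first.
  exact: (LC_D (LC_Z c LCb) (LC_convol LCb LCg)).1.
rewrite (gtr0_norm gi0) -mulrA ler_wpM2l ?(ltW gi0)//.
apply: le_trans (norm1D (LC_Z c LCb).1 (LC_convol LCb LCg).1) _.
rewrite norm1Z; last exact: LCb.1.
rewrite mulrDr mulrC lerD2l; exact: le_norm1_convol LCb.1 LCg.1.
Qed.

(** The difference of two solutions solves the Volterra equation with
    right-hand side 0. *)
Lemma abel_unique c g u v : LC g -> LC u -> LC v -> supported u -> supported v ->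
  eq_ae T (convol K u) (fun t => c * one T t + convol (one T) g t) ->
  eq_ae T (convol K v) (fun t => c * one T t + convol (one T) g t) -> eq_ae T u v.
Proof.
move=> LCg LCu LCv su sv.
move=> /(abel_equiv T0 a01 gam0 LCK LCG bK c LCg LCu) Eu.
move=> /(abel_equiv T0 a01 gam0 LCK LCG bK c LCg LCv) Ev.
have Lw := LC_B LCu LCv.
have [Q Q0 HQ] := volterra_bound T0 LCG.1 LCG.2.
apply/eqT_subr0.
have n0 : norm1 (cst 0 : R -> R) = 0.
  by rewrite /norm1 (@eq_Rintegral _ _ _ mu _ (cst 0)) ?Rintegral_cst ?mul0r// => x _; rewrite normr0.
have : norm1 (fun t => u t - v t) <= Q * norm1 (cst 0 : R -> R).
  apply: HQ; [exact: LC_0.1|exact: Lw.1|by []| |].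
    by move=> t nt; rewrite su// sv// subrr.
  apply: ae_impl3 Eu Ev (eqT_convolBr T LCG LCu LCv) => t eu ev e tT.
  by rewrite e// eu// ev//=; ring.
rewrite n0 mulr0 => h.
have h0 : norm1 (fun t => u t - v t) = 0 by apply/eqP; rewrite eq_le h norm1_ge0.
by apply: ae_impl (norm1_eq0 Lw.1 h0) => t ->.
Qed.

Lemma abel_L1 : exists2 Q, 0 < Q & forall c g, LC g -> exists u,
  [/\ LC u, supported u,
      eq_ae T (convol K u) (fun t => c * one T t + convol (one T) g t) &
      norm1 u <= Q * (`|c| + norm1 g)].
Proof.
have [Q Q0 HQ] := volterra_bound T0 LCG.1 LCG.2.
have nb0 := norm1_ge0 b.
exists (Q * (gam^-1 * norm1 b) + 1).
  by rewrite ltr_wpDl// !mulr_ge0 ?norm1_ge0// ltW.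
move=> c g LCg.
have LCF := LC_abel_rhs (T := T) gam T0 a01 c LCg.
have [v [lv cv_ Ev]] := volterra_exists T LCG.1 LCF.1 LCG.2 LCF.2.
pose u := v \_ `]0, T[.
have LCv : LC v by [].
have LCu : LC u := LC_trunc T lv.
have uv : eq_ae T u v := eqT_trunc T v.
have Eu : eq_ae T u (fun t => abel_rhs T a gam c g t - convol G u t).
  apply: ae_impl3 uv Ev (eqT_convolr LCG LCu LCv uv) => t h1 h2 h3 tT.
  by rewrite h1// h2// h3.
exists u; split => //; first exact: supported_trunc.
  by apply/(abel_equiv T0 a01 gam0 LCK LCG bK c LCg LCu).
apply: (le_trans (HQ _ _ LCF.1 LCu.1 LCF.2 (@supported_trunc v) Eu)).
apply: (@le_trans _ _ (Q * (gam^-1 * norm1 b) * (`|c| + norm1 g))).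
  by rewrite -mulrA ler_wpM2l ?(ltW Q0)// norm1_abel_rhs.
by rewrite ler_wpM2r ?addr_ge0 ?norm1_ge0// lerDl.
Qed.

Context (C : R) (C0 : 0 <= C).
Context (G_le : forall t, `|G t| <= C * powT T (1/2) t).

Let ka := powT T (1/2).

Let LCka : LC ka.
Proof. by apply: LC_powT => //; lra. Qed.

(** Two applications of the kernel [t^(-1/2)] have a bounded kernel: this
    turns a bound in the mean into a pointwise bound. *)
Lemma bootstrap (A X : R -> R) : LC A -> LC X -> (forall t, 0 <= X t) ->
  {ae mu, forall t, t \in `]0, T[ -> X t <= A t + C * convol ka X t} ->
  {ae mu, forall t, t \in `]0, T[ ->
     X t <= A t + C * convol ka A t + C * C * Beta (1/2) (1/2) * norm1 X}.
Proof.
move=> LCA LCX X0 HX.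
have LkX := LC_convol LCka LCX; have LCkX := LC_Z C LkX.
have ka0 t : 0 <= ka t by exact: powT_ge0.
have m := convol_mono LCka ka0 LCX (LC_D LCA LCkX) HX.
have e1 := eqT_trans (eqT_convolDr T LCka LCA LCkX)
   (eqT_D (eqT_refl T (convol ka A)) (eqT_convolZr T C LCka LkX)).
have kk : eq_ae T (convol ka ka) (fun t => Beta (1/2) (1/2) * one T t).
  apply: eqT_fun => t tT; rewrite convol_powT//.
  rewrite /one truncE tT (_ : 1/2 + 1/2 - 1 = 0) ?powRr0//; lra.
have L1T := LC_one T; have LB1 := LC_Z (Beta (1/2) (1/2)) L1T.
have e2 := eqT_trans (eqT_sym (eqT_convolA T LCka LCka LCX))
  (eqT_convoll (LC_convol LCka LCka) LB1 LCX kk).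
have e3 := eqT_trans (eqT_convolC T LB1 LCX) (eqT_convolZr T (Beta (1/2) (1/2)) LCX L1T).
have e4 := eqT_trans e2 (eqT_trans e3 (eqT_Z _ (eqT_convolC T LCX L1T))).
have m2 : {ae mu, forall t, t \in `]0, T[ ->
    convol ka X t <= convol ka A t + C * (Beta (1/2) (1/2) * convol (one T) X t)}.
  apply: ae_impl3 m e1 e4 => t hm h1 h4 tT.
  by have := hm tT; rewrite h1// h4.
have B0 : 0 <= Beta (1/2) (1/2) :> R.
  by apply: Rintegral_ge0 => x _; exact: beta_weight_ge0.
apply: ae_impl2 HX m2 => t hX hm tT.
have tT' : t < T by move: tT; rewrite in_itv/= => /andP[].
have := norm_convol_one_le LCX tT' => /(le_trans (ler_norm _)) h1.
apply: (le_trans (hX tT)); rewrite -addrA lerD2l.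
apply: (@le_trans _ _ (C * (convol ka A t + C * (Beta (1/2) (1/2) * convol (one T) X t)))).
  by rewrite ler_wpM2l// hm.
rewrite mulrDr lerD2l -!mulrA !ler_wpM2l//.
Qed.

(** Apply [bootstrap] to [|u|] with [A = gam^-1 (|c| t^(a-1) + N)].  The term
    [t^(-1/2) * t^(a-1)] is a multiple of [t^(a-1/2)], which is less singular
    than [t^(a-1)]; the norm of [u] is bounded by that of [A], and its constant
    part by a multiple of [t^(a-1)], which is bounded below on [(0, T)]. *)
Lemma abel_pointwise : exists2 Q, 0 < Q & forall c g N u, LC g -> LC u ->
  supported u -> 0 <= N ->
  eq_ae T (convol K u) (fun t => c * one T t + convol (one T) g t) ->
  {ae mu, forall t, t \in `]0, T[ -> `|convol b g t| <= N} ->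
  {ae mu, forall t, t \in `]0, T[ -> `|u t| <= Q * (`|c| * t `^ (a - 1)) + Q * N}.
Proof.
have /andP[a0 a1] := a01; have L1T := LC_one T.
have [Q0 Q00 HQ] := volterra_bound T0 LCG.1 LCG.2.
(* [m] is the lower bound of [t^(a-1)], by which constants are absorbed. *)
pose m := T `^ (a - 1); have m0 : 0 < m by exact: powR_gt0.
pose B1 := Beta (1/2) (1/2) : R; pose B2 := Beta (1/2) a : R.
have B10 : 0 <= B1 by apply: Rintegral_ge0 => x _; exact: beta_weight_ge0.
have B20 : 0 <= B2 by apply: Rintegral_ge0 => x _; exact: beta_weight_ge0.
have nb := norm1_ge0 b; have nk := norm1_ge0 ka; have no := norm1_ge0 (one T).
have gi0' := ltW gi0; have Q0' := ltW Q00; have m0' : 0 <= m^-1 by rewrite invr_ge0 ltW.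
have T1 : 0 <= 1 + T by rewrite addr_ge0// ltW.
pose q3 := C * C * B1 * (Q0 * gam^-1).
have q30 : 0 <= q3 by rewrite !mulr_ge0.
pose Q1 := gam^-1 + C * (gam^-1 * (B2 * (1 + T))) + q3 * norm1 b * m^-1.
pose Q2 := gam^-1 + C * (gam^-1 * norm1 ka) + q3 * norm1 (one T).
have Q10 : 0 < Q1.
  by rewrite /Q1 -addrA ltr_wpDr// addr_ge0// !mulr_ge0.
have Q20 : 0 <= Q2 by rewrite /Q2 !addr_ge0 ?mulr_ge0.
exists (Q1 + Q2); first by rewrite ltr_wpDr.
move=> c g N u LCg LCu su N0 Eu0 HN.
have Eu := (abel_equiv T0 a01 gam0 LCK LCG bK c LCg LCu).1 Eu0.
pose A t := gam^-1 * (`|c| * b t + N * one T t).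
have LCA : LC A by apply: LC_Z; apply: LC_D; apply: LC_Z.
have one0 t : 0 <= one T t by rewrite /one truncE; case: ifP.
have A0 t : 0 <= A t.
  by rewrite mulr_ge0// addr_ge0// mulr_ge0// powT_ge0.
have rhsA : {ae mu, forall t, t \in `]0, T[ -> `|abel_rhs T a gam c g t| <= A t}.
  apply: ae_impl HN => t h tT; rewrite /abel_rhs normrM (gtr0_norm gi0).
  rewrite ler_wpM2l//; apply: (le_trans (ler_normD _ _)); apply: lerD.
    by rewrite normrM ler_wpM2l// ger0_norm// powT_ge0.
  move: (tT); rewrite in_itv/= => tT'.
  by rewrite /one truncE tT' mulr1 h.
have LCX := LC_abs LCu; have LCG' := LC_abs LCG.
have LCkX := LC_convol LCka LCX; have LCCk := LC_Z C LCka.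
have HX : {ae mu, forall t, t \in `]0, T[ -> `|u t| <= A t + C * convol ka (fun s => `|u s|) t}.
  have mono : {ae mu, forall t, t \in `]0, T[ ->
      convol (fun s => `|u s|) (fun s => `|G s|) t <= convol (fun s => `|u s|) (fun s => C * ka s) t}.
    apply: convol_mono => //.
    by apply: aeW => t _; exact: G_le.
  have e1 := eqT_trans (eqT_convolZr T C LCX LCka) (eqT_Z C (eqT_convolC T LCX LCka)).
  have h1 : {ae mu, forall t, t \in `]0, T[ -> `|convol G u t| <= C * convol ka (fun s => `|u s|) t}.
    have e2 : {ae mu, forall t, t \in `]0, T[ ->
        convol (fun s => `|G s|) (fun s => `|u s|) t <= C * convol ka (fun s => `|u s|) t}.
      apply: ae_impl3 mono e1 (eqT_convolC T LCG' LCX) => t hm h1 h2 tT.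
      by rewrite h2// -[leRHS](h1 tT) hm.
    apply: ae_impl2 e2 (ae_norm_convol LCG.1 LCu.1) => t h1 h2 tT.
    exact: le_trans h2 (h1 tT).
  apply: ae_impl3 Eu rhsA h1 => t hu hA h tT.
  rewrite hu//; apply: (le_trans (ler_normB _ _)).
  by apply: lerD; [exact: hA|exact: h].
have boot := bootstrap LCA LCX (fun t => normr_ge0 _) HX.
have nX : norm1 (fun s => `|u s|) <= Q0 * gam^-1 * (`|c| * norm1 b + N * norm1 (one T)).
  have -> : norm1 (fun s => `|u s|) = norm1 u.
    by apply: eq_Rintegral => x _; rewrite normr_id.
  pose F := abel_rhs T a gam c g \_ `]0, T[.
  have LCF : LC F := LC_trunc T (LC_abel_rhs (T := T) gam T0 a01 c LCg).1.
  have EF : eq_ae T u (fun t => F t - convol G u t).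
    apply: ae_impl2 Eu (eqT_trunc T (abel_rhs T a gam c g)) => t h1 h2 tT.
    by rewrite h1// /F h2.
  apply: (le_trans (HQ _ _ LCF.1 LCu.1 LCF.2 su EF)); rewrite -mulrA ler_wpM2l//.
  apply: (@le_trans _ _ (norm1 A)).
    apply: norm1_le_ae; [exact: LCF.1|exact: LCA.1|].
    apply: ae_impl rhsA => t h; rewrite /F truncE.
    case: ifPn => tT; last by rewrite normr0.
    by rewrite (ger0_norm (A0 t)) h// in_itv.
  rewrite /A norm1Z; last exact: (LC_D (LC_Z `|c| LCb) (LC_Z N L1T)).1.
  rewrite (gtr0_norm gi0) ler_wpM2l//.
  apply: (le_trans (norm1D (LC_Z `|c| LCb).1 (LC_Z N L1T).1)).
  rewrite !norm1Z ?normr_id ?(ger0_norm N0)//; [exact: L1T.1|exact: LCb.1].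
have Lcb := LC_Z `|c| LCb; have LN1 := LC_Z N L1T.
have eA := eqT_trans (eqT_convolZr T gam^-1 LCka (LC_D Lcb LN1))
  (eqT_Z gam^-1 (eqT_trans (eqT_convolDr T LCka Lcb LN1)
     (eqT_D (eqT_convolZr T `|c| LCka LCb)
        (eqT_trans (eqT_convolZr T N LCka L1T) (eqT_Z N (eqT_convolC T LCka L1T)))))).
apply: ae_impl2 boot eA => t hb hA tT.
move: (tT); rewrite in_itv/= => tT'; have /andP[t0 tT''] := tT'.
set tau := t `^ (a - 1).
have tau0 : 0 <= tau by exact: powR_ge0.
have kb : convol ka b t <= B2 * (1 + T) * tau.
  rewrite /ka /b convol_powT//.
  rewrite -mulrA ler_wpM2l// (_ : 1/2 + a - 1 = 1/2 + (a - 1)); last by ring.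
  rewrite (@powRD _ t (1/2)) ?(lt0r_neq0 t0) ?implybT// ler_wpM2r//.
  by rewrite -mul_isqrt// mul_isqrt_le.
have k1 : convol (one T) ka t <= norm1 ka.
  by apply: le_trans (ler_norm _) _; exact: norm_convol_one_le.
have ctau : 0 <= `|c| * tau by rewrite mulr_ge0.
have cm : `|c| <= `|c| * tau * m^-1.
  rewrite -mulrA ler_peMr// ler_pdivlMr// mul1r /m /tau.
  rewrite -(opprK (a - 1)) !(powRN _ (- (a - 1))) lef_pV2 ?posrE ?powR_gt0//.
  by apply: ge0_ler_powR; rewrite ?nnegrE ?ltW//; lra.
have AtE : A t = gam^-1 * (`|c| * tau) + gam^-1 * N.
  by rewrite /A /b powTE// /one truncE tT' [cst 1 t]/(1 : R) mulr1 mulrDr.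
have kA : convol ka A t <= gam^-1 * (B2 * (1 + T)) * (`|c| * tau) + gam^-1 * norm1 ka * N.
  rewrite (hA tT) mulrDr; apply: lerD.
    have -> : gam^-1 * (B2 * (1 + T)) * (`|c| * tau) =
        gam^-1 * (`|c| * (B2 * (1 + T) * tau)) by ring.
    by rewrite !ler_wpM2l.
  by rewrite -mulrA (mulrC (norm1 ka)) !ler_wpM2l.
have l3 : C * C * B1 * norm1 (fun s => `|u s|) <=
    q3 * norm1 b * m^-1 * (`|c| * tau) + q3 * norm1 (one T) * N.
  apply: (@le_trans _ _ (q3 * (`|c| * norm1 b + N * norm1 (one T)))).
    by rewrite /q3 -(mulrA (C * C * B1)) ler_wpM2l// !mulr_ge0.
  rewrite mulrDr; apply: lerD; last by rewrite -mulrA (mulrC N).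
  have -> : q3 * norm1 b * m^-1 * (`|c| * tau) = q3 * (`|c| * tau * m^-1 * norm1 b) by ring.
  by rewrite ler_wpM2l// ler_wpM2r.
apply: (le_trans (hb tT)).
have l2 : C * convol ka A t <= C * (gam^-1 * (B2 * (1 + T))) * (`|c| * tau) +
    C * (gam^-1 * norm1 ka) * N.
  by rewrite -!(mulrA C) -mulrDr ler_wpM2l.
have : A t + C * convol ka A t + C * C * B1 * norm1 (fun s => `|u s|) <=
    Q1 * (`|c| * tau) + Q2 * N.
  rewrite AtE /Q1 /Q2 !mulrDl.
  move: l2 l3; lra.
move=> /le_trans; apply; apply: lerD.
  by rewrite ler_wpM2r// lerDl.
by rewrite ler_wpM2r// lerDr ltW.
Qed.

End abel_estimates.

(** * Lebesgue norms, initial values and Hoelder's inequality on an interval *)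

Section lebesgue_norms.
Context {R : realType}.
Local Notation mu := (@lebesgue_measure R).
Implicit Types (f g h u v w k : R -> R) (t x y z s c N T p q : R).

Lemma in_L1E T f : in_Lp T 1 f <-> L1 (f \_ `]0, T[).
Proof. exact: Lfun1_integrable. Qed.

Lemma L1_normE T f : L1 (f \_ `]0, T[) -> Lp_norm T 1 f = (norm1 (f \_ `]0, T[))%:E.
Proof. by move=> lf; rewrite /Lp_norm Lnorm1 norm1E. Qed.

Lemma Lp_norm_ge0 T p f : (0 <= Lp_norm T p f)%E.
Proof. exact: Lnorm_ge0. Qed.

Lemma LC_of_L1_trunc T f : L1 (f \_ `]0, T[) -> LC (f \_ `]0, T[).
Proof. by move=> lf; split => //; exact: causal_trunc. Qed.

Lemma convolutionE T k u t : measurable_fun setT (k \_ `]0, T[) ->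
  measurable_fun setT (u \_ `]0, T[) -> 0 < t < T ->
  convolution k u t = convol (k \_ `]0, T[) (u \_ `]0, T[) t.
Proof.
move=> mk mu_ /andP[t0 tT]; rewrite /convolution /convol.
set k' := k \_ _ in mk *; set u' := u \_ _ in mu_ *.
have E s : s \in `]0, t[%classic -> k (t - s) * u s = k' (t - s) * u' s.
  move=> /set_mem; rewrite /= in_itv/= => /andP[s0 st].
  rewrite /k' /u' !truncE ifT; last by apply/andP; split; lra.
  by rewrite ifT//; apply/andP; split; lra.
have mku : measurable_fun `]0, t[ (fun s => k (t - s) * u s).
  apply: (eq_measurable_fun (fun s => k' (t - s) * u' s)).
    by move=> s st; rewrite E.
  by apply: measurable_funTS; exact: measurable_convol_section.
rewrite [LHS]/Rintegral integral_itv_bndoo; last exact/measurable_EFinP.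
rewrite -[LHS]/(\int[mu]_(s in `]0, t[) (k (t - s) * u s)).
rewrite (@eq_Rintegral _ _ _ mu _ (fun s => k' (t - s) * u' s)); last first.
  by move=> s st; rewrite E.
rewrite Rintegral_mkcond; apply: eq_Rintegral => s _; rewrite patchE.
case: ifPn => // /negP ns.
have [s0|s0] := leP s 0; first by rewrite /u' (causal_trunc _ _ s0) mulr0.
have [ts|st] := leP t s.
  by rewrite (_ : k' (t - s) = 0) ?mul0r// /k' causal_trunc// subr_le0.
by exfalso; apply: ns; apply: mem_set; rewrite /= in_itv/= s0.
Qed.

Lemma continuous_ae_eq_at0 T f g : 0 < T ->
  {within `[0, T], continuous f} -> {within `[0, T], continuous g} ->
  eq_ae T f g -> f 0 = g 0.
Proof.
move=> T0 /subspace_continuousP cf /subspace_continuousP cg fg.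
have D0 : `[0, T]%classic (0 : R) by rewrite /= in_itv/= lexx ltW.
apply/eqP; rewrite -subr_eq0; apply/negPn/negP => n0.
have e0 : 0 < `|f 0 - g 0| / 2 by rewrite divr_gt0// normr_gt0.
have /cvgrPdist_lt/(_ _ e0)[d1 /= d10 h1] := cf 0 D0.
have /cvgrPdist_lt/(_ _ e0)[d2 /= d20 h2] := cg 0 D0.
have m0 : 0 < Num.min T (Num.min d1 d2) by rewrite !lt_min T0 d10.
have [x /andP[x0]] := ae_ex_itv m0 fg.
rewrite !lt_min => /and3P[xT x1 x2] fgx.
have Dx : `[0, T]%classic x by rewrite /= in_itv/= !ltW.
have b1 : ball_ [eta Num.Def.normr] 0 d1 x by rewrite /= sub0r normrN gtr0_norm.
have b2 : ball_ [eta Num.Def.normr] 0 d2 x by rewrite /= sub0r normrN gtr0_norm.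
have q1 : `|f 0 - f x| < `|f 0 - g 0| / 2 := h1 x b1 Dx.
have q2 : `|g 0 - g x| < `|f 0 - g 0| / 2 := h2 x b2 Dx.
rewrite fgx ?in_itv/= ?x0 ?xT// in q1.
have : `|f 0 - g 0| <= `|f 0 - g x| + `|g 0 - g x|.
  have -> : f 0 - g 0 = (f 0 - g x) - (g 0 - g x) by ring.
  exact: ler_normB.
lra.
Qed.

(** Two continuous representatives agree at 0, and [c + 1 * g] is one. *)
Lemma value_at0E T f g c : 0 < T -> LC g ->
  eq_ae T f (fun t => c + convol (one T) g t) -> value_at0 T f = c.
Proof.
move=> T0 [lg cg] fE.
pose F t := c + parameterized_integral mu 0 t g.
have cF : {within `[0, T], continuous F}.
  move=> t; apply: cvgD; first exact: cvg_cst.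
  have := @parameterized_integral_continuous R 0 T g (ltW T0)
    (L1_on (measurable_itv _) lg).
  exact.
have F0 : F 0 = c.
  rewrite /F /parameterized_integral set_itv1 Rintegral_set1 addr0//.
have fF : eq_ae T f F.
  apply: ae_impl fE => t ft tT; rewrite ft// /F.
  move: tT; rewrite in_itv/= => /andP[t0 tT].
  rewrite convol_oneE//; congr (_ + _); rewrite /parameterized_integral.
  rewrite Rintegral_mkcond [RHS]Rintegral_mkcond; apply: eq_Rintegral => s _.
  rewrite !patchE !mem_setE !in_itv/=.
  have [s0|s0] := ltP s 0; last by [].
  by rewrite cg ?(ltW s0)//= if_same.
have ex : [set c | exists g, [/\ {within `[0, T], continuous g},
     eq_ae T f g & g 0 = c]] c by exists F.
have [G [cG fG GE]] := xgetPex 0 (ex_intro _ c ex).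
rewrite /value_at0 -GE -F0; apply: continuous_ae_eq_at0 cG cF _ => //.
exact: eqT_trans (eqT_sym fG) fF.
Qed.

Lemma locally_integrable_trunc T f : locally_integrable `]0, T[ f ->
  measurable_fun setT (f \_ `]0, T[).
Proof. by move=> [mf _ _]; exact: (measurable_restrictT f (measurable_itv `]0, T[)).1. Qed.

(** On a bounded interval [|f|] is at most the integrable function
    [1 + |f| `^ p]. *)
Lemma L1_of_Lp_norm T p f : 1 <= p -> measurable_fun setT (f \_ `]0, T[) ->
  (Lp_norm T p f < +oo)%E -> L1 (f \_ `]0, T[).
Proof.
move=> p1 mf np; set F := f \_ _ in mf np *.
have : F \in Lfun mu p%:E.
  by rewrite inE; apply/andP; split; rewrite inE.
move=> /(Lfun_integrable p1) iF.
apply: (L1_le mf _ (L1D (L1_one T) (iF : L1 (fun x => `|F x| `^ p)))).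
move=> x; rewrite [leRHS]ger0_norm; last first.
  by rewrite addr_ge0 ?powR_ge0// /one truncE; case: ifP.
rewrite /F /one !truncE; case: ifP => xT; last by rewrite normr0 add0r powR_ge0.
have [f1|f1] := leP `|f x| 1.
  by rewrite (le_trans f1)// lerDl powR_ge0.
apply: (@le_trans _ _ (`|f x| `^ p)); last by rewrite lerDr.
by apply: le1r_powR => //; exact: ltW.
Qed.

(** Hoelder's inequality: [t^(a-1)] is in the space dual to [L^p] as soon as
    [p > 1/a]. *)
Lemma convol_powT_hoelder T a p : 0 < T -> 0 < a < 1 -> 0 < p -> p^-1 < a ->
  exists2 M : R, 0 <= M & forall g, L1 (g \_ `]0, T[) ->
    (Lp_norm T p g < +oo)%E ->
    {ae mu, forall t, t \in `]0, T[ ->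
       `|convol (powT T a) (g \_ `]0, T[) t| <= M * fine (Lp_norm T p g)}.
Proof.
move=> T0 /andP[a0 a1] p0 pa.
pose q := (1 - p^-1)^-1; have q0 : 0 < q by rewrite invr_gt0; lra.
have pq : q^-1 + p^-1 = 1 by rewrite /q invrK; ring.
have e0 : 0 < (a - 1) * q + 1.
  have d0 : 0 < 1 - p^-1 by lra.
  rewrite -(ltr_pM2r d0) mul0r mulrDl -mulrA mulVf ?lt0r_neq0//; lra.
have bq s : `|powT T a s| `^ q = powT T ((a - 1) * q + 1) s.
  rewrite ger0_norm ?powT_ge0// /powT !truncE; case: ifPn => _; last first.
    by rewrite powR0// lt0r_neq0.
  by rewrite -powRrM; congr (_ `^ _); ring.
pose I := (\int[mu]_s (`|powT T a s| `^ q)%:E)%E.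
have lI : L1 (fun s => `|powT T a s| `^ q).
  by rewrite (_ : (fun s => _) = powT T ((a - 1) * q + 1));
    [exact: L1_powT|apply/funext => s; exact: bq].
have I0 : (0 <= I)%E by apply: integral_ge0 => s _; rewrite lee_fin powR_ge0.
have Ify : (I < +oo)%E.
  have := L1_abs_lty lI; apply: le_lt_trans; rewrite /I.
  by rewrite le_eqVlt; apply/orP; left; apply/eqP; apply: eq_integral => s _;
    rewrite [in RHS]ger0_norm ?powR_ge0.
have IE t : (\int[mu]_s (`|powT T a (t - s)| `^ q)%:E)%E = I.
  rewrite /I [RHS](@ge0_integral_affine _ (-1) t) ?oppr_eq0 ?oner_eq0//.
  - rewrite normrN1 mul1e; apply: eq_integral => s _.
    by rewrite mulN1r addrC.
  - by apply/measurable_EFinP; exact: L1_measurable lI.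
have NE t : 'N[mu]_q%:E[EFin \o (fun s => powT T a (t - s))]%E = (I `^ q^-1)%E.
  by rewrite unlock -(IE t).
have Mfin : (I `^ q^-1 < +oo)%E by exact: poweR_lty.
have M0 : (0 <= I `^ q^-1)%E by exact: poweR_ge0.
exists (fine (I `^ q^-1)); first exact: fine_ge0.
move=> g lg gp; apply: ae_impl (convol_ae_integrable (L1_powT T0 a0) lg) => t it _.
have mb : measurable_fun [set: R] (fun s => powT T a (t - s)).
  by apply: (measurableT_comp (measurable_powT T a)); exact: measurable_funB.
have H := hoelder mu mb (L1_measurable lg) q0 p0 pq.
rewrite NE Lnorm1 in H.
rewrite -lee_fin EFinM !fineK; last 2 first.
- by rewrite ge0_fin_numE ?Lp_norm_ge0.
- by rewrite ge0_fin_numE.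
apply: le_trans H; rewrite EFin_normr_Rintegral//.
exact: (le_abse_integral _ _ (measurable_int mu it)).
Qed.

End lebesgue_norms.

(** * Factorization of the variable-exponent kernel *)

Section kernel_facts.
Context {R : realType}.
Local Notation mu := (@lebesgue_measure R).
Context (T L : R) (alpha alpha' alpha'' : R -> R).
Context (T0 : 0 < T) (L0 : 0 < L).
Context (alpha01 : forall t, t \in `[0, T] -> 0 < alpha t < 1).
Context (dalpha : is_derivative_on `[0, T] alpha alpha').
Context (dalpha' : is_derivative_on `[0, T] alpha' alpha'').
Context (alpha'_le : forall t, t \in `[0, T] -> `|alpha' t| <= L).

Let a0 := alpha 0.

Let a01 : 0 < a0 < 1.
Proof. by apply: alpha01; rewrite in_itv/= lexx ltW. Qed.

Lemma kernel_truncE : Defs.kernel alpha \_ `]0, T[ =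
  (fun s => s `^ (- a0) * regular_factor alpha s) \_ `]0, T[.
Proof.
by apply/funext => s; rewrite !truncE; case: ifP => // sT; rewrite (kernel_factor _ sT).
Qed.

Lemma LC_kernel : LC (Defs.kernel alpha \_ `]0, T[).
Proof.
split; last exact: causal_trunc.
have a1 : 0 < 1 - a0 by move: a01; lra.
have mh := measurable_regular_factor alpha01 dalpha.
have -> : Defs.kernel alpha \_ `]0, T[ =
    (fun s => powT T (1 - a0) s * (regular_factor alpha \_ `]0, T[) s).
  apply/funext => s; rewrite kernel_truncE /powT !truncE; case: ifP => _; last by rewrite mulr0.
  by congr (_ `^ _ * _); ring.
apply: (@L1_mul_bounded _ (expo_bound T L * expR 1)) => //; last exact: L1_powT.
move=> s; rewrite truncE; case: ifPn => [sT|_].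
  exact: (regular_factor_bounded T0 L0 alpha01 dalpha alpha'_le sT).
by rewrite normr0 mulr_ge0// expR_ge0.
Qed.

(** The conjugate power removes the singularity of the kernel: what is
    left is a positive constant and a primitive, with a derivative [G] whose
    singularity is integrable. *)
Lemma kernel_factorization : exists gam C G,
  [/\ 0 < gam, 0 <= C, LC G, forall t, `|G t| <= C * powT T (1/2) t &
   eq_ae T (convol (powT T a0) (Defs.kernel alpha \_ `]0, T[))
     (fun t => gam * (one T t + convol (one T) G t))].
Proof.
have [C C0 HC] := regular_factor'_le T0 L0 alpha01 dalpha alpha'_le.
have mh := measurable_regular_factor alpha01 dalpha.
have hb s := @regular_factor_bounded _ _ _ _ _ T0 L0 alpha01 dalpha alpha'_le s.
have lh' := L1_regular_factor' T0 L0 alpha01 dalpha dalpha' alpha'_le.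
have hE s := @regular_factorE _ _ _ _ _ _ T0 L0 alpha01 dalpha dalpha' alpha'_le s.
have h0 := regular_factor0_gt0 T0 alpha01.
have /andP[a00 a11] := a01.
have B1 : 1 <= Beta a0 (1 - a0) by apply: Beta_ge1; lra.
have B0 : 0 < Beta a0 (1 - a0) by exact: lt_le_trans B1.
pose gam := regular_factor alpha 0 * Beta a0 (1 - a0).
have gam0 : 0 < gam by exact: mulr_gt0.
pose G0 := conv_derivative T a0 (regular_factor' alpha alpha').
have LCG0 : LC G0.
  split; last exact: causal_conv_derivative.
  exact: (L1_conv_derivative T0 a01 (ltW C0) lh' HC).
exists gam, (gam^-1 * (C * Beta a0 (1 - a0))), (fun t => gam^-1 * G0 t).
split => //.
- by rewrite !mulr_ge0 ?invr_ge0// ltW.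
- exact: LC_Z.
- move=> t; rewrite normrM gtr0_norm ?invr_gt0// -mulrA ler_wpM2l ?invr_ge0 ?(ltW gam0)//.
  exact: (conv_derivative_le a01 (ltW C0) lh' HC).
apply: ae_impl (eqT_convolZr T gam^-1 (LC_one T) LCG0) => t h tT; rewrite h//.
move: tT; rewrite in_itv/= => tT; rewrite kernel_truncE.
rewrite (convol_powT_factor T0 a01 (ltW C0) mh hb lh' HC hE tT).
by rewrite /one truncE tT mulrDr mulr1 mulrA divff ?mul1r// lt0r_neq0.
Qed.

End kernel_facts.

(** * Functions with an integrable weak derivative *)

Section sobolev.
Context {R : realType}.
Local Notation mu := (@lebesgue_measure R).
Implicit Types (f g : R -> R) (T p c : R).

Lemma weak_derivativeP T p f : in_W1p T p f ->
  is_weak_derivative T f (weak_derivative T f).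
Proof. by move=> [_ [g gE _]]; apply: (xgetPex (cst 0)); exists g. Qed.

Lemma primitive_of_weak_derivative T f g : 0 < T -> L1 (f \_ `]0, T[) ->
  L1 (g \_ `]0, T[) -> is_weak_derivative T f g ->
  exists c, eq_ae T f (fun t => c * one T t + convol (one T) (g \_ `]0, T[) t).
Proof.
move=> T0 lf lg wd; have [c cE] := weak_derivative_primitive T0 lf lg wd.
exists c; apply: ae_impl cE => t h tT; rewrite h//.
by move: tT; rewrite in_itv/= /one truncE => ->; rewrite mulr1.
Qed.

(** On [(0, T)] the constant [c] is [f - 1 * g], and the primitive of [g] is
    at most [norm1 g]; integrate over the interval. *)
Lemma initial_value_le T f g c : 0 < T -> LC f -> LC g ->
  eq_ae T f (fun t => c * one T t + convol (one T) g t) ->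
  `|c| <= T^-1 * norm1 f + norm1 g.
Proof.
move=> T0 LCf LCg fE; have L1T := LC_one T.
have n1one : norm1 (one T) = T.
  have m1 : fine (mu `]0, T[%classic) = T.
    by rewrite lebesgue_measure_itv/= lte_fin T0 oppr0 adde0.
  have -> : norm1 (one T) = \int[mu]_x one T x.
    apply: eq_Rintegral => x _; rewrite /one truncE; case: ifP => _; first by rewrite normr1.
    by rewrite normr0.
  by rewrite /one -Rintegral_mkcond Rintegral_cst// [X in _ * X]m1 mul1r.
have key : norm1 (fun t => c * one T t) <= norm1 f + norm1 g * norm1 (one T).
  have -> : norm1 g * norm1 (one T) = norm1 (fun t => norm1 g * one T t).
    by rewrite norm1Z ?ger0_norm ?norm1_ge0//; exact: L1T.1.
  have Lf' := LC_abs LCf; have Lg1 := LC_Z (norm1 g) L1T.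
  have -> : norm1 f = norm1 (fun x => `|f x|).
    by apply: eq_Rintegral => x _; rewrite normr_id.
  apply: le_trans (norm1D Lf'.1 Lg1.1).
  apply: norm1_le_ae; [exact: (LC_Z c L1T).1|exact: (LC_D Lf' Lg1).1|].
  apply: ae_impl fE => t h.
  have [tT|nt] := boolP (0 < t < T); last first.
    by rewrite {1}/one truncE (negbTE nt) mulr0 normr0.
  have -> : c * one T t = f t - convol (one T) g t by rewrite h ?in_itv//; ring.
  have one1 : one T t = 1 by rewrite /one truncE tT.
  rewrite one1 mulr1 [leRHS]ger0_norm ?addr_ge0 ?norm1_ge0//.
  apply: (le_trans (ler_normB _ _)); rewrite lerD2l.
  by apply: norm_convol_one_le => //; case/andP: tT.
rewrite norm1Z ?n1one in key; last exact: L1T.1.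
by rewrite -(ler_pM2r T0) mulrDl mulrAC mulVf ?mul1r// lt0r_neq0.
Qed.

End sobolev.

Theorem theorem10 (R : realType) (alpha0 : R) (halpha0 : 0 < alpha0 < 1) :
  exists2 sigma0 : R, 0 < sigma0 <= alpha0 &
  forall (T L : R) (alpha alpha' alpha'' alpha''' : R -> R),
  0 < T -> 0 < L ->
  (forall t, t \in `[0, T] -> 0 < alpha t < 1) ->
  is_derivative_on `[0, T] alpha alpha' ->
  is_derivative_on `[0, T] alpha' alpha'' ->
  is_derivative_on `[0, T] alpha'' alpha''' ->
  (forall t, t \in `[0, T] ->
     `|alpha' t| + `|alpha'' t| + `|alpha''' t| <= L) ->
  alpha 0 = alpha0 ->
  (exists2 Q : R, 0 < Q &
     forall f : R -> R, in_W1p T 1 f ->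
     exists u : R -> R,
       [/\ Abel_solution T alpha f u,
           forall v : R -> R, Abel_solution T alpha f v ->
             eq_ae T v u &
           (Lp_norm T 1 u <= Q%:E * W1p_norm T 1 f)%E])
  /\
  (forall sigma : R, 0 < sigma < sigma0 ->
   exists2 Q : R, 0 < Q &
     forall f u : R -> R,
       in_W1p T 1 f -> in_W1p T (alpha0 - sigma)^-1 f ->
       Abel_solution T alpha f u ->
       {ae lebesgue_measure, forall t, t \in `]0, T] ->
         (`|u t|%:E <=
            (Q * `|value_at0 T f| * t `^ (alpha0 - 1))%:E
            + Q%:E * Lp_norm T (alpha0 - sigma)^-1 (weak_derivative T f))%E}).
Proof.
(* Every [sigma] below [alpha0] is admissible: [1 / (alpha0 - sigma)] exceeds
   [1 / alpha0], which is all that Hoelder's inequality asks for. *)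
exists alpha0; first by case/andP: halpha0 => -> _ /=.
move=> T L alpha alpha' alpha'' alpha''' T0 L0 alpha01 da da' _ aL a0E.
have aL' t : t \in `[0, T] -> `|alpha' t| <= L.
  move=> /aL; apply: le_trans; rewrite -addrA lerDl addr_ge0//.
have LCK := LC_kernel T0 L0 alpha01 da aL'.
have [gam [C [G [gam0 C0 LCG GC bK]]]] := kernel_factorization T0 L0 alpha01 da da' aL'.
rewrite a0E in bK.
set K := Defs.kernel alpha \_ _ in LCK bK.
have solE f u : in_Lp T 1 u ->
    eq_ae T (convolution (Defs.kernel alpha) u) f <-> eq_ae T (convol K (u \_ `]0, T[)) f.
  move=> /in_L1E lu; have E : eq_ae T (convolution (Defs.kernel alpha) u) (convol K (u \_ `]0, T[)).
    by apply: eqT_fun => t tT; apply: convolutionE => //;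
      [exact: L1_measurable LCK.1|exact: L1_measurable].
  by split => H; [exact: eqT_trans (eqT_sym E) H|exact: eqT_trans E H].
split.
- have [Q Q0 HQ] := abel_L1 T0 halpha0 gam0 LCK LCG bK.
  have Ti0 : 0 < T^-1 by rewrite invr_gt0.
  exists (Q * (T^-1 + 2)); first by rewrite mulr_gt0// addr_gt0.
  move=> f fW; have [fL [g0 g0E g0L]] := fW.
  have lf := (in_L1E T f).1 fL; have LCf := LC_of_L1_trunc lf.
  have wdE := weak_derivativeP fW.
  (* Weak derivatives are unique up to null sets, but a case distinction spares
     the proof: if the norm of the chosen one is infinite the bound is trivial,
     and the integrable one given with [f] yields the solution; otherwise the
     chosen one is integrable itself. *)
  have build g : L1 (g \_ `]0, T[) -> is_weak_derivative T f g -> exists u,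
     [/\ Abel_solution T alpha f u,
           forall v : R -> R, Abel_solution T alpha f v -> eq_ae T v u,
           L1 (u \_ `]0, T[) &
           norm1 (u \_ `]0, T[) <= Q * (T^-1 + 2) *
             (norm1 (f \_ `]0, T[) + norm1 (g \_ `]0, T[))].
    move=> lg gE; have LCg := LC_of_L1_trunc lg.
    have [c cE] := primitive_of_weak_derivative T0 lf lg gE.
    have [u [LCu su uE un]] := HQ c _ LCg.
    have uu : u \_ `]0, T[ = u.
      by apply/funext => t; rewrite truncE; case: ifPn => // /su ->.
    have uL : in_Lp T 1 u by apply/in_L1E; rewrite uu; exact: LCu.1.
    exists u; split.
    + split => //; apply/solE => //; rewrite uu.
      exact: eqT_trans uE (eqT_sym cE).
    + move=> v [vL /(solE _ _ vL) vE].
      have lv := (in_L1E T v).1 vL; have LCv := LC_of_L1_trunc lv.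
      apply: eqT_trans (eqT_sym (eqT_trunc T v)) _.
      apply: (abel_unique T0 halpha0 gam0 LCK LCG bK LCg LCv LCu _ su _ uE).
        exact: supported_trunc.
      exact: eqT_trans vE cE.
    + by rewrite uu; exact: LCu.1.
    + rewrite uu; apply: (le_trans un); rewrite -mulrA ler_wpM2l ?(ltW Q0)//.
      have fcE : eq_ae T (f \_ `]0, T[) (fun t => c * one T t + convol (one T) (g \_ `]0, T[) t).
        exact: eqT_trans (eqT_trunc T f) cE.
      have := initial_value_le T0 LCf LCg fcE.
      have := norm1_ge0 (f \_ `]0, T[); have := norm1_ge0 (g \_ `]0, T[).
      move: Ti0; set nf := norm1 (f \_ _); set ng := norm1 (g \_ _); move=> Ti0 ng0 nf0 hc.
      have h1 : 0 <= T^-1 * ng by rewrite mulr_ge0// ltW.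
      rewrite mulrDl mulrDr; lra.
  have mwd := locally_integrable_trunc (let: And3 _ h _ := wdE in h).
  have finish u g : L1 (u \_ `]0, T[) ->
      norm1 (u \_ `]0, T[) <= Q * (T^-1 + 2) * (norm1 (f \_ `]0, T[) + norm1 (g \_ `]0, T[)) ->
      ((norm1 (g \_ `]0, T[))%:E <= Lp_norm T 1 (weak_derivative T f))%E ->
      (Lp_norm T 1 u <= (Q * (T^-1 + 2))%:E * W1p_norm T 1 f)%E.
    move=> lu un gw; rewrite L1_normE// /W1p_norm (L1_normE lf).
    apply: (@le_trans _ _ ((Q * (T^-1 + 2))%:E *
        ((norm1 (f \_ `]0, T[))%:E + (norm1 (g \_ `]0, T[))%:E))%E).
      by rewrite -EFinD -EFinM lee_fin.
    by apply: lee_wpmul2l; [rewrite lee_fin !mulr_ge0 ?addr_ge0 ?ltW|exact: leeD].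
  have [wy|wfin] := eqVneq (Lp_norm T 1 (weak_derivative T f)) +oo%E.
    have [u [u1 u2 u3 u4]] := build g0 ((in_L1E T g0).1 g0L) g0E.
    by exists u; split => //; apply: finish u3 u4 _; rewrite wy leey.
  have lwd : L1 (weak_derivative T f \_ `]0, T[).
    by apply: (L1_of_Lp_norm (lexx 1) mwd); rewrite ltey.
  have [u [u1 u2 u3 u4]] := build _ lwd wdE.
  by exists u; split => //; apply: finish u3 u4 _; rewrite L1_normE.
- move=> sigma /andP[s0 sa]; have /andP[a00 a11] := halpha0.
  set p := (alpha0 - sigma)^-1.
  have p0 : 0 < p by rewrite invr_gt0 subr_gt0.
  have p1 : 1 <= p by rewrite -invr1 lef_pV2 ?posrE//; lra.
  have pa : p^-1 < alpha0 by rewrite invrK; lra.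
  have [Q Q0 HQ] := abel_pointwise T0 halpha0 gam0 LCK LCG bK C0 GC.
  have [M M0 HM] := convol_powT_hoelder T0 halpha0 p0 pa.
  have M1 : 0 < M + 1 by rewrite ltr_wpDl.
  exists (Q * (M + 1)); first exact: mulr_gt0.
  move=> f u fW fWp [uL uE].
  have wdE := weak_derivativeP fW.
  have [wy|wfin] := eqVneq (Lp_norm T p (weak_derivative T f)) +oo%E.
    by apply: aeW => t _; rewrite wy mulry gtr0_sg ?mulr_gt0// mul1e addey// leey.
  have lf := (in_L1E T f).1 fW.1.
  have mwd := locally_integrable_trunc (let: And3 _ h _ := wdE in h).
  have wlt : (Lp_norm T p (weak_derivative T f) < +oo)%E by rewrite ltey.
  have lwd := L1_of_Lp_norm p1 mwd wlt.
  have LCwd := LC_of_L1_trunc lwd.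
  have [c cE] := primitive_of_weak_derivative T0 lf lwd wdE.
  have cE' : eq_ae T f (fun t => c + convol (one T) (weak_derivative T f \_ `]0, T[) t).
    apply: ae_impl cE => t h tT; rewrite h//.
    by move: tT; rewrite in_itv/= /one truncE => ->; rewrite mulr1.
  have -> := value_at0E T0 LCwd cE'.
  have lu := (in_L1E T u).1 uL; have LCu := LC_of_L1_trunc lu.
  have uE' := eqT_trans ((solE f u uL).1 uE) cE.
  set N := fine (Lp_norm T p (weak_derivative T f)).
  have NE : Lp_norm T p (weak_derivative T f) = N%:E.
    by rewrite fineK// ge0_fin_numE ?Lp_norm_ge0.
  have N0 : 0 <= N by rewrite fine_ge0// Lp_norm_ge0.
  have MN0 : 0 <= M * N by exact: mulr_ge0.
  have := HQ c _ (M * N) _ LCwd LCu (@supported_trunc _ T u) MN0 uE' (HM _ lwd wlt).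
  have aeT : {ae lebesgue_measure, forall t : R, t != T}.
    exists [set T]; split => //; first exact: lebesgue_measure_set1.
    by move=> t /= /negP; rewrite negbK => /eqP.
  apply: (ae_impl2 _ aeT) => t tnT h; rewrite in_itv/= => /andP[t0 tT].
  have tT' : 0 < t < T by rewrite t0/= lt_neqAle tnT.
  have := h; rewrite in_itv/= => /(_ tT'); rewrite truncE tT' => hu.
  rewrite NE -EFinM -EFinD lee_fin; apply: (le_trans hu).
  have ct : 0 <= `|c| * t `^ (alpha0 - 1) by rewrite mulr_ge0// powR_ge0.
  apply: lerD.
    rewrite -[leRHS]mulrA -mulrA ler_wpM2l ?(ltW Q0)// ler_peMl//; lra.
  by rewrite -mulrA ler_wpM2l ?(ltW Q0)// ler_wpM2r//; lra.
Qed.
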